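(* Suppose $\Omega\subseteq\mathbb{R}^d$ is closed and convex, the weighted graph $\mathcal{G}$ is connected and symmetric, and the interpolation function $\theta$ satisfies (A1)–(A7). Then for every $\boldsymbol{\mu},\boldsymbol{\nu}\in\mathcal{P}_2(\Omega\times\mathcal{G})$, $$W_{\Omega\times\mathcal{G}}(\boldsymbol{\mu},\boldsymbol{\nu})\le D_{\mathbb{R}^d\times\mathcal{G}}(\boldsymbol{\mu},\boldsymbol{\nu})\le W_{2,\mathcal{W}}(\boldsymbol{\mu},\boldsymbol{\nu}).$$
   Context: Graph. $\mathcal{G}$ is a weighted graph with nodes $\{1,\dots,n\}$ and edge weights $q_{ij}\ge 0$. It is symmetric if $q_{ij}=q_{ji}$ and connected if any two nodes are joined by a finite sequence of edges with strictly positive weights. Interpolation function. Assumptions on $\theta:[0,\infty)\times[0,\infty)\to[0,\infty)$: (A1) $\theta$ is continuous on $[0,\infty)^2$ and $C^\infty$ on $(0,\infty)^2$; (A2) $\theta(t,s)=\theta(s,t)$; (A3) $\theta>0$ on $(0,\infty)^2$; (A4) $\theta(1,1)=1$; (A5) $\theta(r,t)\le\theta(s,t)$ for $t\ge0$, $0\le r\le s$; (A6) $\theta(\lambda t,\lambda s)=\lambda\theta(t,s)$ for $\lambda>0$, $t,s\ge0$; (A7) $\theta$ is concave. Vector valued measures. $\mathcal{M}(\Omega)$ denotes the finite (nonnegative) Borel measures on $\Omega$. $\mathcal{P}(\Omega\times\mathcal{G})$ is the set of $\boldsymbol{\mu}=[\mu_1,\dots,\mu_n]^t$ with $\mu_i\in\mathcal{M}(\Omega)$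 and $\sum_i\mu_i(\Omega)=1$, with the topology of componentwise narrow convergence; $\bar\mu:=\sum_i\mu_i$. $\mathcal{P}_2(\Omega\times\mathcal{G})$ is the subset with $\int_\Omega|x|^2d\mu_i<\infty$ for all $i$. Measures on $\Omega$ are regarded as measures on $\mathbb{R}^d$ by zero extension, so $\mathcal{P}(\Omega\times\mathcal{G})\subseteq\mathcal{P}(\mathbb{R}^d\times\mathcal{G})$. Vector valued continuity equation. $(\boldsymbol{\rho},\mathbf{u},\boldsymbol{v})$ is a solution on $[t_0,t_1]$ if: (i) $\boldsymbol{\rho}\in C([t_0,t_1];\mathcal{P}(\Omega\times\mathcal{G}))$; (ii) $\mathbf{u}=[u_i]_{i=1}^n:\mathbb{R}^d\times[t_0,t_1]\to(\mathbb{R}^d)^n$ is measurable with $\int_{t_0}^{t_1}\int_\Omega|u_{i,t}|\,d\rho_{i,t}\,dt<\infty$ for all $i$; (iii) $\boldsymbol{v}=[v_{ij}]:\mathbb{R}^d\times[t_0,t_1]\to\mathbb{R}^{n\times n}$ is measurable with $\int_{t_0}^{t_1}\int_\Omega|v_{ij,t}|\,\theta(\frac{d\rho_{i,t}}{d\bar\rho_t},\frac{d\rho_{j,t}}{d\bar\rho_t})\,d\bar\rho_t\,dt<\infty$ for all $i,j$; (iv) for all $\eta\in C_c^\infty(\mathbb{R}^d\times(t_0,t_1))$ and all $i$, $$\int_{t_0}^{t_1}\!\!\int\partial_t\eta\,d\rho_{i,t}dt=-\int_{t_0}^{t_1}\!\!\int\nabla\eta\cdot u_{i,t}\,d\rho_{i,t}dt-\frac12\sum_{j=1}^n\int_{t_0}^{t_1}\!\!\int\eta\,\theta\Big(\frac{d\rho_{i,t}}{d\bar\rho_t},\frac{d\rho_{j,t}}{d\bar\rho_t}\Big)(v_{ij,t}-v_{ji,t})q_{ij}\,d\bar\rho_t\,dt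 .$$ $\mathcal{C}(\boldsymbol{\mu},\boldsymbol{\nu})$ is the set of solutions on $[0,1]$ with $\boldsymbol{\rho}_0=\boldsymbol{\mu}$, $\boldsymbol{\rho}_1=\boldsymbol{\nu}$. Dynamic distance. $\|(\mathbf{u},\boldsymbol{v})\|^2_{\boldsymbol{\rho}}:=\sum_i\int_\Omega|u_i|^2d\rho_i+\frac12\sum_{i,j}\int_\Omega|v_{ij}|^2\theta(\frac{d\rho_i}{d\bar\rho},\frac{d\rho_j}{d\bar\rho})q_{ij}\,d\bar\rho$ and $W^2_{\Omega\times\mathcal{G}}(\boldsymbol{\mu},\boldsymbol{\nu}):=\inf\{\int_0^1\|(\mathbf{u}_t,\boldsymbol{v}_t)\|^2_{\boldsymbol{\rho}_t}dt:(\boldsymbol{\rho},\mathbf{u},\boldsymbol{v})\in\mathcal{C}(\boldsymbol{\mu},\boldsymbol{\nu})\}$. Graph Wasserstein metric. $\mathcal{P}(\mathcal{G})=\{p\in\mathbb{R}^n:p_i\ge0,\sum_ip_i=1\}$. A pair $(p,v)$ solves the graph continuity equation on $[0,1]$ if $p:[0,1]\to\mathcal{P}(\mathcal{G})$ is continuous, $v:[0,1]\to\mathbb{R}^{n\times n}$ is measurable, $t\mapsto\theta(p_{i,t},p_{j,t})v_{ij,t}$ is locally integrable on $(0,1)$ for all $i,j$, and $\partial_tp_i=\frac12\sum_j\theta(p_i,p_j)(v_{ij}-v_{ji})q_{ij}$ in the sense of distributions for all $i$. Then $W_\mathcal{G}^2(p_0,p_1)$ is the infimum of $\int_0^1\frac12\sum_{i,j}v_{ij,t}^2\theta(p_{i,t},p_{j,t})q_{ij}\,dt$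 over all such $(p,v)$ with endpoints $p_0,p_1$. Lifted space. $\Delta^{n-1}=\{r\in\mathbb{R}^{n-1}:r_i\ge0,\ \sum_{i}r_i\le1\}$, $\mathbf{p}(r)=[p_j(r)]_{j=1}^n:=[r_1,\dots,r_{n-1},1-\sum_{i=1}^{n-1}r_i]\in\mathcal{P}(\mathcal{G})$, $d_{\Delta^{n-1}}(r,\tilde r):=W_\mathcal{G}(\mathbf{p}(r),\mathbf{p}(\tilde r))$, and $d^2_{\mathbb{R}^d\times\Delta^{n-1}}((x,r),(\tilde x,\tilde r)):=|x-\tilde x|^2+d^2_{\Delta^{n-1}}(r,\tilde r)$. $W_{\mathbb{R}^d\times\Delta^{n-1}}$ is the 2-Wasserstein (Kantorovich) distance on probability measures on $\mathbb{R}^d\times\Delta^{n-1}$ with ground distance $d_{\mathbb{R}^d\times\Delta^{n-1}}$. The projection $\mathfrak{P}:\mathcal{P}(\mathbb{R}^d\times\Delta^{n-1})\to\mathcal{P}(\mathbb{R}^d\times\mathcal{G})$ is given by $\int\eta\,d(\mathfrak{P}\lambda)_j=\int p_j(r)\eta(x)\,d\lambda(x,r)$ for all bounded continuous $\eta$, $j=1,\dots,n$. The canonical lifting of $\boldsymbol{\mu}$ is $\lambda_{\boldsymbol{\mu}}:=\sum_{j=1}^n\mu_j\otimes\delta_{e_j}$, where $e_j$ is the vertex of $\Delta^{n-1}$ for which $\mathbf{p}(e_j)$ is the unit mass at node $j$. Static quantities. $D_{\mathbb{R}^d\times\mathcal{G}}(\boldsymbol{\mu},\boldsymbol{\nu}):=\inf\{W_{\mathbb{R}^d\times\Delta^{n-1}}(\lambda_1,\lambda_2):\mathfrak{P}\lambda_1=\boldsymbol{\mu},\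 \mathfrak{P}\lambda_2=\boldsymbol{\nu}\}$ and $W_{2,\mathcal{W}}(\boldsymbol{\mu},\boldsymbol{\nu}):=W_{\mathbb{R}^d\times\Delta^{n-1}}(\lambda_{\boldsymbol{\mu}},\lambda_{\boldsymbol{\nu}})$. *)

(* Defs.v *)
From HB Require Import structures.
From mathcomp Require Import all_boot all_order all_algebra.
From mathcomp Require Import all_classical all_reals all_analysis.

Set Implicit Arguments.
Unset Strict Implicit.
Unset Printing Implicit Defensive.

Import Order.TTheory GRing.Theory Num.Theory.
Import numFieldNormedType.Exports.

Local Open Scope classical_set_scope.
Local Open Scope ring_scope.

(* Vectors and matrices carry their Borel sigma-algebra. *)
Section borel_matrix.
Variables (R : realType) (m n : nat).
Local Notation borel := (@open 'M[R]_(m, n)).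

HB.instance Definition _ := @isMeasurable.Build (sigma_display borel)
  'M[R]_(m, n) <<s borel >> (@sigma_algebra0 _ setT borel)
  (@sigma_algebraC _ borel) (@sigma_algebra_bigcup _ setT borel).

End borel_matrix.

Section ord_msum.
Local Open Scope ereal_scope.
Context {dT : measure_display} {T : measurableType dT} {R : realType}.

Definition ord_msum {n : nat} (m : 'I_n -> {measure set T -> \bar R})
  (A : set T) : \bar R := \sum_(i < n) m i A.

Section measure.
Variables (n : nat) (m : 'I_n -> {measure set T -> \bar R}).

Let m' (k : nat) : {measure set T -> \bar R} :=
  if insub k is Some i then m i else mzero.

Let ord_msumE : ord_msum m = msum m' n.
Proof.
apply/funext => A; rewrite /ord_msum /msum; apply: eq_bigr => i _.
by rewrite /m' valK.
Qed.

Let ord_msum0 : ord_msum m set0 = 0.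
Proof. by rewrite ord_msumE measure0. Qed.

Let ord_msum_ge0 A : 0 <= ord_msum m A.
Proof. by rewrite ord_msumE measure_ge0. Qed.

Let ord_msum_sigma_additive : semi_sigma_additive (ord_msum m).
Proof. by rewrite ord_msumE; exact: measure_semi_sigma_additive. Qed.

HB.instance Definition _ := isMeasure.Build _ _ _ (ord_msum m)
  ord_msum0 ord_msum_ge0 ord_msum_sigma_additive.
End measure.

Section finite_measure.
Variables (n : nat) (m : 'I_n -> {finite_measure set T -> \bar R}).

Let ord_msum_finite : fin_num_fun (ord_msum m).
Proof.
move=> A mA; rewrite /ord_msum; apply/sum_fin_numP => i _ _.
exact: fin_num_measure.
Qed.

HB.instance Definition _ :=
  Measure_isFinite.Build _ _ _ (ord_msum m) ord_msum_finite.
End finite_measure.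

End ord_msum.

(* The norm of the library on ['M_(m, n)] is the sup norm; the Euclidean one is
   needed here. *)
Definition edot {R : realType} {d : nat} (x y : 'rV[R]_d) : R :=
  \sum_(k < d) x 0 k * y 0 k.

Definition enorm {R : realType} {d : nat} (x : 'rV[R]_d) : R :=
  Num.sqrt (edot x x).

Section smooth.
Context {R : realType} {V : normedModType R}.

(* On an open set, existence and continuity of the iterated directional
   derivatives in all fixed directions amounts to that of the iterated partial
   derivatives. *)
Fixpoint Ck (k : nat) (U : set V) (f : V -> R) : Prop :=
  (forall x, U x -> {for x, continuous f}) /\
  (if k is k'.+1 then
     forall v : V, (forall x, U x -> derivable (f : V -> R^o) x v) /\
                   Ck k' U (fun x => 'D_v (f : V -> R^o) x)
   else True).

Definition smooth_on (U : set V) (f : V -> R) : Prop := forall k, Ck k U f.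

(* [C_c^oo(U)], the functions being extended by zero outside of [U] *)
Definition test_function (U : set V) (f : V -> R) : Prop :=
  smooth_on setT f /\
  exists2 K : set V, compact K /\ K `<=` U & forall x, ~ K x -> f x = 0.

End smooth.

Section interpolation.
Context {R : realType}.
Implicit Type theta : R -> R -> R.

(* Only the values of [theta] on the closed quadrant are meaningful. *)
Record interpolation_function theta : Prop := {
  theta_ge0 : forall t s : R, 0 <= t -> 0 <= s -> 0 <= theta t s;
  theta_continuous :
    {within [set p : R * R | 0 <= p.1 /\ 0 <= p.2],
      continuous (fun p : R * R => theta p.1 p.2)};
  theta_smooth :
    smooth_on [set p : R^o * R^o | 0 < p.1 /\ 0 < p.2]
      (fun p => theta p.1 p.2);
  theta_sym : forall t s : R, 0 <= t -> 0 <= s -> theta t s = theta s t;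
  theta_gt0 : forall t s : R, 0 < t -> 0 < s -> 0 < theta t s;
  theta11 : theta 1 1 = 1;
  theta_mono : forall r s t : R, 0 <= t -> 0 <= r -> r <= s ->
    theta r t <= theta s t;
  theta_homogeneous : forall lam t s : R, 0 < lam -> 0 <= t -> 0 <= s ->
    theta (lam * t) (lam * s) = lam * theta t s;
  theta_concave : forall t s t' s' lam : R,
    0 <= t -> 0 <= s -> 0 <= t' -> 0 <= s' -> 0 <= lam -> lam <= 1 ->
    lam * theta t s + (1 - lam) * theta t' s' <=
      theta (lam * t + (1 - lam) * t') (lam * s + (1 - lam) * s')
}.

End interpolation.

(* A graph with nodes ['I_n.+1] is given by its weights. *)
Section graph.
Context {R : realType} {n : nat}.
Implicit Type q : 'I_n.+1 -> 'I_n.+1 -> R.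

Definition weighted_graph q : Prop := forall i j, 0 <= q i j.

Definition graph_symmetric q : Prop := forall i j, q i j = q j i.

Definition graph_connected q : Prop :=
  forall i j, connect (fun a b => 0 < q a b) i j.

End graph.

Section graph_wasserstein.
Context {R : realType} {n : nat}.
Variables (q : 'I_n.+1 -> 'I_n.+1 -> R) (theta : R -> R -> R).

Definition prob_graph : set 'rV[R]_n.+1 :=
  [set p | (forall i, 0 <= p 0 i) /\ \sum_i p 0 i = 1].

Definition graph_CE (p : R -> 'rV[R]_n.+1) (v : R -> 'M[R]_n.+1) : Prop :=
  [/\ (forall t, t \in `[0, 1] -> prob_graph (p t)) /\
        {within `[0, 1], continuous p},
      measurable_fun (`[0, 1] : set R) v,
      forall i j, locally_integrable (`]0, 1[ : set R)
        (fun t => theta (p t 0 i) (p t 0 j) * v t i j) &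
      forall (phi : R^o -> R) i,
        test_function (`]0, 1[ : set R) phi ->
        \int[lebesgue_measure]_(t in `]0, 1[)
          ('D_1 (phi : R^o -> R^o) t * p t 0 i)
        = - \int[lebesgue_measure]_(t in `]0, 1[) (phi t *
            (2^-1 * \sum_j theta (p t 0 i) (p t 0 j) *
                           (v t i j - v t j i) * q i j))].

Definition graph_action (p : R -> 'rV[R]_n.+1) (v : R -> 'M[R]_n.+1) : \bar R :=
  (\int[lebesgue_measure]_(t in `[0%R, 1%R])
     (2^-1 * \sum_i \sum_j
        v t i j ^+ 2 * theta (p t 0%R i) (p t 0%R j) * q i j)%:E)%E.

Definition W_graph (p0 p1 : 'rV[R]_n.+1) : \bar R :=
  sqrte (ereal_inf [set a | exists p v,
    [/\ graph_CE p v, p 0 = p0, p 1 = p1 & a = graph_action p v]]).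

(* The simplex, in the first [n] of the [n.+1] barycentric coordinates. *)
Definition simplex : set 'rV[R]_n :=
  [set r | (forall i, 0 <= r 0 i) /\ \sum_i r 0 i <= 1].

Definition bary (r : 'rV[R]_n) : 'rV[R]_n.+1 :=
  \row_j (if unlift ord_max j is Some k then r 0 k else 1 - \sum_i r 0 i).

(* [vertex ord_max] is the origin. *)
Definition vertex (j : 'I_n.+1) : 'rV[R]_n := \row_k (k == j :> nat)%:R.

Lemma bary_vertex (j : 'I_n.+1) : bary (vertex j) = delta_mx 0 j.
Proof.
apply/rowP => l; rewrite !mxE eqxx /=; case: unliftP => [k|] ->.
  by rewrite mxE -val_eqE /= /bump leqNgt ltn_ord add0n.
case: (unliftP ord_max j) => [k|] ->; rewrite -?val_eqE /=.
  rewrite /bump leqNgt ltn_ord add0n (bigD1 k)//= big1 ?addr0.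
    by rewrite mxE /= /bump leqNgt ltn_ord add0n eqxx subrr gtn_eqF.
  move=> i ik; rewrite mxE /= /bump leqNgt ltn_ord add0n.
  by rewrite val_eqE (negbTE ik).
by rewrite eqxx big1 ?subr0// => i _; rewrite mxE /= ltn_eqF.
Qed.

Definition d_simplex (r r' : 'rV[R]_n) : \bar R := W_graph (bary r) (bary r').

Definition d_lifted {d : nat} (z z' : 'rV[R]_d * 'rV[R]_n) : \bar R :=
  sqrte ((enorm (z.1 - z'.1) ^+ 2)%:E + d_simplex z.2 z'.2 ^+ 2)%E.

End graph_wasserstein.

Section kantorovich.
Local Open Scope ereal_scope.
Context {dT : measure_display} {T : measurableType dT} {R : realType}.

Definition coupling (l1 l2 : {measure set T -> \bar R})
    (g : probability (T * T)%type R) : Prop :=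
  forall A, measurable A -> g (A `*` setT) = l1 A /\ g (setT `*` A) = l2 A.

Definition W_kantorovich (dist : T -> T -> \bar R)
    (l1 l2 : {measure set T -> \bar R}) : \bar R :=
  sqrte (ereal_inf
    [set \int[g]_z (dist z.1 z.2 ^+ 2) | g in coupling l1 l2]).

End kantorovich.

(* Measures on [Omega] are represented by their extension by zero. *)
Section vector_valued.
Context {R : realType} {d n : nat}.
Variable Omega : set 'rV[R]_d.

Local Notation vmeasure := ('I_n.+1 -> {finite_measure set 'rV[R]_d -> \bar R}).
Local Notation leb := (@lebesgue_measure R).

Definition prob_vec (mu : vmeasure) : Prop :=
  (forall i, mu i (~` Omega) = 0%E) /\ (\sum_i mu i Omega = 1)%E.

Definition prob2_vec (mu : vmeasure) : Prop :=
  prob_vec mu /\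
  forall i, (\int[mu i]_(x in Omega) (enorm x ^+ 2)%:E < +oo)%E.

Definition density (mu : vmeasure) (i : 'I_n.+1) (x : 'rV[R]_d) : R :=
  fine (Radon_Nikodym_SigmaFinite.f (mu i) (ord_msum mu) x).

Section dynamic.
Variables (q : 'I_n.+1 -> 'I_n.+1 -> R) (theta : R -> R -> R).

Definition mobility (mu : vmeasure) i j (x : 'rV[R]_d) : R :=
  theta (density mu i x) (density mu j x).

Definition grad_x (eta : 'rV[R]_d * R^o -> R) (z : 'rV[R]_d * R^o) : 'rV[R]_d :=
  \row_k 'D_((delta_mx 0 k, 0) : 'rV[R]_d * R^o)
           (eta : 'rV[R]_d * R^o -> R^o) z.

Definition diff_t (eta : 'rV[R]_d * R^o -> R) (z : 'rV[R]_d * R^o) : R :=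
  'D_((0, 1) : 'rV[R]_d * R^o) (eta : 'rV[R]_d * R^o -> R^o) z.

(* Continuity for the topology induced by the functionals
   [mu |-> \int[mu i] f], with [f] bounded and continuous. *)
Definition narrowly_continuous (t0 t1 : R) (rho : R -> vmeasure) : Prop :=
  forall i (f : 'rV[R]_d -> R), continuous f -> bounded_fun f ->
    {within `[t0, t1], continuous (fun t => \int[rho t i]_x f x)}.

(* Row [i] of the matrix [u (x, t)] is the velocity of species [i]. *)
Record vector_CE (t0 t1 : R) (rho : R -> vmeasure)
    (u : 'rV[R]_d * R -> 'M[R]_(n.+1, d))
    (v : 'rV[R]_d * R -> 'M[R]_n.+1) : Prop := {
  CE_prob : forall t, t \in `[t0, t1] -> prob_vec (rho t);
  CE_continuous : narrowly_continuous t0 t1 rho;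
  CE_u_measurable : measurable_fun (setT `*` `[t0, t1]) u;
  CE_u_integrable : forall i,
    (\int[leb]_(t in `[t0, t1]) \int[rho t i]_(x in Omega)
       (enorm (row i (u (x, t))))%:E < +oo)%E;
  CE_v_measurable : measurable_fun (setT `*` `[t0, t1]) v;
  CE_v_integrable : forall i j,
    (\int[leb]_(t in `[t0, t1]) \int[ord_msum (rho t)]_(x in Omega)
       (`|v (x, t) i j| * mobility (rho t) i j x)%:E < +oo)%E;
  CE_weak : forall (eta : 'rV[R]_d * R^o -> R) i,
    test_function (setT `*` `]t0, t1[) eta ->
    \int[leb]_(t in `[t0, t1]) \int[rho t i]_x diff_t eta (x, t)
    = - (\int[leb]_(t in `[t0, t1]) \int[rho t i]_x
          edot (grad_x eta (x, t)) (row i (u (x, t))))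
      - 2^-1 * \sum_j \int[leb]_(t in `[t0, t1]) \int[ord_msum (rho t)]_x
          (eta (x, t) * mobility (rho t) i j x *
             (v (x, t) i j - v (x, t) j i) * q i j)
}.

Definition norm2_rho (mu : vmeasure) (u : 'rV[R]_d -> 'M[R]_(n.+1, d))
    (v : 'rV[R]_d -> 'M[R]_n.+1) : \bar R :=
  (\sum_i \int[mu i]_(x in Omega) (enorm (row i (u x)) ^+ 2)%:E
   + 2^-1%:E * \sum_i \sum_j \int[ord_msum mu]_(x in Omega)
       (`|v x i j| ^+ 2 * mobility mu i j x * q i j)%:E)%E.

Definition W_dynamic (mu nu : vmeasure) : \bar R :=
  sqrte (ereal_inf [set a | exists rho u v,
    [/\ vector_CE 0 1 rho u v,
        (forall i A, measurable A -> rho 0 i A = mu i A),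
        (forall i A, measurable A -> rho 1 i A = nu i A) &
        a = (\int[leb]_(t in `[0%R, 1%R])
          norm2_rho (rho t) (fun x => u (x, t)) (fun x => v (x, t)))%E]]).

End dynamic.
End vector_valued.

Section static.
Context {R : realType} {d n : nat}.
Variables (q : 'I_n.+1 -> 'I_n.+1 -> R) (theta : R -> R -> R).

Local Notation vmeasure := ('I_n.+1 -> {finite_measure set 'rV[R]_d -> \bar R}).
Local Notation lifted := ('rV[R]_d * 'rV[R]_n)%type.

Definition W_lifted (l1 l2 : {measure set lifted -> \bar R}) : \bar R :=
  W_kantorovich (@d_lifted R n q theta d) l1 l2.

Definition prob_lifted (l : probability lifted R) : Prop :=
  l (~` (setT `*` simplex)) = 0%E.

(* [mu] is the projection of [l]. *)
Definition projects_to (l : probability lifted R) (mu : vmeasure) : Prop :=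
  forall j (eta : 'rV[R]_d -> R), continuous eta -> bounded_fun eta ->
    \int[mu j]_x eta x = \int[l]_z (bary z.2 0 j * eta z.1).

Definition D_static (mu nu : vmeasure) : \bar R :=
  ereal_inf [set w | exists l1 l2 : probability lifted R,
    [/\ prob_lifted l1 /\ prob_lifted l2, projects_to l1 mu,
        projects_to l2 nu & w = W_lifted l1 l2]].

Definition canonical_lifting (mu : vmeasure) : {measure set lifted -> \bar R} :=
  ord_msum (fun j => (mu j \x \d_(vertex j : 'rV[R]_n))%E).

Definition W_2W (mu nu : vmeasure) : \bar R :=
  W_lifted (canonical_lifting mu) (canonical_lifting nu).

End static.

(* Main.v *)
(* For a coupling of two liftings and a pair of points [(x, r)], [(x', r')], let
   [x_t] be the segment from [x] to [x'] and [p_t] a curve on the graph from [r]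
   to [r'] with flux [M_t].  Pushing the weights [p_t] forward along
   [(pair, t) |-> (x_t, t)] gives [rho_t]; its spatial velocity and its graph
   flux are the conditional expectations of [x' - x] (under the weight [p_i]) and
   of [M_ij] given [(x_t, t)].  Jensen's inequality bounds the action of the
   result by the mean action of the curves: for the graph part it is applied to
   [M^2 / theta(p_i, p_j)], which is a supremum of functions that are linear in
   [(M, p_i, p_j)] because the concave 1-homogeneous function [theta] is an
   infimum of countably many linear ones.

   No measurable selection of almost optimal graph curves is needed.  Pairs
   [(r, r')] are sorted into countably many cells on which every component is
   constant up to a factor close to 1.  Each cell gets one curve, optimal up to
   [eps] for the infimum of the action over the whole cell, taken with weight
   [1 - eta]; the remaining mass [eta] is moved by an explicit curve, of cost
   [O(eta)], that corrects the endpoints and exists since the graph is connected.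

   The second inequality holds because canonical liftings are liftings. *)

Require Import Defs.
From HB Require Import structures.
From mathcomp Require Import all_boot all_order all_algebra.
From mathcomp Require Import all_classical all_reals all_analysis.
From mathcomp Require Import measurable_realfun ring lra.

Import Order.TTheory GRing.Theory Num.Theory.
Import numFieldNormedType.Exports.
Local Open Scope classical_set_scope.
Local Open Scope ring_scope.

Set Implicit Arguments.
Unset Strict Implicit.
Unset Printing Implicit Defensive.

Local Notation mfun := (measurable_fun setT).
Local Notation L1 mu f := (integrable mu setT (EFin \o f)).

(** The mobility is built from Radon-Nikodym derivatives chosen separately at each time, so its
    definition gives no joint measurability. It is replaced by [theta] of conditional expectations
    on space-time; the two agree almost everywhere at all times outside one null set, where the
    graph velocity is set to zero. [theta] may vanish on the boundary of the quadrant, so the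
    quotient of a squared flux by the mobility could blow up at the ends of a correcting curve. The
    polynomials in [residual] therefore put mass of order t^2 (1 - t)^2 on every node while the
    rates are of order t (1 - t), which bounds the quotient uniformly in time. Costs are carried by
    2 al M - al^2 (a p_i + b p_j) <= C, for all [al] and all linear majorants: no division by a
    mobility occurs, the inequality survives sums and conditional expectations, and countably many
    instances give back M^2 <= C theta(p_i, p_j). Neither the squared lifted distance nor the action
    as a function of time is shown to be measurable; both are only compared with measurable
    functions, by monotonicity of the integral. *)

Lemma le_of_eq (disp : Order.disp_t) (T : porderType disp) (x y : T) : x = y -> (x <= y)%O.
Proof. by move->. Qed.

(** * Integrability of real-valued functions *)

Section integrable_operations.
Context d (T : measurableType d) (R : realType).

Section measure.
Variable mu : {measure set T -> \bar R}.
Implicit Types (f g : T -> R) (r : R).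

Lemma L1D f g : L1 mu f -> L1 mu g -> L1 mu (fun x => f x + g x).
Proof.
move=> jf jg; have i := integrableD measurableT jf jg.
by apply: (eq_integrable measurableT _ _ _ i).
Qed.

Lemma L1Z r f : L1 mu f -> L1 mu (fun x => r * f x).
Proof.
move=> jf; have i := integrableZl measurableT r jf.
by apply: (eq_integrable measurableT _ _ _ i).
Qed.

Lemma L1N f : L1 mu f -> L1 mu (fun x => - f x).
Proof.
by move=> jf; have i := integrableN jf; apply: (eq_integrable measurableT _ _ _ i).
Qed.

Lemma L1B f g : L1 mu f -> L1 mu g -> L1 mu (fun x => f x - g x).
Proof. by move=> jf /L1N jg; exact: L1D jf jg. Qed.

End measure.

Lemma L1_sqr (mu : {finite_measure set T -> \bar R}) (f : T -> R) : mfun f ->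
  L1 mu (fun x => f x ^+ 2) -> L1 mu f.
Proof.
move=> mf jf; have i1 : L1 mu (cst (1 : R)) by exact: finite_measure_integrable_cst.
apply: (@le_integrable _ _ _ _ _ measurableT _ _ _ _ (L1D i1 jf)).
  exact/measurable_EFinP.
move=> x _; rewrite /= lee_fin; apply: le_trans (ler_norm _).
rewrite -[X in _ + X]real_normK ?num_real //.
by have := sqr_ge0 (`|f x| - 1); have := normr_ge0 (f x); nra.
Qed.

End integrable_operations.

(** * Borel sets of matrices *)

Lemma cover_rat_interval (R : realType) (x e : R) : 0 < e ->
  exists c r : rat, [/\ `|x - ratr c| < ratr r, 0 < ratr r :> R &
    forall y, `|y - ratr c| < ratr r -> `|x - y| < e].
Proof.
(* The centre is taken within e/4 of [x] and the radius between e/4 and e/2, so the interval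
   contains [x] and its points are within e/4 + e/2 of it. *)
move=> e0; have e2 : e / 4 < e / 2 by lra.
have [r] := rat_in_itvoo e2; rewrite in_itv /= => /andP[r1 r2].
have x1 : x - e / 4 < x + e / 4 by lra.
have [c] := rat_in_itvoo x1; rewrite in_itv /= => /andP[c1 c2].
exists c, r; split.
- by rewrite ltr_norml; apply/andP; split; lra.
- lra.
- by move=> y; rewrite !ltr_norml => /andP[? ?]; apply/andP; split; lra.
Qed.

Section borel_matrix_product.
Context {R : realType} {m n : nat}.
Implicit Types (c : 'M[rat]_(m, n)) (r : rat).

(** A countable base of the topology. It turns every open set of matrices into a countable union of
    sets defined by entries, which ties the Borel sigma-algebra to entrywise measurability and to
    products. *)
Definition rat_box c r : set 'M[R]_(m, n) :=
  [set A | forall i j, `|A i j - ratr (c i j)| < ratr r].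

Lemma open_rat_box (U : set ('M[R]_(m, n))) A : open U -> U A ->
  exists c r, rat_box c r A /\ rat_box c r `<=` U.
Proof.
rewrite openE => oU UA; have /nbhs_ballP[e /= e0 eU] := oU _ UA.
have e2 : e / 4 < e / 2 by lra.
have [r] := rat_in_itvoo e2; rewrite in_itv /= => /andP[r1 r2].
have H i j : exists c : rat, `|A i j - ratr c| < ratr r.
  have [|c] := @rat_in_itvoo R (A i j - e / 4) (A i j + e / 4); first lra.
  by rewrite in_itv /= => /andP[c1 c2]; exists c; rewrite ltr_norml; apply/andP; split; lra.
pose c := \matrix_(i, j) xchoose (H i j).
have cP i j : `|A i j - ratr (c i j)| < ratr r by rewrite mxE; exact: (xchooseP (H i j)).
exists c, r; split=> // B BP; apply: eU; split=> // i j.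
rewrite /ball /=; have := BP i j; have := cP i j.
by rewrite !ltr_norml => /andP[? ?] /andP[? ?]; apply/andP; split; lra.
Qed.

Lemma measurable_mx_entry (i : 'I_m) (j : 'I_n) :
  mfun (fun A : 'M[R]_(m, n) => A i j).
Proof.
apply: (measurability _ (RGenOInfty.measurableE R)) => _ [_ [a ->] <-].
rewrite setTI; apply: sub_sigma_algebra.
apply: open_comp; last exact: itv_open_ends_open.
by move=> A _; exact: coord_continuous.
Qed.

Lemma measurable_rat_box c r : measurable (rat_box c r).
Proof.
rewrite (_ : rat_box c r = \bigcap_(i in [set: 'I_m]) \bigcap_(j in [set: 'I_n])
   ((fun A : 'M[R]_(m, n) => A i j) @^-1` [set x | `|x - ratr (c i j)| < ratr r])).
  apply: fin_bigcap_measurable => // i _; apply: fin_bigcap_measurable => // j _.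
  rewrite -[X in measurable X]setTI; apply: measurable_mx_entry => //.
  rewrite (_ : [set x | _] = ball (ratr (c i j) : R) (ratr r : R)).
    exact: measurable_ball.
  by apply/seteqP; split=> x; rewrite /ball /= distrC.
by apply/seteqP; split=> A AP //= i; [move=> _ j _; exact: AP|move=> j; exact: AP].
Qed.

Lemma measurable_fun_mx d (T : measurableType d) (D : set T)
    (f : T -> 'M[R]_(m, n)) :
  (forall i j, measurable_fun D (fun x => f x i j)) -> measurable_fun D f.
Proof.
move=> mf; move=> mD; move: (mD); apply: (@measurability _ _ _ _ _ _ (@open 'M[R]_(m, n))) => //.
move=> _ [U oU <-].
rewrite (_ : D `&` f @^-1` U = \bigcup_(p in [set p : 'M[rat]_(m, n) * rat |
  rat_box p.1 p.2 `<=` U]) (D `&` f @^-1` (rat_box p.1 p.2))).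
  rewrite bigcup_mkcond; apply: countable_bigcupT_measurable => // -[c r].
  case: ifPn => // _.
  rewrite (_ : D `&` _ = D `&` \bigcap_(i in [set: 'I_m]) \bigcap_(j in [set: 'I_n])
   (D `&` (fun A => f A i j) @^-1` [set x | `|x - ratr (c i j)| < ratr r])).
    apply: measurableI => //.
    apply: fin_bigcap_measurable => // i _; apply: fin_bigcap_measurable => // j _.
    apply: mf => //.
    rewrite (_ : [set x | _] = ball (ratr (c i j) : R) (ratr r : R)).
      exact: measurable_ball.
    by apply/seteqP; split=> x; rewrite /ball /= distrC.
  apply/seteqP; split=> x [Dx fx]; split=> //= i; first by move=> _ j _; split=> //; exact: fx.
  by move=> j; have [] := fx i I j I.
apply/seteqP; split=> x.
  move=> [Dx Ufx]; have [c [r [bx bU]]] := open_rat_box oU Ufx.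
  by exists (c, r).
by move=> [[c r] /= bU [Dx bx]]; split=> //; exact: bU.
Qed.

(** Openness refers to the product topology and measurability to the product sigma-algebra. They are
    reconciled by writing the open set as a countable union of rational rectangles. *)
Lemma measurable_open_mx_prod (U : set ('M[R]_(m, n) * R^o)) :
  open U -> measurable (U : set ('M[R]_(m, n) * R)).
Proof.
rewrite openE => oU.
rewrite (_ : U = \bigcup_(p in [set p : 'M[rat]_(m, n) * rat * (rat * rat) |
    rat_box p.1.1 p.1.2 `*` [set t : R | `|t - ratr p.2.1| < ratr p.2.2] `<=` U])
  (rat_box p.1.1 p.1.2 `*` [set t : R | `|t - ratr p.2.1| < ratr p.2.2])).
  rewrite bigcup_mkcond; apply: countable_bigcupT_measurable => // -[[c r] [s e]].
  case: ifPn => // _; apply: measurableX; first exact: measurable_rat_box.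
  rewrite (_ : [set x | _] = ball (ratr s : R) (ratr e : R)).
    exact: measurable_ball.
  by apply/seteqP; split=> x; rewrite /ball /= distrC.
apply/seteqP; split=> [[A t] UA|z [p]]; last by move=> /=; apply.
have /nbhs_ballP[e /= e0 eU] := oU _ UA.
have [c [r [cA rA]]] := @open_rat_box (ball A e) A (ball_open A e) (ballxx A e0).
have [s [r' [ts r0 tr]]] := cover_rat_interval t e0.
exists ((c, r), (s, r')) => //= -[B t'] /= [Bc Bt]; apply: eU.
by split; [exact: rA|exact: tr].
Qed.

Lemma continuous_mx_prod_measurable (F : 'M[R]_(m, n) * R^o -> R) :
  continuous F -> mfun (F : 'M[R]_(m, n) * R -> R).
Proof.
move=> cF; apply: (measurability _ (RGenOInfty.measurableE R)) => _ [_ [a ->] <-].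
rewrite setTI; apply: measurable_open_mx_prod; apply: open_comp; last exact: itv_open_ends_open.
by move=> z _; exact: cF.
Qed.

Lemma continuous_mx_measurable (F : 'M[R]_(m, n) -> R) :
  continuous F -> mfun F.
Proof.
move=> cF; apply: (measurability _ (RGenOInfty.measurableE R)) => _ [_ [a ->] <-].
rewrite setTI; apply: sub_sigma_algebra; apply: open_comp; last exact: itv_open_ends_open.
by move=> z _; exact: cF.
Qed.

Lemma closed_mx_measurable (A : set 'M[R]_(m, n)) : closed A -> measurable A.
Proof.
move=> cA; rewrite -(setCK A); apply: measurableC; apply: sub_sigma_algebra.
by rewrite openC.
Qed.

End borel_matrix_product.

(** * A countable family of sets that determines finite measures *)

Section lower_ray.
Context {R : realType} {d : nat}.

(** Open orthants with rational corner: a countable family, stable under intersection, that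
    generates the Borel sets. Countability lets one null set of times serve for all of them;
    openness makes their indicators limits of continuous functions. *)
Definition lower_ray (a : 'rV[rat]_d) : set 'rV[R]_d :=
  [set x | forall k, x 0 k < ratr (a 0 k)].

Lemma measurable_lower_ray a : measurable (lower_ray a).
Proof.
rewrite (_ : lower_ray a = \bigcap_(k in [set: 'I_d])
   ((fun x : 'rV[R]_d => x 0 k) @^-1` `]-oo, ratr (a 0 k)[)).
  apply: fin_bigcap_measurable => // k _.
  rewrite -[X in measurable X]setTI; apply: measurable_mx_entry => //.
apply/seteqP; split=> x ax k; first by move=> _ /=; rewrite in_itv /=; exact: ax.
by have := ax k I; rewrite /= in_itv.
Qed.

Lemma rat_gt (x : R) : exists a : rat, x < ratr a.
Proof.
have x1 : x < x + 1 by lra.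
by have [a] := rat_in_itvoo x1; rewrite in_itv /= => /andP[xa _]; exists a.
Qed.

Lemma borel_lower_ray :
  @measurable _ 'rV[R]_d = <<s range lower_ray >>.
Proof.
apply/seteqP; split; last first.
  apply: smallest_sub; first exact: sigma_algebra_measurable.
  by move=> _ [a _ <-]; exact: measurable_lower_ray.
pose G := range lower_ray.
suff mid : mfun (id : g_sigma_algebraType G -> 'rV[R]_d).
  by move=> A mA; have := mid measurableT A mA; rewrite setTI.
apply: measurable_fun_mx => i k; rewrite ord1.
apply: (measurability _ (RGenInftyO.measurableE R)) => _ [_ [r ->] <-]; rewrite setTI.
rewrite (_ : _ @^-1` _ = \bigcup_(a in [set a : 'rV[rat]_d | ratr (a 0 k) <= r])
   lower_ray a).
  rewrite bigcup_mkcond; apply: countable_bigcupT_measurable => // a.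
  by case: ifPn => // _; apply: sub_sigma_algebra; exists a.
apply/seteqP; split=> x /=; rewrite in_itv /=.
  move=> xr; have [b] := rat_in_itvoo xr; rewrite in_itv /= => /andP[xb br].
  (* Only coordinate [k] is constrained by [r]; the others just have to exceed those of [x]. *)
  pose a := \row_j (if j == k then b else xchoose (rat_gt (x 0 j))).
  exists a; first by rewrite /= mxE eqxx ltW.
  move=> j; rewrite mxE; case: eqP => [->//|_]; exact: (xchooseP (rat_gt (x 0 j))).
by move=> [a /= ar] /(_ k) xa; exact: lt_le_trans ar.
Qed.

Lemma lower_ray_setI : setI_closed (range lower_ray).
Proof.
move=> _ _ [a _ <-] [b _ <-]; exists (\row_k Order.min (a 0 k) (b 0 k)) => //.
apply/seteqP; split=> x.
  move=> H; split=> k; have := H k; rewrite mxE => /lt_le_trans; apply;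
    by rewrite ler_rat ge_min lexx ?orbT.
by move=> [Ha Hb] k; rewrite mxE /Order.min; case: ifP.
Qed.

Lemma lower_ray_cover :
  \bigcup_(k : nat) lower_ray (const_mx k%:R) = setT.
Proof.
apply/seteqP; split=> // x _.
pose b j := Num.Def.archi_bound (x 0 j).
exists (\max_(j < d) b j)%N => // j; rewrite mxE ratr_nat.
by rewrite (lt_le_trans (unstable.ltr_bound _)) // ler_nat (leq_bigmax (F := b) j).
Qed.

Lemma rV_measure_unique (m1 m2 : {measure set 'rV[R]_d -> \bar R}) :
  (m1 setT < +oo)%E -> (forall a, m1 (lower_ray a) = m2 (lower_ray a)) ->
  forall A, measurable A -> m1 A = m2 A.
Proof.
move=> fin1 m12 A mA.
apply: (measure_unique (range lower_ray) (fun k => lower_ray (const_mx k%:R))) => //.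
- exact: borel_lower_ray.
- exact: lower_ray_setI.
- exact: lower_ray_cover.
- by move=> _ [a _ <-].
- move=> k; apply: le_lt_trans fin1; apply: le_measure; rewrite ?inE //.
  exact: measurable_lower_ray.
Qed.

End lower_ray.

(** * Conditional expectation *)

Section integral_nonmeasurable.
Import HBNNSimple.

(** The integral of a nonnegative function is a supremum over the simple functions below it, hence
    monotone for arbitrary integrands. It serves for integrands whose measurability is not
    established. *)
Lemma ge0_le_integral_nonmeas d (T : measurableType d) (R : realType)
    (mu : {measure set T -> \bar R}) (D : set T) (f g : T -> \bar R) :
  (forall x, D x -> (0 <= f x)%E) -> (forall x, D x -> (f x <= g x)%E) ->
  (\int[mu]_(x in D) f x <= \int[mu]_(x in D) g x)%E.
Proof.
move=> f0 fg; rewrite !ge0_integralE //; last first.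
  by move=> x Dx; exact: le_trans (f0 _ Dx) (fg _ Dx).
apply: le_ereal_sup => _ [h /= hf <-]; exists h => //= x; apply: le_trans (hf x) _.
by rewrite /patch; case: ifPn => // /set_mem; exact: fg.
Qed.

End integral_nonmeasurable.

Section weighted_image.
Local Open Scope ereal_scope.
Context {d d'} {S : measurableType d} {E : measurableType d'} {R : realType}.
Variables (H : {finite_measure set S -> \bar R}) (h : S -> R) (X : S -> E).
Hypotheses (ih : L1 H h) (h0 : forall s, (0 <= h s)%R).
Hypothesis (mX : mfun X).

(** The push-forward under [X] of the measure with density [h] with respect to [H]. The three proofs
    are arguments so that the measure structures can be attached to the term. *)
Definition wimage (ih : L1 H h)
    (h0 : forall s, (0 <= h s)%R) (mX : mfun X) (A : set E) : \bar R :=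
  \int[H]_(s in X @^-1` A) (h s)%:E.

Let mpre A : measurable A -> measurable (X @^-1` A).
Proof. by move=> mA; rewrite -[X in measurable X]setTI; exact: mX. Qed.

Let wimage0 : wimage ih h0 mX set0 = 0.
Proof. by rewrite /wimage preimage_set0; exact: integral_set0. Qed.

Let wimage_ge0 A : 0 <= wimage ih h0 mX A.
Proof. by apply: integral_ge0 => s _; rewrite lee_fin. Qed.

Let wimage_sigma_additive : semi_sigma_additive (wimage ih h0 mX).
Proof.
move=> F mF tF mUF; rewrite /wimage preimage_bigcup.
apply: semi_sigma_additive_nng_induced.
- exact: measurable_int ih.
- by move=> s; rewrite lee_fin.
- by move=> n; exact: mpre.
- apply/trivIsetP => /= i j _ _ ij; rewrite -preimage_setI.
  by move/trivIsetP : tF => /(_ _ _ _ _ ij) ->//; rewrite preimage_set0.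
- by rewrite -preimage_bigcup; exact: mpre.
Qed.

HB.instance Definition _ := isMeasure.Build _ _ _ (wimage ih h0 mX)
  wimage0 wimage_ge0 wimage_sigma_additive.

Let wimage_fin : fin_num_fun (wimage ih h0 mX).
Proof.
move=> A mA; apply: integrable_fin_num; first exact: mpre.
by apply: integrableS ih => //; exact: mpre.
Qed.

HB.instance Definition _ := Measure_isFinite.Build _ _ _ (wimage ih h0 mX) wimage_fin.

End weighted_image.

Section integral_wimage.
Local Open Scope ereal_scope.
Context {d d'} {S : measurableType d} {E : measurableType d'} {R : realType}.
Variables (H : {finite_measure set S -> \bar R}) (h : S -> R) (X : S -> E).
Hypotheses (ih : L1 H h) (h0 : forall s, (0 <= h s)%R).
Hypothesis (mX : mfun X).

Let mh : mfun (EFin \o h). Proof. exact: measurable_int ih. Qed.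

(** [h] is a version of the Radon-Nikodym derivative of the weighted measure, so the change of
    variables for that derivative applies. *)
Lemma ge0_integral_density (F : S -> \bar R) :
  mfun F -> (forall s, 0 <= F s) ->
  \int[wimage ih h0 (@measurable_id _ S setT)]_s F s = \int[H]_s (F s * (h s)%:E).
Proof.
move=> mF F0; pose nu : {finite_measure set S -> \bar R} := wimage ih h0 (@measurable_id _ S setT).
have dom : nu `<< H.
  apply/null_content_dominatesP => A mA HA0.
  rewrite /nu /= /wimage; by apply: null_set_integral => //; exact: measurable_funTS.
rewrite -(Radon_Nikodym_SigmaFinite.change_of_variables dom F0 measurableT mF).
apply: ae_eq_integral => //.
- apply: emeasurable_funM => //.
  exact: measurable_int (Radon_Nikodym_SigmaFinite.f_integrable dom).
- exact: emeasurable_funM.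
- apply: ae_eqe_mul2l; apply: integral_ae_eq => //.
    exact: Radon_Nikodym_SigmaFinite.f_integrable.
  by move=> A _ mA; rewrite -Radon_Nikodym_SigmaFinite.f_integral.
Qed.

Lemma ge0_integral_wimage (F : E -> \bar R) :
  mfun F -> (forall s, 0 <= F s) ->
  \int[wimage ih h0 mX]_x F x = \int[H]_s (F (X s) * (h s)%:E).
Proof.
move=> mF F0.
rewrite -(@ge0_integral_density (F \o X)) //=; [|exact: measurableT_comp].
rewrite -(@ge0_integral_pushforward _ _ _ _ _ X mX
  (wimage ih h0 (@measurable_id _ S setT)) setT F) //.
Qed.

Lemma integrable_wimage (F : E -> R) : mfun F ->
  H.-integrable setT (fun s => (F (X s) * h s)%:E) -> L1 (wimage ih h0 mX) F.
Proof.
move=> mF /integrableP[_ iF]; apply/integrableP; split.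
  exact/measurable_EFinP.
rewrite ge0_integral_wimage //; last by apply: measurableT_comp => //; exact/measurable_EFinP.
apply: le_lt_trans iF; apply: le_of_eq.
by apply: eq_integral => s _ /=; rewrite normrM (ger0_norm (h0 s)) EFinM.
Qed.

Lemma wimage_integrable (F : E -> R) : mfun F -> L1 (wimage ih h0 mX) F ->
  H.-integrable setT (fun s => (F (X s) * h s)%:E).
Proof.
move=> mF /integrableP[_ iF]; apply/integrableP; split.
  apply/measurable_EFinP; apply: measurable_funM; first exact: measurableT_comp.
  exact/measurable_EFinP.
apply: le_lt_trans iF; rewrite ge0_integral_wimage //; last first.
  by apply: measurableT_comp => //; exact/measurable_EFinP.
apply: le_of_eq.
by apply: eq_integral => s _ /=; rewrite normrM (ger0_norm (h0 s)) EFinM.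
Qed.

Lemma Rintegral_wimage (F : E -> R) : mfun F ->
  (\int[wimage ih h0 mX]_x F x = \int[H]_s (F (X s) * h s))%R.
Proof.
move=> mF; rewrite /Rintegral integralE [in RHS]integralE.
have mFE : mfun (EFin \o F) by exact/measurable_EFinP.
congr (fine (_ - _)).
  rewrite ge0_integral_wimage //; last exact: measurable_funepos.
  apply: eq_integral => s _ /=; rewrite funeposE /= [in RHS]funeposE /=.
  by rewrite -!EFin_max -EFinM maxr_pMl // mul0r.
rewrite ge0_integral_wimage //; last exact: measurable_funeneg.
apply: eq_integral => s _ /=; rewrite funenegE /= [in RHS]funenegE /=.
by rewrite -!EFin_max -EFinM maxr_pMl // mul0r mulNr.
Qed.

End integral_wimage.

Section conditional_expectation.
Context {d d'} {S : measurableType d} {E : measurableType d'} {R : realType}.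
Variables (H : {finite_measure set S -> \bar R}) (X : S -> E).
Hypothesis (mX : mfun X).

Let one_int : L1 H (cst (1 : R)).
Proof. exact: finite_measure_integrable_cst. Qed.

(** The conditional expectation of [h] given [X], as a function on the target of [X]: the
    Radon-Nikodym derivative of the image of the measure with density [h] with respect to the image
    of [H]. *)
Lemma ge0_condexp (h : S -> R) : L1 H h ->
  (forall s, 0 <= h s) ->
  exists f : E -> R, [/\ mfun f, forall x, 0 <= f x &
    forall F : E -> \bar R, mfun F -> (forall x, 0 <= F x)%E ->
     (\int[H]_s (F (X s) * (f (X s))%:E) = \int[H]_s (F (X s) * (h s)%:E))%E].
Proof.
move=> ih h0; have one0 (s : S) : 0 <= cst (1 : R) s by exact: ler01.
pose nu : {finite_measure set E -> \bar R} := wimage ih h0 mX.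
pose mu : {finite_measure set E -> \bar R} := wimage one_int one0 mX.
have dom : nu `<< mu.
  apply/null_content_dominatesP => A mA muA.
  have mXA : measurable (X @^-1` A) by rewrite -[X in measurable X]setTI; exact: mX.
  apply: null_set_integral => //.
    by apply: measurable_funTS; exact: measurable_int ih.
  by move: muA => <-; rewrite /mu /= /wimage (integral_cst _ mXA 1%:E) mul1e.
pose f := Radon_Nikodym_SigmaFinite.f nu mu.
have f0 x : (0 <= f x)%E by exact: Radon_Nikodym_SigmaFinite.f_ge0.
have fE x : (fine (f x))%:E = f x.
  by rewrite fineK //; exact: Radon_Nikodym_SigmaFinite.f_fin_num.
have mf : mfun f.
  exact: measurable_int (Radon_Nikodym_SigmaFinite.f_integrable dom).
exists (fine \o f); split.
- exact: measurableT_comp.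
- by move=> x; rewrite /= fine_ge0.
- move=> F mF F0; rewrite -(@ge0_integral_wimage _ _ _ _ _ _ h X ih h0 mX) //.
  rewrite -/nu -(Radon_Nikodym_SigmaFinite.change_of_variables dom F0 measurableT mF).
  rewrite ge0_integral_wimage //.
  + by apply: eq_integral => s _; rewrite /= mule1 fE.
  + exact: emeasurable_funM.
  + by move=> x; rewrite mule_ge0.
Qed.

Lemma integrable_bounded_mul (F h : S -> R) : mfun F ->
  (exists K : R, forall s, `|F s| <= K) -> L1 H h -> L1 H (F \* h).
Proof.
move=> mF [K FK] ih.
have mh : mfun h by apply/measurable_EFinP; exact: measurable_int ih.
apply: (@le_integrable _ _ _ _ _ measurableT _ (fun s => K%:E * (EFin \o h) s)%E).
- by apply/measurable_EFinP; exact: measurable_funM.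
- move=> s _; rewrite /= lee_fin !normrM ler_wpM2r //.
  by apply: (le_trans (FK s)); exact: ler_norm.
- exact: integrableZl.
Qed.

(** Conditional expectations live on the value space [E] and are tested against bounded functions of
    [X]; on space-time they become velocities, fluxes and densities directly. *)
Definition is_condexp (h : S -> R) (f : E -> R) : Prop :=
  [/\ mfun f, H.-integrable setT (EFin \o f \o X) &
    forall F : E -> R, mfun F -> (exists K : R, forall x, `|F x| <= K) ->
     \int[H]_s (F (X s) * f (X s)) = \int[H]_s (F (X s) * h s)].

Lemma condexp (h : S -> R) : L1 H h ->
  exists f, is_condexp h f.
Proof.
(* The nonnegative case is known for nonnegative test functions; a bounded one is split into its
   positive and negative parts. *)
have pos (h' : S -> R) : L1 H h' -> (forall s, 0 <= h' s) ->
    exists f, is_condexp h' f.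
  move=> ih h0; have [f [mf f0 fP]] := ge0_condexp ih h0; exists f.
  have mfX : mfun (EFin \o f \o X).
    by apply: measurableT_comp => //; exact/measurable_EFinP.
  have ifX : H.-integrable setT (EFin \o f \o X).
    apply/integrableP; split=> //.
    have := fP _ (@measurable_cst _ _ _ _ setT (1%:E : \bar R)) (fun=> lee01).
    under eq_integral do rewrite mul1e; under [in RHS]eq_integral do rewrite mul1e.
    move=> fh.
    under eq_integral do rewrite gee0_abs ?lee_fin ?f0 //.
    by rewrite fh; exact: integrable_lty ih.
  split=> // F mF [K FK].
  have split_int (g : S -> R) : L1 H g ->
      \int[H]_s (F (X s) * g s) = \int[H]_s (F^\+ (X s) * g s) - \int[H]_s (F^\- (X s) * g s).
    move=> ig; rewrite -RintegralB //.
    - apply: eq_Rintegral => s _; rewrite -mulrBl.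
      by congr (_ * _); rewrite -{1}(funrposBneg F).
    - apply: (@integrable_bounded_mul (F^\+ \o X)) => //.
        by apply: measurableT_comp => //; exact: measurable_funrpos.
      exists K => s; rewrite /= ger0_norm ?funrpos_ge0 //.
      by rewrite (le_trans _ (FK (X s))) // /funrpos ge_max ler_norm normr_ge0.
    - apply: (@integrable_bounded_mul (F^\- \o X)) => //.
        by apply: measurableT_comp => //; exact: measurable_funrneg.
      exists K => s; rewrite /= ger0_norm ?funrneg_ge0 //.
      by rewrite (le_trans _ (FK (X s))) // /funrneg ge_max -normrN ler_norm normr_ge0.
  rewrite !split_int //; congr (_ - _); congr fine.
    have := fP (EFin \o F^\+); apply.
      by apply/measurable_EFinP; exact: measurable_funrpos.
    by move=> x; rewrite lee_fin funrpos_ge0.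
  have := fP (EFin \o F^\-); apply.
    by apply/measurable_EFinP; exact: measurable_funrneg.
  by move=> x; rewrite lee_fin funrneg_ge0.
move=> ih.
have ihp : L1 H (h^\+) by exact: integrable_funrpos.
have ihn : L1 H (h^\-) by exact: integrable_funrneg.
have [f [mf if_ fP]] := pos _ ihp (funrpos_ge0 h).
have [g [mg ig gP]] := pos _ ihn (funrneg_ge0 h).
exists (f \- g); split.
- exact: measurable_funB.
- have i := integrableB measurableT if_ ig.
  by apply: (eq_integrable measurableT _ _ _ i).
- move=> F mF Fb.
  have FbX : exists K : R, forall s, `|(F \o X) s| <= K.
    by have [K FK] := Fb; exists K => s; exact: FK.
  have mFX : mfun (F \o X) by exact: measurableT_comp.
  transitivity (\int[H]_s (F (X s) * f (X s)) - \int[H]_s (F (X s) * g (X s))).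
    rewrite -RintegralB //; [|exact: integrable_bounded_mul..].
    by apply: eq_Rintegral => s _; rewrite -mulrBr.
  rewrite fP // gP // -RintegralB //; [|exact: integrable_bounded_mul..].
  apply: eq_Rintegral => s _; rewrite -mulrBr.
  congr (_ * _); by rewrite -[in RHS](funrposBneg h).
Qed.

(** Testing on the set where [f] is negative gives an integrand of one sign whose integral has the
    other sign; it vanishes almost everywhere. *)
Lemma condexp_ge0 (f : E -> R) : mfun f ->
  H.-integrable setT (EFin \o f \o X) ->
  (forall A, measurable A -> 0 <= \int[H]_s (\1_A (X s) * f (X s))) ->
  {ae H, forall s, 0 <= f (X s)}.
Proof.
move=> mf ifX fA.
pose A := [set x | f x < 0].
have mA : measurable A.
  rewrite (_ : A = setT `&` f @^-1` `]-oo, 0[).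
    by apply: mf => //; exact: measurable_itv.
  by apply/seteqP; split=> x /=; rewrite in_itv /= => //; case.
have ge0 := fA _ mA.
pose g s := - (\1_A (X s) * f (X s)).
have g0 s : 0 <= g s.
  rewrite /g indicE; case: (boolP (X s \in A)); last by rewrite mul0r oppr0.
  by rewrite inE /A /= mul1r oppr_ge0 => /ltW.
have i1 : L1 H ((\1_A \o X) \* (f \o X)).
  apply: integrable_bounded_mul => //.
    by apply: measurableT_comp => //; exact: measurable_indic.
  by exists 1 => s; rewrite /= indicE; case: (_ \in _); rewrite ?normr1 ?normr0.
have ig : L1 H g by exact: L1N i1.
have Ig0 : \int[H]_s g s = 0.
  apply/eqP; rewrite eq_le; apply/andP; split; last exact: Rintegral_ge0.
  rewrite (_ : \int[H]_s g s = -1 * \int[H]_s (\1_A (X s) * f (X s))).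
    by rewrite mulN1r oppr_le0.
  by rewrite -RintegralZl //; apply: eq_Rintegral => s _; rewrite mulN1r.
have : ae_eq H setT (EFin \o g) (cst 0%E).
  apply/ae_eq_integral_abs => //; first exact: measurable_int ig.
  under eq_integral do rewrite /= ger0_norm //.
  by rewrite -(fineK (integrable_fin_num measurableT ig)) -/(Rintegral _ _ _) Ig0.
apply: filterS => s /(_ I) [gs0]; rewrite leNgt; apply/negP => fs0.
by move: gs0; rewrite /g indicE mem_set // mul1r => /eqP; rewrite oppr_eq0 lt_eqF.
Qed.

End conditional_expectation.

(** * Derivatives of test functions *)

Section directional_derivative.
Context {R : realType} {V : normedModType R}.
Implicit Types (f : V -> R^o) (x u v : V).

(** The difference quotients of the restriction to a line and of the function itself are the same
    function of the increment, so existence and value of the derivatives transfer at once. *)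
Lemma line_quotient f x v (h t : R) :
  (fun k : R => k^-1 *: (((fun s : R^o => f (x + s *: v)) \o shift t) (k *: h) -
     f (x + t *: v))) =
  (fun k : R => k^-1 *: ((f \o shift (x + t *: v)) (k *: (h *: v)) - f (x + t *: v))).
Proof.
apply/funext => k; congr (_ *: (f _ - _)) => /=.
by rewrite scalerDl addrCA scalerA.
Qed.

Lemma derivable_line f x v (h t : R) : derivable f (x + t *: v) (h *: v) ->
  derivable (fun s : R^o => f (x + s *: v)) t h.
Proof. by rewrite /derivable line_quotient. Qed.

Lemma derive_line f x v (h t : R) :
  'D_h (fun s : R^o => f (x + s *: v)) t = 'D_(h *: v) f (x + t *: v).
Proof. by rewrite /derive line_quotient. Qed.

Lemma continuous_line x v : continuous (fun s : R^o => x + s *: v).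
Proof.
move=> s; apply: cvgD; first exact: cvg_cst.
by apply: cvgZr_tmp; exact: cvg_id.
Qed.

Lemma Ck_line k f x v : Ck k setT f -> Ck k setT (fun s : R^o => f (x + s *: v)).
Proof.
elim: k f => [|k IH] f [cf df]; split.
- by move=> s _; apply: continuous_comp; [exact: continuous_line|exact: cf].
- by [].
- by move=> s _; apply: continuous_comp; [exact: continuous_line|exact: cf].
- move=> h; have [dh Ch] := df (h *: v); split.
    by move=> t _; apply: derivable_line; exact: dh.
  suff -> : (fun t : R^o => 'D_h (fun s : R^o => f (x + s *: v) : R^o) t) =
      (fun t : R^o => 'D_(h *: v) f (x + t *: v)) by exact: (IH _ Ch).
  by apply/funext => t; rewrite derive_line.
Qed.

Lemma MVT_0 (g : R^o -> R^o) (b : R) : (forall s : R, derivable g s 1) ->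
  exists2 c : R, `|c| <= `|b| & g b - g 0 = 'D_1 g c * b.
Proof.
move=> dg.
have cg (i : interval R) : {within [set` i], continuous g}.
  by apply: derivable_within_continuous => s _; exact: dg.
have ig (s : R) : is_derive s 1 g ('D_1 g s) by exact: (@derivableP _ _ _ g s 1 (dg s)).
have [b0|b0] := leP 0 b.
  have [c] := @MVT_segment R g ('D_1 g) 0 b b0 (fun s _ => ig s) (cg _).
  rewrite in_itv /= => /andP[c0 cb] ->; exists c; last by rewrite subr0.
  by rewrite !ger0_norm.
have [c] := @MVT_segment R g ('D_1 g) b 0 (ltW b0) (fun s _ => ig s) (cg _).
rewrite in_itv /= => /andP[bc c0] gE; exists c.
  by rewrite !ler0_norm ?lerN2 // ltW.
by apply: oppr_inj; rewrite opprB gE sub0r mulrN.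
Qed.

(** Additivity in the direction, from partial continuity only: the mean value theorem turns the
    increment along [u] from the displaced point into a value of the derivative along [u] near [x],
    and that derivative is continuous at [x]. *)
Lemma derive_scaleD f u v (a : R) x :
  (forall y, derivable f y u) -> derivable f x v ->
  {for x, continuous (fun y => 'D_u f y)} ->
  'D_(a *: u + v) f x = a * 'D_u f x + 'D_v f x.
Proof.
move=> du dv cu; apply: cvg_lim => //.
(* The increment goes first along [v], then along [u]. *)
rewrite (_ : (fun k : R => _) = (fun k : R =>
   k^-1 *: (f (x + k *: v + (k * a) *: u) - f (x + k *: v)) +
   k^-1 *: ((f \o shift x) (k *: v) - f x))); last first.
  apply/funext => k; rewrite -scalerDr /=; congr (_ *: _).
  rewrite (addrC (k *: v) x) addrA subrK; congr (f _ - _).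
  by rewrite scalerDr scalerA addrAC [in RHS]addrC addrA addrAC.
apply: cvgD; last exact: dv.
apply/cvgrPdist_le => e e0.
have ae : 0 < e / (`|a| + 1) by rewrite divr_gt0 // ltr_wpDl.
move/cvgrPdist_le : cu => /(_ _ ae) /nbhs_ballP[r /= r0 rP].
have M0 : 0 < `|v| + `|a| * `|u| + 1 by rewrite ltr_wpDl // addr_ge0 // mulr_ge0.
have : \forall k \near (0 : R)^', `|k| < r / (`|v| + `|a| * `|u| + 1).
  apply: dnbhs0_lt; exact: divr_gt0.
have kn0 : \forall k \near (0 : R)^', k != 0 by exact: nbhs_dnbhs_neq.
move=> krN; near=> k.
have k0 : k != 0 by near: k.
have kr : `|k| < r / (`|v| + `|a| * `|u| + 1) by near: k.
pose g := fun s : R^o => f (x + k *: v + s *: u) : R^o.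
have dg (s : R) : derivable g s 1.
  by apply: derivable_line; rewrite scale1r; exact: du.
have [c cb] := MVT_0 (k * a) dg.
rewrite /g scale0r addr0 => ->.
rewrite derive_line scale1r [k^-1 *: _]mulrC -mulrA (mulrC k) mulfK // mulrC -mulrBr normrM.
have := rP (x + k *: v + c *: u) _ => H.
apply: (@le_trans _ _ (`|a| * (e / (`|a| + 1)))).
  apply: ler_wpM2l => //; apply: H.
  rewrite -ball_normE /ball_ /= -addrA opprD addrA subrr add0r normrN.
  apply: le_lt_trans (ler_normD _ _) _; rewrite !normrZ.
  apply: (@le_lt_trans _ _ (`|k| * (`|v| + `|a| * `|u| + 1))).
    rewrite 2!mulrDr mulr1 mulrA -normrM -!addrA lerD2l.
    by apply: (le_trans (ler_wpM2r (normr_ge0 u) cb)); rewrite lerDl.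
  by rewrite -ltr_pdivlMr.
rewrite mulrCA ger_pMr // ler_pdivrMr ?mul1r ?lerDl //.
Unshelve. all: by end_near. Qed.

Lemma derive_sum_scale f (I : Type) (s : seq I) (a : I -> R) (e : I -> V) v x :
  Ck 1 setT f ->
  'D_(\sum_(i <- s) a i *: e i + v) f x = \sum_(i <- s) a i * 'D_(e i) f x + 'D_v f x.
Proof.
move=> [_ Cf]; elim: s => [|i s IH]; first by rewrite !big_nil !add0r.
rewrite !big_cons -!addrA derive_scaleD ?IH //.
- by move=> y; have [+ _] := Cf (e i); exact.
- by have [+ _] := Cf (\sum_(j <- s) a j *: e j + v); exact.
- by have [_ [+ _]] := Cf (e i); exact.
Qed.

End directional_derivative.

Section test_functions.
Context {R : realType} {V : normedModType R}.
Implicit Types (f : V -> R) (U : set V).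

Lemma compact_support_bounded f (K : set V) : continuous f -> compact K ->
  (forall x, ~ K x -> f x = 0) -> exists M : R, forall x, `|f x| <= M.
Proof.
move=> cf cK fK0.
have : compact (f @` K).
  by apply: continuous_compact => //; apply: continuous_subspaceT.
move=> /compact_bounded [M [_ MP]].
exists (Num.max 0 (M + 1)) => x.
have [Kx|nKx] := pselect (K x); last by rewrite fK0 // normr0 le_max lexx.
by rewrite le_max (MP (M + 1)) ?orbT ?ltrDl //; exists x.
Qed.

Lemma derive_off_support f (K : set V) (v : V) : closed K ->
  (forall x, ~ K x -> f x = 0) -> forall x, ~ K x -> 'D_v (f : V -> R^o) x = 0.
Proof.
move=> cK fK0 x nKx.
have -> : 'D_v (f : V -> R^o) x = 'D_v (cst 0 : V -> R^o) x; last by rewrite derive_cst.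
apply: near_eq_derive; near=> y.
apply: fK0; near: y.
by have := open_nbhs_nbhs (conj (closed_openC cK) nKx).
Unshelve. all: by end_near. Qed.

Lemma test_function_continuous U f : test_function U f -> continuous f.
Proof. by move=> [+ _] => /(_ 0%N) [cf _] x; exact: cf. Qed.

Lemma test_function_bounded U f : test_function U f ->
  exists M : R, forall x, `|f x| <= M.
Proof.
move=> tf; have cf := test_function_continuous tf.
by move: tf => [_ [K [cK _] fK0]]; exact: compact_support_bounded cf cK fK0.
Qed.

Lemma test_function_derive_continuous U f v : test_function U f ->
  continuous (fun x => 'D_v (f : V -> R^o) x).
Proof. by move=> [+ _] => /(_ 1%N) [_ /(_ v) [_ [cf _]]] x; exact: cf. Qed.

Lemma test_function_derive_bounded U f v : test_function U f ->
  exists M : R, forall x, `|'D_v (f : V -> R^o) x| <= M.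
Proof.
move=> tf; have cf := test_function_derive_continuous (v := v) tf.
move: tf => [_ [K [cK _] fK0]]; apply: (compact_support_bounded cf cK).
exact: (derive_off_support v (compact_closed (@norm_hausdorff _ _) cK) fK0).
Qed.

End test_functions.

Section space_time_test_function.
Context {R : realType} {d : nat}.
Implicit Types (eta : 'rV[R]_d * R^o -> R) (x w : 'rV[R]_d).

Let lineE x w (t : R) :
  (x + t *: w, t) = ((x, 0) : 'rV[R]_d * R^o) + t *: ((w, 1) : 'rV[R]_d * R^o).
Proof. by congr pair => /=; rewrite add0r /GRing.scale /= mulr1. Qed.

Lemma test_function_line eta x w (t0 t1 : R) :
  test_function (setT `*` `]t0, t1[) eta ->
  test_function `]t0, t1[ (fun t : R^o => eta (x + t *: w, t)).
Proof.
move=> [seta [K [cK KU] K0]]; split.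
  move=> k; under eq_fun do rewrite lineE.
  exact: (Ck_line (V := ('rV[R]_d * R^o)%type) (f := eta)).
exists (snd @` K).
  split; last by move=> _ [[y s] /KU [_ /= st] <-].
  by apply: continuous_compact => //; apply: continuous_subspaceT => z; exact: cvg_snd.
by move=> t nKt; apply: K0 => Kt; apply: nKt; exists (x + t *: w, t).
Qed.

(** The curve moves in the direction (w, 1). Its expansion in coordinate directions makes the
    derivative along a trajectory the sum of the time derivative and the transport term. *)
Lemma derive_material eta x w (t : R) : Ck 1 setT eta ->
  'D_1 ((fun t : R^o => eta (x + t *: w, t)) : R^o -> R^o) t =
  diff_t eta (x + t *: w, t) + edot (grad_x eta (x + t *: w, t)) w.
Proof.
move=> Ceta; under eq_fun do rewrite lineE.
rewrite (derive_line (V := ('rV[R]_d * R^o)%type) (eta : _ -> R^o)) scale1r.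
rewrite -lineE.
have -> : ((w, 1) : 'rV[R]_d * R^o) =
    \sum_(k <- index_enum 'I_d) w 0 k *: ((delta_mx 0 k, 0) : 'rV[R]_d * R^o) + (0, 1).
  rewrite [X in (X, _)]row_sum_delta.
  elim: (index_enum _) => [|k s IH]; first by rewrite !big_nil add0r.
  rewrite !big_cons -addrA -IH; congr pair => /=.
  by rewrite scaler0 add0r.
rewrite derive_sum_scale // addrC; congr (_ + _).
by apply: eq_bigr => k _; rewrite mxE mulrC.
Qed.

End space_time_test_function.

(** * Linear majorants of the interpolation function *)

Section theta.
Context {R : realType}.
Variable theta : R -> R -> R.
Hypothesis theta_interp : interpolation_function theta.

(** The dual description of [theta] on the closed quadrant: the coefficients are nonnegative, and
    the infimum over all such pairs is attained at interior points. *)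
Definition linear_majorant (a b : R) : Prop :=
  forall s t : R, 0 <= s -> 0 <= t -> theta s t <= a * s + b * t.

Lemma linear_majorant_ge0 a b : linear_majorant a b -> 0 <= a /\ 0 <= b.
Proof.
move=> M; split.
  have := M 1 0 ler01 (lexx 0); rewrite mulr0 addr0 mulr1.
  by apply: le_trans; apply: (theta_ge0 theta_interp).
have := M 0 1 (lexx 0) ler01; rewrite mulr0 add0r mulr1.
by apply: le_trans; apply: (theta_ge0 theta_interp).
Qed.

Lemma theta_mono2 (s s' t t' : R) : 0 <= s -> s <= s' -> 0 <= t -> t <= t' ->
  theta s t <= theta s' t'.
Proof.
move=> s0 ss' t0 tt'.
have s'0 := le_trans s0 ss'; have t'0 := le_trans t0 tt'.
apply: (@le_trans _ _ (theta s' t)); first exact: (theta_mono theta_interp).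
rewrite (theta_sym theta_interp) // (theta_sym theta_interp s'0) //.
exact: (theta_mono theta_interp).
Qed.

(** By homogeneity it suffices to support the concave function [phi] at x0 = s0 / t0. The slope is
    the supremum of the difference quotients to the right of x0. *)
Lemma theta_tangent (s0 t0 : R) : 0 < s0 -> 0 < t0 ->
  exists a b, linear_majorant a b /\ a * s0 + b * t0 = theta s0 t0.
Proof.
move=> s00 t00; pose phi x := theta x 1; pose x0 := s0 / t0.
have x00 : 0 < x0 by rewrite divr_gt0.
(* Concavity at x0, a convex combination of [y] and [z]: quotients to the right lie below quotients
   to the left. *)
have conc y z : 0 <= y -> y < x0 -> x0 < z ->
    (phi z - phi x0) / (z - x0) <= (phi x0 - phi y) / (x0 - y).
  move=> y0 yx xz.
  have zy : 0 < z - y by lra.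
  have zx : 0 < z - x0 by lra.
  have xy : 0 < x0 - y by lra.
  have z0 : 0 <= z by lra.
  have zy' : z - y != 0 by rewrite gt_eqF.
  have := theta_concave theta_interp (lam := (z - x0) / (z - y)) y0 ler01 z0 ler01.
  have l0 : 0 <= (z - x0) / (z - y) by rewrite divr_ge0 // ltW.
  have l1 : (z - x0) / (z - y) <= 1 by rewrite ler_pdivrMr // mul1r; lra.
  move=> /(_ l0 l1).
  have -> : (z - x0) / (z - y) * y + (1 - (z - x0) / (z - y)) * z = x0 by field.
  have -> : (z - x0) / (z - y) * 1 + (1 - (z - x0) / (z - y)) * 1 = 1 by field.
  rewrite -/(phi _) -/(phi _) -/(phi _).
  have -> : 1 - (z - x0) / (z - y) = (x0 - y) / (z - y) by field.
  move=> H.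
  rewrite ler_pdivrMr // mulrAC ler_pdivlMr //.
  have : (z - x0) * phi y + (x0 - y) * phi z <= phi x0 * (z - y).
    rewrite -ler_pdivrMr // mulrDl; apply: le_trans H.
    by apply: le_of_eq; field.
  by lra.
pose L := [set (phi z - phi x0) / (z - x0) | z in [set z | x0 < z]].
have hL : has_sup L.
  split; first by exists ((phi (x0 + 1) - phi x0) / (x0 + 1 - x0)), (x0 + 1) => //=; lra.
  exists ((phi x0 - phi 0) / (x0 - 0)) => _ [z /= xz <-]; exact: conc.
pose a := sup L; pose b := phi x0 - a * x0.
have tan y : 0 <= y -> phi y <= a * y + b.
  move=> y0; have [yx|xy|->] := ltgtP y x0; last by rewrite /b; lra.
    have : a <= (phi x0 - phi y) / (x0 - y).
      by apply: ge_sup; [exact: hL.1|move=> _ [z /= xz <-]; exact: conc].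
    by rewrite ler_pdivlMr /b; [lra|rewrite subr_gt0].
  have : (phi y - phi x0) / (y - x0) <= a by apply: sup_ubound; [exact: hL.2|exists y].
  by rewrite ler_pdivrMr /b; [lra|rewrite subr_gt0].
have maj s t : 0 <= s -> 0 < t -> theta s t <= a * s + b * t.
  move=> s_0 t_0; have := theta_homogeneous theta_interp t_0 (divr_ge0 s_0 (ltW t_0)) ler01.
  rewrite mulr1 mulrC divfK ?gt_eqF // => ->.
  have := tan _ (divr_ge0 s_0 (ltW t_0)).
  rewrite -(ler_pM2l t_0); move=> /le_trans; apply.
  by apply: le_of_eq; field; rewrite gt_eqF.
exists a, b; split.
  (* On the axis t = 0 the scaling by [t] is lost; monotonicity compares with the small value e /
     (|b| + 1), whose contribution to the majorant is at most [e]. *)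
  move=> s t s_0; rewrite le_eqVlt => /predU1P[<-|]; last exact: maj.
  rewrite mulr0 addr0; apply/ler_addgt0Pr => e e0.
  have b1 : 0 < `|b| + 1 by rewrite ltr_wpDl.
  have eb : 0 < e / (`|b| + 1) by rewrite divr_gt0.
  apply: (@le_trans _ _ (theta s (e / (`|b| + 1)))).
    by apply: theta_mono2 => //; exact: ltW.
  apply: (le_trans (maj _ _ s_0 eb)); rewrite lerD2l mulrCA.
  rewrite ger_pMr // ler_pdivrMr // mul1r.
  by rewrite (le_trans (ler_norm _)) // lerDl.
have := theta_homogeneous theta_interp t00 (ltW x00) ler01.
rewrite mulr1 mulrC divfK ?gt_eqF // => ->; rewrite -/(phi x0).
by rewrite /b /x0; field; rewrite gt_eqF.
Qed.

(** Stated for points above and to the right, where rational approximations are chosen: these have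
    positive coordinates even when [s] or [t] is zero. *)
Lemma theta_upper_semicontinuous (s t e : R) : 0 <= s -> 0 <= t -> 0 < e ->
  exists2 r, 0 < r & forall s' t', s < s' < s + r -> t < t' < t + r ->
    theta s' t' <= theta s t + e.
Proof.
move=> s0 t0 e0; have /(_ (s, t)) ct := theta_continuous theta_interp.
have Q : [set p : R * R | 0 <= p.1 /\ 0 <= p.2] (s, t) by [].
have {}ct : theta p.1 p.2 @[p --> within [set p : R * R | 0 <= p.1 /\ 0 <= p.2] (nbhs (s, t))]
    --> theta s t by rewrite (nbhs_subspace_in Q); exact: ct.
move/cvgrPdist_le : ct => /(_ _ e0).
move=> /nbhs_ballP [r /= r0 rP]; exists r => // s' t' /andP[ss' s'r] /andP[tt' t'r].
have : `|theta s t - theta s' t'| <= e.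
  apply: (rP (s', t')); last by split=> /=; lra.
  by split; rewrite /ball /= ltr_norml; apply/andP; split; lra.
by rewrite ler_norml => /andP[? _]; lra.
Qed.

(** Tangents at rational points suffice. Since the coefficients are nonnegative, the tangent at (c,
    c') takes at a smaller point a value at most [theta c c'], which is close to [theta s t]. *)
Lemma countable_linear_majorants : exists A B : nat -> R,
  (forall k, linear_majorant (A k) (B k)) /\
  forall s t e, 0 <= s -> 0 <= t -> 0 < e -> exists k, A k * s + B k * t <= theta s t + e.
Proof.
have H (p : rat * rat) : exists ab : R * R, linear_majorant ab.1 ab.2 /\
    (0 < p.1 -> 0 < p.2 -> ab.1 * ratr p.1 + ab.2 * ratr p.2 = theta (ratr p.1) (ratr p.2)).
  have [p1|p1] := ltP 0 p.1; last first.
    have [a [b [ab _]]] := theta_tangent ltr01 ltr01.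
    by exists (a, b); split=> //; rewrite ltNge p1.
  have [p2|p2] := ltP 0 p.2; last first.
    have [a [b [ab _]]] := theta_tangent ltr01 ltr01.
    by exists (a, b); split=> // _; rewrite ltNge p2.
  have r1 : 0 < ratr p.1 :> R by rewrite ltr0q.
  have r2 : 0 < ratr p.2 :> R by rewrite ltr0q.
  by have [a [b [ab abE]]] := theta_tangent r1 r2; exists (a, b).
have [F FP] := choice H.
(* The default pair is harmless, because [F] assigns a majorant to every pair. *)
pose q k : rat * rat := odflt (0, 0) (unpickle k).
exists (fun k => (F (q k)).1), (fun k => (F (q k)).2); split.
  by move=> k; have [] := FP (q k).
move=> s t e s0 t0 e0; have [r r0 rP] := theta_upper_semicontinuous s0 t0 e0.
have sr : s < s + r by lra.
have tr : t < t + r by lra.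
have [c] := rat_in_itvoo sr; rewrite in_itv /= => /andP[sc cr].
have [c'] := rat_in_itvoo tr; rewrite in_itv /= => /andP[tc c'r].
exists (pickle (c, c')); rewrite /q pickleK /=.
have [/linear_majorant_ge0[a0 b0] /= eq] := FP (c, c').
have c0 : 0 < c by rewrite -(ltr0q R) (le_lt_trans s0).
have c'0 : 0 < c' by rewrite -(ltr0q R) (le_lt_trans t0).
apply: le_trans (rP _ _ (introT andP (conj sc cr)) (introT andP (conj tc c'r))).
by rewrite -eq // lerD // ler_wpM2l // ltW.
Qed.

End theta.

Lemma Rintegral_ae_eq d (T : measurableType d) (R : realType)
    (mu : {measure set T -> \bar R}) (f g : T -> R) :
  mfun f -> mfun g ->
  {ae mu, forall x, f x = g x} -> \int[mu]_x f x = \int[mu]_x g x.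
Proof.
move=> mf mg fg; congr fine; apply: ae_eq_integral => //.
- exact/measurable_EFinP.
- exact/measurable_EFinP.
- by apply: filterS fg => x -> _.
Qed.

(** * Jensen's inequality for conditional expectations *)

Section conditional_jensen.
Context {d d'} {S : measurableType d} {E : measurableType d'} {R : realType}.
Variables (H : {finite_measure set S -> \bar R}) (X : S -> E).
Hypothesis (mX : mfun X).

Lemma is_condexp_int h f : is_condexp H X h f -> \int[H]_s f (X s) = \int[H]_s h s.
Proof.
move=> [_ _ /(_ (cst 1))]; under eq_Rintegral do rewrite mul1r.
under [in X in _ -> _ -> _ = X]eq_Rintegral do rewrite mul1r.
by apply; [exact: measurable_cst|exists 1 => x; rewrite normr1].
Qed.

(** The bounds hold almost everywhere for any version and are made to hold everywhere by truncation,
    since [theta] is controlled only on nonnegative arguments. *)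
Lemma condexp_bounds01 (h : S -> R) : mfun h ->
  (forall s, 0 <= h s <= 1) ->
  exists f : E -> R, is_condexp H X h f /\ forall x, 0 <= f x <= 1.
Proof.
move=> mh h01.
have ih : L1 H h.
  rewrite (_ : EFin \o h = EFin \o (h \* cst 1)).
    apply: integrable_bounded_mul => //; last exact: finite_measure_integrable_cst.
    by exists 1 => s; have /andP[h0 h1] := h01 s; rewrite ger0_norm.
  by apply/funext => s /=; rewrite mulr1.
have [f [mf iff fP]] := condexp mX ih.
have A01 (A : set E) : exists K : R, forall x, `|\1_A x : R| <= K.
  by exists 1 => x; rewrite indicE; case: (_ \in _); rewrite ?normr1 ?normr0.
have indI (A : set E) (k : S -> R) : measurable A -> L1 H k -> L1 H ((\1_A \o X) \* k).
  move=> mA ik; apply: integrable_bounded_mul => //.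
    by apply: measurableT_comp => //; exact: measurable_indic.
  by have [K KA] := A01 A; exists K => s; exact: KA.
have f_ge0 : {ae H, forall s, 0 <= f (X s)}.
  apply: condexp_ge0 => // A mA.
  rewrite fP //.
  apply: Rintegral_ge0 => s _; have /andP[h0 h1] := h01 s.
  by rewrite mulr_ge0 // indicE; case: (_ \in _).
have i1 : L1 H (cst (1 : R)) by exact: finite_measure_integrable_cst.
have i1f : H.-integrable setT (EFin \o (cst 1 \- f) \o X).
  have i := integrableB measurableT i1 iff.
  by apply: (eq_integrable measurableT _ _ _ i).
have f_le1 : {ae H, forall s, 0 <= 1 - f (X s)}.
  apply: (@condexp_ge0 _ _ _ _ _ _ _ mX (cst 1 \- f)) => // [|A mA].
    by apply: measurable_funB.
  rewrite (_ : \int[H]_s _ = \int[H]_s (\1_A (X s) * (1 - h s))).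
    apply: Rintegral_ge0 => s _; have /andP[h0 h1] := h01 s.
    by rewrite mulr_ge0 ?subr_ge0 // indicE; case: (_ \in _).
  transitivity (\int[H]_s (\1_A (X s) * 1) - \int[H]_s (\1_A (X s) * f (X s))).
    rewrite -RintegralB //; [|exact: (indI _ (cst 1))|exact: (indI _ (f \o X))].
    by apply: eq_Rintegral => s _ /=; rewrite -mulrBr.
  rewrite fP //.
  rewrite -RintegralB //; [|exact: (indI _ (cst 1))|exact: indI].
  by apply: eq_Rintegral => s _ /=; rewrite -mulrBr.
pose g x := Num.min 1 (Num.max 0 (f x)).
have mg : mfun g.
  by apply: measurable_minr => //; apply: measurable_maxr.
have g01 x : 0 <= g x <= 1 by rewrite /g le_min ge_min le_max !lexx ler01.
have gf : {ae H, forall s, g (X s) = f (X s)}.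
  apply: filterS2 f_ge0 f_le1 => s f0; rewrite subr_ge0 => f1.
  by rewrite /g (max_idPr f0) (min_idPr f1).
exists g; split=> //; split=> //.
  apply: (eq_integrable measurableT (EFin \o ((g \o X) \* cst 1))).
    by move=> s _ /=; rewrite mulr1.
  apply: integrable_bounded_mul => //; first exact: measurableT_comp.
  by exists 1 => s; have /andP[h0 h1] := g01 (X s); rewrite ger0_norm.
move=> F mF Fb; rewrite -fP //.
have mFX : mfun (F \o X) by exact: measurableT_comp.
apply: Rintegral_ae_eq.
- by apply: measurable_funM => //; exact: measurableT_comp.
- by apply: measurable_funM => //; exact: measurableT_comp.
- by apply: filterS gf => s ->.
Qed.

(** The linear core of Jensen's inequality: a linear inequality between integrands passes to
    conditional expectations. Quadratic inequalities follow from countably many choices of the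
    coefficients and [discriminant_rat]. *)
Lemma condexp_linear3 (h1 l1 l2 : R) (hc hN hf hg : S -> R) (c' N f g : E -> R) :
  L1 H hc -> L1 H hN -> L1 H hf -> L1 H hg ->
  is_condexp H X hc c' -> is_condexp H X hN N -> is_condexp H X hf f -> is_condexp H X hg g ->
  (forall s, 0 <= hc s + h1 * hN s + l1 * hf s + l2 * hg s) ->
  {ae H, forall s, 0 <= c' (X s) + h1 * N (X s) + l1 * f (X s) + l2 * g (X s)}.
Proof.
move=> ic iN i_f ig [mc' ic' c'P] [mN iN' NP] [mf if' fP] [mg ig' gP] pos.
have comb (k1 k2 k3 k4 : S -> R) : L1 H k1 -> L1 H k2 -> L1 H k3 ->
    L1 H k4 ->
    H.-integrable setT (fun s => (k1 s + h1 * k2 s + l1 * k3 s + l2 * k4 s)%:E) /\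
    \int[H]_s (k1 s + h1 * k2 s + l1 * k3 s + l2 * k4 s) =
     \int[H]_s k1 s + h1 * \int[H]_s k2 s + l1 * \int[H]_s k3 s + l2 * \int[H]_s k4 s.
  move=> j1 j2 j3 j4.
  have z2 := L1Z h1 j2; have z3 := L1Z l1 j3; have z4 := L1Z l2 j4.
  have z12 := L1D j1 z2; have z123 := L1D z12 z3.
  split; first exact: (L1D z123 z4).
  by rewrite !RintegralD // !RintegralZl.
apply: (@condexp_ge0 _ _ _ _ _ _ _ mX (fun x => c' x + h1 * N x + l1 * f x + l2 * g x)).
- by repeat apply: measurable_funD => //; apply: measurable_funM.
- exact: (comb _ _ _ _ ic' iN' if' ig').1.
move=> A mA.
have mI : mfun (\1_A : E -> R) by exact: measurable_indic.
have bI : exists K : R, forall x, `|\1_A x : R| <= K.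
  by exists 1 => x; rewrite indicE; case: (_ \in _); rewrite ?normr1 ?normr0.
have indI (k : S -> R) : L1 H k -> L1 H (fun s => \1_A (X s) * k s).
  move=> ik; apply: (@integrable_bounded_mul _ _ _ _ (\1_A \o X)) => //.
    by apply: measurableT_comp.
  by have [K KA] := bI; exists K => s; exact: KA.
have dist (k1 k2 k3 k4 : S -> R) : (fun s => \1_A (X s) * (k1 s + h1 * k2 s + l1 * k3 s + l2 * k4 s)) =
   (fun s => \1_A (X s) * k1 s + h1 * (\1_A (X s) * k2 s) + l1 * (\1_A (X s) * k3 s) + l2 * (\1_A (X s) * k4 s)).
  by apply/funext => s; ring.
rewrite (dist (c' \o X) (N \o X) (f \o X) (g \o X)).
rewrite (comb _ _ _ _ (indI _ ic') (indI _ iN') (indI _ if') (indI _ ig')).2.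
rewrite c'P // NP // fP // gP //.
rewrite -(comb _ _ _ _ (indI _ ic) (indI _ iN) (indI _ i_f) (indI _ ig)).2 -dist.
apply: Rintegral_ge0 => s _; rewrite mulr_ge0 // indicE; by case: (_ \in _).
Qed.

End conditional_jensen.

(* The inequalities say that the quadratic [L a^2 - 2 N a + c] is nonnegative
   for [L] arbitrarily close to [th]; [N^2 <= c th] is its discriminant. *)
Lemma discriminant_rat (R : realType) (N c th : R) (L : nat -> R) :
  0 <= th -> (forall (a : rat) k, 0 <= c + - (2 * ratr a) * N + ratr a ^+ 2 * L k) ->
  (forall e, 0 < e -> exists k, L k <= th + e) -> N ^+ 2 <= c * th.
Proof.
move=> th0 HL Lth.
have Hth (a : rat) : 2 * ratr a * N <= c + ratr a ^+ 2 * th.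
  apply/ler_addgt0Pr => e e0.
  have a1 : 0 < ratr a ^+ 2 + 1 :> R by rewrite ltr_wpDl // sqr_ge0.
  have [k Lk] := Lth _ (divr_gt0 e0 a1).
  have := HL a k; have := ler_wpM2l (sqr_ge0 (ratr a : R)) Lk.
  have : ratr a ^+ 2 * (e / (ratr a ^+ 2 + 1)) <= e.
    by rewrite mulrCA ger_pMr // ler_pdivrMr // mul1r lerDl.
  by rewrite mulrDr; lra.
have c0 : 0 <= c by have := Hth 0; rewrite !rmorph0 mulr0 mul0r expr0n mul0r addr0.
move: th0; rewrite le_eqVlt => /predU1P[th0|th0].
  rewrite -th0 mulr0; move: Hth; rewrite -th0 => Hth.
  suff -> : N = 0 by rewrite expr0n.
  apply/eqP; apply/negPn/negP => N0.
  have N0' : 0 < `|N| by rewrite normr_gt0.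
  (* With [th] equal to zero, 2 a N <= c for every rational [a]; a large one, or its opposite,
     excludes a nonzero [N]. *)
  have [b] := rat_gt ((c + 1) / (2 * `|N|)).
  rewrite ltr_pdivrMr ?mulr_gt0 // => Hb.
  have := Hth b; have := Hth (- b); rewrite rmorphN /= !mulr0 !addr0 => H1 H2.
  have : c + 1 < ratr b * (2 * N) \/ c + 1 < ratr b * (2 * - N).
    move: Hb; have [Npos|Nneg] := leP 0 N; first by rewrite ger0_norm //; left.
    by rewrite ltr0_norm //; right.
  by case; lra.
rewrite -ler_pdivrMr //; apply/ler_addgt0Pr => e e0.
(* a rational a with th (a - N/th)^2 <= e *)
pose r := Num.min 1 (e / th).
have r0 : 0 < r by rewrite lt_min ltr01 divr_gt0.
have [a /[!in_itv] /= /andP[a1 a2]] : exists a : rat, ratr a \in `]N / th, N / th + r[.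
  by apply: rat_in_itvoo; rewrite ltrDl.
have := Hth a.
have -> : N ^+ 2 / th = 2 * ratr a * N - ratr a ^+ 2 * th + th * (ratr a - N / th) ^+ 2.
  by field; rewrite gt_eqF.
suff : th * (ratr a - N / th) ^+ 2 <= e by lra.
rewrite mulrC -ler_pdivlMr //; apply: (@le_trans _ _ r); last by rewrite ge_min lexx orbT.
have x0 : 0 <= ratr a - N / th by lra.
have xr : ratr a - N / th <= r by lra.
rewrite expr2 (le_trans (ler_pM x0 x0 xr xr)) // ger_pMr //.
by rewrite ge_min lexx.
Qed.

(** * Products of finite measures and Lebesgue measure on the unit interval *)

Section finite_product.
Context {d1 d2} {T1 : measurableType d1} {T2 : measurableType d2} {R : realType}.
Variables (m1 : {finite_measure set T1 -> \bar R}) (m2 : {finite_measure set T2 -> \bar R}).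

Definition prodfin : set (T1 * T2) -> \bar R := (m1 \x m2)%E.

HB.instance Definition _ := Measure.on prodfin.

Let prodfin_fin : fin_num_fun prodfin.
Proof.
move=> A mA; rewrite ge0_fin_numE //.
apply: (@le_lt_trans _ _ (prodfin setT)); first by rewrite le_measure ?inE.
rewrite /prodfin -setXTT product_measure1E // lte_mul_pinfty //.
- by rewrite fin_num_measure.
- by rewrite ltey_eq fin_num_measure.
Qed.

HB.instance Definition _ := Measure_isFinite.Build _ _ _ prodfin prodfin_fin.

Lemma ge0_prodfin21 (f : T1 * T2 -> \bar R) : mfun f ->
  (forall z, 0 <= f z)%E ->
  (\int[prodfin]_z f z = \int[m2]_t \int[m1]_y f (y, t))%E.
Proof. exact: fubini_tonelli2. Qed.

Lemma ge0_prodfin12 (f : T1 * T2 -> \bar R) : mfun f ->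
  (forall z, 0 <= f z)%E ->
  (\int[prodfin]_z f z = \int[m1]_y \int[m2]_t f (y, t))%E.
Proof. exact: fubini_tonelli1. Qed.

Lemma ge0_prodfin_slice (f : T1 * T2 -> \bar R) : mfun f ->
  (forall z, 0 <= f z)%E -> mfun (fun t => \int[m1]_y f (y, t))%E.
Proof. exact: measurable_fun_fubini_tonelli_G. Qed.

Lemma Rintegral_slice_measurable (f : T1 * T2 -> R) :
  L1 prodfin f ->
  mfun (fun t => \int[m1]_y f (y, t)).
Proof.
move=> i_f; apply: measurableT_comp => //.
exact: (measurable_fubini_G (m1 := m1) (m2 := m2) i_f).
Qed.

(** Inner integrals are real-valued in [Rintegral] but extended in Fubini's theorem, where they may
    be infinite on a null set. *)
Let fine_integral d (T : measurableType d) (m : {measure set T -> \bar R}) (g : T -> \bar R) :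
  m.-integrable setT g -> (\int[m]_t g t = \int[m]_t (fine (g t))%:E)%E.
Proof.
move=> ig; apply: ae_eq_integral => //.
- exact: measurable_int ig.
- apply/measurable_EFinP; apply: measurableT_comp => //; exact: measurable_int ig.
- by have := integrable_ae measurableT ig; apply: filterS => t /(_ I) gt _; rewrite fineK // gt.
Qed.

Lemma integrable_slice (f : T1 * T2 -> \bar R) : prodfin.-integrable setT f ->
  m2.-integrable setT (fun t => \int[m1]_y f (y, t))%E.
Proof.
move=> i_f; apply/integrableP; split.
  exact: (measurable_fubini_G (m1 := m1) (m2 := m2) i_f).
have mf := measurable_int _ i_f.
apply: le_lt_trans (integrableP _ _ _ i_f).2.
rewrite ge0_prodfin21 //; last exact: measurableT_comp.
apply: ge0_le_integral_nonmeas => // t _; apply: le_abse_integral => //.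
exact: measurableT_comp mf (pair2_measurable t).
Qed.

Lemma Rintegral_prodfin21 (f : T1 * T2 -> R) : L1 prodfin f ->
  \int[prodfin]_z f z = \int[m2]_t \int[m1]_y f (y, t).
Proof.
move=> i_f; congr fine; rewrite -fine_integral.
  by rewrite (integral21_prod_meas1 (m1 := m1) (m2 := m2) i_f).
exact: (integrable_slice i_f).
Qed.

Lemma Rintegral_prodfin12 (f : T1 * T2 -> R) : L1 prodfin f ->
  \int[prodfin]_z f z = \int[m1]_y \int[m2]_t f (y, t).
Proof.
move=> i_f; congr fine; rewrite -fine_integral.
  by rewrite (integral12_prod_meas1 (m1 := m1) (m2 := m2) i_f).
exact: (integrable_fubini_F (m1 := m1) (m2 := m2) i_f).
Qed.

End finite_product.

Section unit_interval.
Context {R : realType}.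
Local Notation leb := (@lebesgue_measure R).
Local Notation RL := (measurableTypeR R).

Let m01 : measurable (`[0, 1] : set RL). Proof. exact: measurable_itv. Qed.

Let leb01 : (leb (`[0%R, 1%R] : set R) < +oo)%E.
Proof. by rewrite lebesgue_measure_itv /= lte01 oppr0 adde0 ltry. Qed.

Let leb_r : {finite_measure set RL -> \bar R} := mfrestr m01 leb01.

Let mid : mfun (idfun : RL -> R). Proof. by move=> _ A mA; rewrite setTI. Qed.

Let i1 : L1 leb_r (cst (1 : R)).
Proof. exact: finite_measure_integrable_cst. Qed.

Let one0 (t : RL) : 0 <= cst (1 : R) t. Proof. exact: ler01. Qed.

(* Lebesgue measure is defined on the copy [measurableTypeR R] of [R], whose
   display differs from that of the canonical Borel structure of [R]. *)
Definition leb_unit : {finite_measure set R -> \bar R} := wimage i1 one0 mid.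

Lemma leb_unitE A : measurable A -> leb_unit A = leb (A `&` `[0, 1]).
Proof.
move=> mA; rewrite /leb_unit /= /wimage /preimage /=.
rewrite (integral_cst _ (mA : measurable (A : set RL)) 1%:E) mul1e.
by [].
Qed.

Lemma leb_unit_setT : leb_unit setT = 1%E.
Proof. by rewrite leb_unitE // setTI lebesgue_measure_itv /= lte_fin ltr01 sube0. Qed.

Lemma leb_unit_ae (P : R -> Prop) : (forall t, t \in `[0, 1] -> P t) ->
  {ae leb_unit, forall t, P t}.
Proof.
move=> P01; exists (~` (`[0, 1] : set R)); split=> [||t nPt t01].
- exact: measurableC.
- by rewrite leb_unitE ?setICl ?measure0 //; exact: measurableC.
- exact/nPt/P01.
Qed.

Let integral_leb_r (f : RL -> \bar R) : mfun f ->
  (\int[leb_r]_t f t = \int[leb]_(t in `[0%R, 1%R]) f t)%E.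
Proof.
move=> mf; transitivity (\int[leb_r]_t (f \_ `[0%R, 1%R]) t)%E.
  apply: ae_eq_integral => //; first by apply/(measurable_restrictT _ m01); exact: measurable_funTS.
  exists (~` (`[0, 1] : set RL)); split=> [||t nPt t01].
  - exact: measurableC.
  - by rewrite /leb_r /= /mfrestr /mrestr /= setICl measure0.
  - by apply: nPt => _; rewrite patchE mem_set.
rewrite -integral_mkcond; apply: eq_measure_integral => A mA A01.
by rewrite /leb_r /= /mfrestr /mrestr /= setIidl.
Qed.

Lemma ge0_integral_leb_unit (f : R -> \bar R) : mfun f ->
  (forall t, 0 <= f t)%E ->
  (\int[leb_unit]_t f t = \int[leb]_(t in `[0%R, 1%R]) f t)%E.
Proof.
move=> mf f0; rewrite ge0_integral_wimage // -integral_leb_r //.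
by apply: eq_integral => t _ /=; rewrite mule1.
Qed.

Lemma Rintegral_leb_unit (f : R -> R) : mfun f ->
  \int[leb_unit]_t f t = \int[leb]_(t in `[0, 1]) f t.
Proof.
move=> mf; rewrite Rintegral_wimage // /Rintegral -integral_leb_r.
  by congr fine; apply: eq_integral => t _ /=; rewrite mulr1.
by apply/measurable_EFinP.
Qed.

Lemma integrable_leb_unit (f : R -> R) :
  leb.-integrable (`[0, 1] : set R) (EFin \o f) -> mfun f -> L1 leb_unit f.
Proof.
move=> /integrableP[_ i_f] mf; apply/integrableP; split.
  exact/measurable_EFinP.
rewrite ge0_integral_leb_unit //.
by apply: measurableT_comp => //; exact/measurable_EFinP.
Qed.

End unit_interval.

Lemma ae_countable d (T : measurableType d) (R : realType) (I : countType)
    (mu : {measure set T -> \bar R}) (Q : I -> T -> Prop) :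
  (forall i, {ae mu, forall x, Q i x}) -> {ae mu, forall x, forall i, Q i x}.
Proof.
move=> QI; have : {ae mu, forall x, forall k, if unpickle k is Some i then Q i x else True}.
  apply: ae_foralln => k; case: (unpickle k) => [i|]; first exact: QI.
  by apply: aeW.
by apply: filterS => x H i; have := H (pickle i); rewrite pickleK.
Qed.

Lemma integrable_bounded d (T : measurableType d) (R : realType)
    (mu : {finite_measure set T -> \bar R}) (f : T -> R) (K : R) :
  mfun f -> (forall x, `|f x| <= K) -> L1 mu f.
Proof.
move=> mf fK; apply: (eq_integrable measurableT (EFin \o (f \* cst 1))).
  by move=> s _ /=; rewrite mulr1.
apply: integrable_bounded_mul => //; first by exists K.
exact: finite_measure_integrable_cst.
Qed.

Lemma integral_set_indic d (T : measurableType d) (R : realType)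
    (mu : {measure set T -> \bar R}) (B : set T) (g : T -> R) :
  (\int[mu]_(x in B) (g x)%:E = \int[mu]_x (\1_B x * g x)%:E)%E.
Proof.
rewrite integral_mkcond; apply: eq_integral => x _; rewrite patchE indicE.
by case: (x \in B); rewrite ?mul1r // mul0r.
Qed.

Lemma Rintegral_norm_le d (T : measurableType d) (R : realType) (G : probability T R)
    (g : T -> R) (K : R) : mfun g -> (forall x, `|g x| <= K) ->
  `|\int[G]_x g x| <= K.
Proof.
move=> mg gK; have ig : L1 G g by exact: integrable_bounded gK.
apply: (le_trans (le_normr_Rintegral measurableT ig)).
have GT : fine (G setT) = 1 by rewrite probability_setT.
have <- : \int[G]_x (cst K x) = K by rewrite Rintegral_cst // GT mulr1.
apply: le_Rintegral => //; first exact: integrable_norm ig.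
exact: finite_measure_integrable_cst.
Qed.

(** The strict sublevel set is the countable union of those of the linear majorants. The values of
    [theta] off the quadrant do not enter. *)
Lemma measurable_theta d (T : measurableType d) (R : realType) (theta : R -> R -> R)
    (f g : T -> R) : interpolation_function theta ->
  mfun f -> mfun g ->
  (forall x, 0 <= f x) -> (forall x, 0 <= g x) ->
  mfun (fun x => theta (f x) (g x)).
Proof.
move=> theta_interp mf mg f0 g0.
have [A [B [AB ABt]]] := countable_linear_majorants theta_interp.
apply: (measurability _ (RGenInftyO.measurableE R)) => _ [_ [r ->] <-]; rewrite setTI.
rewrite (_ : _ @^-1` _ = \bigcup_k ((fun x => A k * f x + B k * g x) @^-1` `]-oo, r[)).
  apply: bigcupT_measurable => k; rewrite -[X in measurable X]setTI.
  have m : mfun (fun x => A k * f x + B k * g x).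
    by apply: measurable_funD; apply: measurable_funM.
  by apply: m.
apply/seteqP; split=> x /=; rewrite in_itv /=.
  move=> tr; have e0 : 0 < (r - theta (f x) (g x)) / 2 by rewrite divr_gt0 // subr_gt0.
  have [k Hk] := ABt _ _ _ (f0 x) (g0 x) e0.
  by exists k => //=; rewrite in_itv /=; lra.
by move=> [k _ /=]; rewrite in_itv /=; apply: le_lt_trans; exact: AB.
Qed.

(** * Superposition of curves *)

Section superposition.
Context {R : realType} {d n : nat} {dY : measure_display} {Y : measurableType dY}.
Variable theta : R -> R -> R.
Hypothesis theta_interp : interpolation_function theta.
Variable G : probability Y R.
Variables X0 W : Y -> 'rV[R]_d.
Hypotheses (mX0 : mfun X0) (mW : mfun W).
Variable P : 'I_n.+1 -> Y * R -> R.
Hypotheses (mP : forall i, mfun (P i))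
  (P0 : forall i z, 0 <= P i z) (P1 : forall z, \sum_i P i z = 1).
Local Notation E := ('rV[R]_d * R)%type.

Definition position (t : R) (y : Y) : 'rV[R]_d := X0 y + t *: W y.
Definition space_time (z : Y * R) : E := (position z.2 z.1, z.2).

Local Notation H := (prodfin G (@leb_unit R)).

Lemma measurable_space_time : mfun space_time.
Proof.
apply: measurable_fun_pair => //; apply: measurable_fun_mx => i j.
rewrite (_ : (fun _ => _) = fun z : Y * R => X0 z.1 i j + z.2 * W z.1 i j); last first.
  by apply/funext => z; rewrite !mxE.
apply: measurable_funD.
  apply: (measurableT_comp (measurable_mx_entry i j)).
  exact: (measurableT_comp mX0).
apply: measurable_funM => //.
apply: (measurableT_comp (measurable_mx_entry i j)).
exact: (measurableT_comp mW).
Qed.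

Lemma measurable_position t : mfun (position t).
Proof.
exact: (measurableT_comp (measurable_fst (T1 := 'rV[R]_d) (T2 := R))
  (measurableT_comp measurable_space_time (pair2_measurable t))).
Qed.

Lemma weight_le1 i z : P i z <= 1.
Proof. by rewrite -(P1 z) (bigD1 i) //= lerDl sumr_ge0. Qed.

Lemma weight_norm i z : `|P i z| <= 1.
Proof. by rewrite ger0_norm // weight_le1. Qed.

Let mPt i t : mfun (fun y => P i (y, t)).
Proof. exact: (measurableT_comp (mP i) (pair2_measurable t)). Qed.

Lemma weight_integrable i : L1 H (P i).
Proof. by apply: (@integrable_bounded _ _ _ _ _ 1) => // z; exact: weight_norm. Qed.

Lemma weight_slice_integrable i t : L1 G (fun y => P i (y, t)).
Proof. by apply: (@integrable_bounded _ _ _ _ _ 1) => // z; exact: weight_norm. Qed.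

Definition rho (t : R) (i : 'I_n.+1) : {finite_measure set 'rV[R]_d -> \bar R} :=
  wimage (weight_slice_integrable i t) (fun y => P0 i (y, t)) (measurable_position t).

Lemma ge0_integral_rho t i (F : 'rV[R]_d -> \bar R) : mfun F ->
  (forall x, 0 <= F x)%E ->
  (\int[rho t i]_x F x = \int[G]_y (F (position t y) * (P i (y, t))%:E))%E.
Proof. by move=> mF F0; exact: ge0_integral_wimage. Qed.

Lemma Rintegral_rho t i (F : 'rV[R]_d -> R) : mfun F ->
  \int[rho t i]_x F x = \int[G]_y (F (position t y) * P i (y, t)).
Proof. by move=> mF; exact: Rintegral_wimage. Qed.

Let mpre t A : measurable A -> measurable (position t @^-1` A).
Proof. by move=> mA; rewrite -[X in measurable X]setTI; exact: measurable_position. Qed.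

(** The weights sum to one, so the total measure is the law of the position. *)
Lemma rho_total t A : measurable A -> ord_msum (rho t) A = G (position t @^-1` A).
Proof.
move=> mA; rewrite /ord_msum /= /wimage -ge0_integral_sum //.
- transitivity (\int[G]_(y in position t @^-1` A) (cst 1%E y))%E.
    by apply: eq_integral => y _; rewrite sumEFin P1.
  by rewrite integral_cst ?mul1e //; exact: mpre.
- exact: mpre.
- by move=> i; apply/measurable_EFinP; exact: measurable_funTS.
- by move=> i y _; rewrite lee_fin.
Qed.

Let one_int : L1 G (cst (1 : R)).
Proof. exact: finite_measure_integrable_cst. Qed.

Let one0 (y : Y) : 0 <= cst (1 : R) y. Proof. exact: ler01. Qed.

(** The total measure written as a weighted image, to inherit the integral formulas of [wimage]. *)
Let rhobar t : {finite_measure set 'rV[R]_d -> \bar R} :=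
  wimage one_int one0 (measurable_position t).

Let rhobarE t A : measurable A -> ord_msum (rho t) A = rhobar t A.
Proof.
move=> mA; rewrite rho_total // /rhobar /= /wimage.
by rewrite (integral_cst _ _ 1%:E) ?mul1e //; exact: mpre.
Qed.

Lemma ge0_integral_rho_total t (F : 'rV[R]_d -> \bar R) : mfun F ->
  (forall x, 0 <= F x)%E ->
  (\int[ord_msum (rho t)]_x F x = \int[G]_y F (position t y))%E.
Proof.
move=> mF F0; rewrite (eq_measure_integral (rhobar t)); last first.
  by move=> A mA _; exact: rhobarE.
rewrite ge0_integral_wimage //; apply: eq_integral => y _.
by rewrite /= mule1.
Qed.

Lemma Rintegral_rho_total t (F : 'rV[R]_d -> R) : mfun F ->
  \int[ord_msum (rho t)]_x F x = \int[G]_y F (position t y).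
Proof.
move=> mF; rewrite /Rintegral (eq_measure_integral (rhobar t)); last first.
  by move=> A mA _; exact: rhobarE.
rewrite -/(Rintegral _ _ _) Rintegral_wimage //; apply: eq_Rintegral => y _.
by rewrite /= mulr1.
Qed.

Section slices.
Variable f : 'I_n.+1 -> E -> R.
Hypotheses (fP : forall i, is_condexp H space_time (P i) (f i))
  (f01 : forall i x, 0 <= f i x <= 1).

Let mf i : mfun (f i). Proof. by have [] := fP i. Qed.

Let f_ge0 i x : 0 <= f i x. Proof. by have /andP[] := f01 i x. Qed.

Let f_norm i x : `|f i x| <= 1.
Proof. by have /andP[f0 f1] := f01 i x; rewrite ger0_norm. Qed.

Let m_slice (g : E -> R) t : mfun g ->
  mfun (fun x : 'rV[R]_d => g (x, t)).
Proof. by move=> mg; exact: (measurableT_comp mg (pair2_measurable t)). Qed.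

(** Passage from space-time to time slices. For each species and each lower ray, the claimed
    identity holds after integration over any set of times, hence at almost every time. There are
    countably many pairs of a species and a ray, so one null set of times suffices, and the rays
    determine the measures. *)
Lemma rho_slice : exists Nul : set R, [/\ measurable Nul, leb_unit Nul = 0%E &
  forall t i A, ~ Nul t -> measurable A ->
    rho t i A = (\int[ord_msum (rho t)]_(x in A) (f i (x, t))%:E)%E].
Proof.
(* The defect of the claimed density on a lower ray at time [t]. *)
pose D i (a : 'rV[rat]_d) (t : R) : R :=
  \int[G]_y (\1_(lower_ray a) (position t y) * (f i (space_time (y, t)) - P i (y, t))).
have mray a : mfun (\1_(lower_ray a) : 'rV[R]_d -> R).
  by apply: measurable_indic; exact: measurable_lower_ray.
have ray_norm a (x : 'rV[R]_d) : `|\1_(lower_ray a) x : R| <= 1.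
  by rewrite indicE; case: (_ \in _); rewrite ?normr1 ?normr0.
pose g i a (z : Y * R) : R :=
  \1_(lower_ray a) (position z.2 z.1) * (f i (space_time z) - P i z).
have mpos : mfun (fun z : Y * R => position z.2 z.1).
  exact: (measurableT_comp (measurable_fst (T1 := 'rV[R]_d) (T2 := R)) measurable_space_time).
have mg i a : mfun (g i a).
  apply: measurable_funM; first exact: (measurableT_comp (mray a) mpos).
  by apply: measurable_funB => //; apply: (measurableT_comp (mf i)); exact: measurable_space_time.
have g_norm i a z : `|g i a z| <= 2.
  have fP2 : `|f i (space_time z) - P i z| <= 2.
    rewrite (le_trans (ler_normB _ _)) //; have := f_norm i (space_time z).
    by have := weight_norm i z; lra.
  by rewrite /g indicE; case: (_ \in _); rewrite ?mul1r // mul0r normr0.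
have ig i a : L1 H (g i a).
  by apply: (@integrable_bounded _ _ _ _ _ 2).
have mD i a : mfun (D i a).
  exact: (Rintegral_slice_measurable (ig i a)).
have D_norm i a t : `|D i a t| <= 2.
  apply: Rintegral_norm_le => [|y]; last exact: (g_norm i a (y, t)).
  exact: (measurableT_comp (mg i a) (pair2_measurable t)).
have D0 i a : {ae leb_unit, forall t, D i a t = 0}.
  have iD (B : set R) : measurable B -> L1 leb_unit (\1_B \* D i a).
    move=> mB; apply: (@integrable_bounded _ _ _ _ _ 2).
      by apply: measurable_funM => //; exact: measurable_indic.
    by move=> t; rewrite /= indicE; case: (_ \in _); rewrite ?mul1r // mul0r normr0.
  have : ae_eq leb_unit setT (EFin \o D i a) (cst 0%E).
    apply: integral_ae_eq => //.
      by apply: (@integrable_bounded _ _ _ _ _ 2).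
    move=> B _ mB; rewrite integral_cst // mul0e.
    rewrite integral_set_indic -(fineK (integrable_fin_num measurableT (iD _ mB))).
    congr EFin; rewrite -/(Rintegral _ _ _).
    (* The property of [f i] on space-time is tested on the product of a ray and a set [B] of times;
       varying [B] localizes it in time. *)
    pose F (x : E) : R := \1_B x.2 * \1_(lower_ray a) x.1.
    have mF : mfun F.
      apply: measurable_funM.
        have mI : mfun (\1_B : R -> R) by exact: measurable_indic.
        exact: (measurableT_comp mI).
      exact: (measurableT_comp (mray a)).
    have bF : exists K : R, forall x, `|F x| <= K.
      exists 1 => x; rewrite /F !indicE.
      by case: (_ \in _); case: (_ \in _); rewrite ?mul1r ?mul0r ?normr1 ?normr0.
    have [_ if_ /(_ F mF bF) FE] := fP i.
    have mFX : mfun (F \o space_time).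
      by apply: measurableT_comp => //; exact: measurable_space_time.
    have bFX : exists K : R, forall z, `|(F \o space_time) z| <= K.
      by have [K FK] := bF; exists K => z; exact: FK.
    have i1 := integrable_bounded_mul mFX bFX if_.
    have i2 := integrable_bounded_mul mFX bFX (weight_integrable i).
    transitivity (\int[H]_z (F (space_time z) * f i (space_time z)) -
                  \int[H]_z (F (space_time z) * P i z)); last by rewrite FE subrr.
    rewrite -RintegralB // Rintegral_prodfin21.
      apply: eq_Rintegral => t _; rewrite -RintegralZl //.
        by apply: eq_Rintegral => y _; rewrite /F /= -mulrBr -mulrA.
      apply: (@integrable_bounded _ _ _ _ _ 2) => [|y]; last exact: (g_norm i a (y, t)).
      exact: (measurableT_comp (mg i a) (pair2_measurable t)).
    exact: (L1B i1 i2).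
  by apply: filterS => t /(_ I) [].
have [Nul [mNul Nul0 NulP]] : {ae leb_unit, forall t : R, forall p : 'I_n.+1 * 'rV[rat]_d, D p.1 p.2 t = 0}.
  by apply: ae_countable => p; exact: D0.
exists Nul; split=> // t i A nNt mA.
have ift : L1 (ord_msum (rho t)) (fun x => f i (x, t)).
  by apply: (@integrable_bounded _ _ _ _ _ 1) => //; exact: m_slice.
have f0t x : 0 <= f i (x, t) by [].
pose nu : {finite_measure set 'rV[R]_d -> \bar R} := wimage ift f0t (@measurable_id _ _ setT).
apply: (@rV_measure_unique _ _ (rho t i) nu) => //.
  by rewrite ltey_eq fin_num_measure.
move=> a; have ray := @measurable_lower_ray R d a.
have Dt0 : D i a t = 0.
  by apply: contrapT => ne; apply: nNt; apply: NulP => /(_ (i, a)).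
have ind_int (k : Y -> R) : mfun k -> (forall y, `|k y| <= 1) ->
    L1 G (fun y => \1_(lower_ray a) (position t y) * k y).
  move=> mk k1; apply: (@integrable_bounded _ _ _ _ _ 1) => [|y].
    by apply: measurable_funM => //; apply: measurableT_comp (mray a) (measurable_position t).
  by rewrite indicE; case: (_ \in _); rewrite ?mul1r // mul0r normr0.
have mft : mfun (fun y => f i (position t y, t)).
  exact: measurableT_comp (m_slice t (mf i)) (measurable_position t).
have iP := ind_int _ (mPt i t) (fun y => weight_norm i (y, t)).
have i_f := ind_int _ mft (fun y => f_norm i (position t y, t)).
transitivity (\int[G]_y (\1_(lower_ray a) (position t y) * P i (y, t))%:E)%E.
  by rewrite /= /wimage integral_set_indic.
transitivity (\int[G]_y (\1_(lower_ray a) (position t y) * f i (position t y, t))%:E)%E.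
  rewrite -(fineK (integrable_fin_num measurableT iP)) -(fineK (integrable_fin_num measurableT i_f)).
  congr EFin; apply/esym/eqP; rewrite -subr_eq0 -!/(Rintegral _ _ _) -RintegralB //.
  by rewrite -[X in _ == X]Dt0 /D; apply/eqP; apply: eq_Rintegral => y _; rewrite /= mulrBr.
rewrite [RHS](_ : _ = (\int[ord_msum (rho t)]_(x in lower_ray a) (f i (x, t))%:E)%E) //.
rewrite [RHS]integral_set_indic ge0_integral_rho_total //.
- by apply/measurable_EFinP; apply: measurable_funM => //; exact: m_slice.
- by move=> x; rewrite lee_fin mulr_ge0.
Qed.

End slices.
End superposition.

(** The power with exponent -1 is measurable and agrees with the inverse on nonnegative reals, zero
    included. *)
Lemma measurable_ge0_inv d (T : measurableType d) (R : realType) (f : T -> R) :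
  mfun f -> (forall x, 0 <= f x) -> mfun (fun x => (f x)^-1).
Proof.
move=> mf f0; rewrite (_ : (fun _ => _) = (fun r => powR r (-1)) \o f).
  by apply: measurableT_comp => //; exact: measurable_powR.
by apply/funext => x; rewrite /= powR_inv1.
Qed.

(** * Densities and mobilities of the superposed measures *)

Section density.
Context {R : realType} {d n : nat} {dY : measure_display} {Y : measurableType dY}.
Variable theta : R -> R -> R.
Hypothesis theta_interp : interpolation_function theta.
Variable G : probability Y R.
Variables X0 W : Y -> 'rV[R]_d.
Hypotheses (mX0 : mfun X0) (mW : mfun W).
Variable P : 'I_n.+1 -> Y * R -> R.
Hypotheses (mP : forall i, mfun (P i))
  (P0 : forall i z, 0 <= P i z) (P1 : forall z, \sum_i P i z = 1).
Local Notation E := ('rV[R]_d * R)%type.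
Local Notation st := (space_time X0 W).
Local Notation rho := (rho G mX0 mW mP P0 P1).

Variable f : 'I_n.+1 -> E -> R.
Hypotheses (mf : forall i, mfun (f i)) (f01 : forall i x, 0 <= f i x <= 1).
Variable Nul : set R.
Hypothesis NulP : forall t i A, ~ Nul t -> measurable A ->
  rho t i A = (\int[ord_msum (rho t)]_(x in A) (f i (x, t))%:E)%E.

Let f_ge0 i x : 0 <= f i x. Proof. by have /andP[] := f01 i x. Qed.

Let mft i t : mfun (fun x : 'rV[R]_d => f i (x, t)).
Proof. exact: (measurableT_comp (mf i) (pair2_measurable t)). Qed.

Let dom t i : rho t i `<< ord_msum (rho t).
Proof.
apply/null_content_dominatesP => A mA A0.
have : (rho t i A <= \sum_(j < n.+1) rho t j A)%E by rewrite (bigD1 i) //= leeDl // sume_ge0.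
by rewrite [leRHS]A0 measure_le0 => /eqP.
Qed.

(** Both functions integrate to [rho t i] over every measurable set, so they agree almost
    everywhere. *)
Lemma density_slice t i : ~ Nul t ->
  {ae ord_msum (rho t), forall x, density (rho t) i x = f i (x, t)}.
Proof.
move=> nt.
have : ae_eq (ord_msum (rho t)) setT
    (Radon_Nikodym_SigmaFinite.f (rho t i) (ord_msum (rho t))) (fun x => (f i (x, t))%:E).
  apply: integral_ae_eq => //.
  - exact: Radon_Nikodym_SigmaFinite.f_integrable (@dom t i).
  - exact/measurable_EFinP.
  - move=> A _ mA; rewrite -NulP //.
    by rewrite -(Radon_Nikodym_SigmaFinite.f_integral (@dom t i)).
by apply: filterS => x /(_ I); rewrite /density => ->.
Qed.

Lemma measurable_density t i : mfun (density (rho t) i).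
Proof.
apply: measurableT_comp => //.
exact: measurable_int (Radon_Nikodym_SigmaFinite.f_integrable (@dom t i)).
Qed.

Lemma density_ge0 t i x : 0 <= density (rho t) i x.
Proof. by rewrite fine_ge0 // (Radon_Nikodym_SigmaFinite.f_ge0 (@dom t i)). Qed.

Lemma measurable_mobility t i j : mfun (mobility theta (rho t) i j).
Proof.
apply: (measurable_theta theta_interp); try exact: measurable_density.
- by move=> x; exact: density_ge0.
- by move=> x; exact: density_ge0.
Qed.

Lemma mobility_slice t i j : ~ Nul t ->
  {ae ord_msum (rho t), forall x,
    mobility theta (rho t) i j x = theta (f i (x, t)) (f j (x, t))}.
Proof.
move=> nt; apply: filterS2 (density_slice i nt) (density_slice j nt) => x.
by rewrite /mobility => -> ->.
Qed.

End density.

(** * Conditional graph fluxes and the velocities they induce *)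

Section conditional_velocities.
Context {R : realType} {d n : nat} {dY : measure_display} {Y : measurableType dY}.
Variable theta : R -> R -> R.
Hypothesis theta_interp : interpolation_function theta.
Variable G : probability Y R.
Variables X0 W : Y -> 'rV[R]_d.
Hypotheses (mX0 : mfun X0) (mW : mfun W).
Variable P : 'I_n.+1 -> Y * R -> R.
Hypotheses (mP : forall i, mfun (P i))
  (P0 : forall i z, 0 <= P i z) (P1 : forall z, \sum_i P i z = 1).
Variables M C : 'I_n.+1 -> 'I_n.+1 -> Y * R -> R.
Local Notation E := ('rV[R]_d * R)%type.
Local Notation st := (space_time X0 W).
Local Notation H := (prodfin G (@leb_unit R)).
Hypotheses (iM : forall i j, L1 H (M i j))
  (iC : forall i j, L1 H (C i j)).
(* The dual form of [M^2 <= C theta(P_i, P_j)]. *)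
Hypothesis MC : forall i j a b al z, linear_majorant theta a b ->
  2 * al * M i j z - al ^+ 2 * (a * P i z + b * P j z) <= C i j z.

Variables (f : 'I_n.+1 -> E -> R) (N c : 'I_n.+1 -> 'I_n.+1 -> E -> R).
Hypotheses (fP : forall i, is_condexp H st (P i) (f i)) (f01 : forall i x, 0 <= f i x <= 1)
  (NP : forall i j, is_condexp H st (M i j) (N i j))
  (cP : forall i j, is_condexp H st (C i j) (c i j)).

Let mst : mfun st. Proof. exact: measurable_space_time. Qed.
Let f_ge0 i x : 0 <= f i x. Proof. by have /andP[] := f01 i x. Qed.
Let mf i : mfun (f i). Proof. by have [] := fP i. Qed.
Let mN i j : mfun (N i j). Proof. by have [] := NP i j. Qed.
Let mc i j : mfun (c i j). Proof. by have [] := cP i j. Qed.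
Let iP i : L1 H (P i).
Proof. exact: weight_integrable. Qed.

(** A jointly measurable substitute for [mobility]; [mobility_slice] identifies the two at times
    outside the exceptional set. *)
Definition mean_mobility i j (x : E) : R := theta (f i x) (f j x).

Lemma mean_mobility_ge0 i j x : 0 <= mean_mobility i j x.
Proof. exact: (theta_ge0 theta_interp). Qed.

Lemma measurable_mean_mobility i j : mfun (mean_mobility i j).
Proof. exact: (measurable_theta theta_interp). Qed.

(** Jensen's inequality for M^2 / theta. The dual inequality is averaged for each rational [al] and
    each of the countably many majorants; approximating [theta] by the majorants and taking the
    discriminant in [al] gives the quadratic bound. *)
Lemma condexp_flux_bound : {ae H, forall z, forall p : 'I_n.+1 * 'I_n.+1,
  N p.1 p.2 (st z) ^+ 2 <= c p.1 p.2 (st z) * mean_mobility p.1 p.2 (st z) /\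
  0 <= c p.1 p.2 (st z)}.
Proof.
have [A [B [AB ABt]]] := countable_linear_majorants theta_interp.
apply: ae_countable => -[i j] /=.
have : {ae H, forall z, forall q : rat * nat, 0 <= c i j (st z) + - (2 * ratr q.1) * N i j (st z)
    + ratr q.1 ^+ 2 * A q.2 * f i (st z) + ratr q.1 ^+ 2 * B q.2 * f j (st z)}.
  apply: ae_countable => -[al k] /=.
  apply: (condexp_linear3 mst (iC i j) (iM i j) (iP i) (iP j)) => // z.
  by have := MC i j (ratr al) z (AB k); lra.
apply: filterS => z Hz; split; last first.
  have := Hz (0, 0%N); rewrite /= rmorph0 expr0n /= !mul0r mulr0 oppr0 mul0r !addr0.
  by [].
apply: (@discriminant_rat _ _ _ _ (fun k => A k * f i (st z) + B k * f j (st z))).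
- exact: mean_mobility_ge0.
- by move=> al k; have := Hz (al, k); rewrite /= mulrDr !mulrA addrA.
- by move=> e e0; exact: ABt.
Qed.

Variable Nul : set R.
Hypotheses (mNul : measurable Nul) (Nul0 : leb_unit Nul = 0%E).

Lemma ae_not_null_time : {ae H, forall z, ~ Nul z.2}.
Proof.
exists (setT `*` Nul); split=> [||[y t] /= /contrapT //].
- exact: measurableX.
- by rewrite /prodfin product_measure1E // [X in (_ * X)%E]Nul0 mule0.
Qed.

(* [density (rho t)] is chosen separately for each [t]; it agrees with the
   jointly measurable [f] outside of the null set [Nul] of times. *)
Definition mean_velocity i j (x : E) : R :=
  \1_(~` Nul) x.2 * (N i j x / mean_mobility i j x).

Lemma measurable_mean_velocity i j : mfun (mean_velocity i j).
Proof.
apply: measurable_funM.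
  have mI : mfun (\1_(~` Nul) : R -> R).
    by apply: measurable_indic; exact: measurableC.
  exact: (measurableT_comp mI).
apply: measurable_funM => //; apply: measurable_ge0_inv.
- exact: measurable_mean_mobility.
- exact: mean_mobility_ge0.
Qed.

(** Where the mobility vanishes, the bound N^2 <= c theta forces the flux to vanish too, so the
    convention that the inverse of 0 is 0 loses no flux. *)
Lemma mean_velocity_flux : {ae H, forall z, forall p : 'I_n.+1 * 'I_n.+1,
  mean_mobility p.1 p.2 (st z) * mean_velocity p.1 p.2 (st z) = N p.1 p.2 (st z) /\
  mean_velocity p.1 p.2 (st z) ^+ 2 * mean_mobility p.1 p.2 (st z) <= c p.1 p.2 (st z)}.
Proof.
apply: filterS2 condexp_flux_bound ae_not_null_time => z Hz nz p.
have [N2 c0] := Hz p; rewrite /mean_velocity /= indicE mem_set // mul1r.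
have := mean_mobility_ge0 p.1 p.2 (st z).
rewrite le_eqVlt => /predU1P[th0|th0].
  move: N2; rewrite -th0 invr0 !mulr0 => N2; split=> //.
  by apply/esym/eqP; rewrite -sqrf_eq0 eq_le N2 sqr_ge0.
split; first by rewrite mulrCA divff ?mulr1 // gt_eqF.
have th1 := gt_eqF th0; rewrite [leLHS](_ : _ = N p.1 p.2 (st z) ^+ 2 / mean_mobility p.1 p.2 (st z)).
  by rewrite ler_pdivrMr.
by field; rewrite th1.
Qed.

Lemma potential_le i j :
  (\int[H]_z (mean_velocity i j (st z) ^+ 2 * mean_mobility i j (st z))%:E <=
   \int[H]_z (C i j z)%:E)%E.
Proof.
have [_ ic ci] := cP i j; have cE := is_condexp_int (cP i j).
have -> : (\int[H]_z (C i j z)%:E = \int[H]_z (c i j (st z))%:E)%E.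
  rewrite -(fineK (integrable_fin_num measurableT (iC i j))).
  by rewrite -(fineK (integrable_fin_num measurableT ic)) -!/(Rintegral _ _ _) cE.
have mE : mfun (fun z => mean_velocity i j (st z) ^+ 2 * mean_mobility i j (st z)).
  apply: (measurableT_comp (_ : mfun
    (fun x => mean_velocity i j x ^+ 2 * mean_mobility i j x)) mst).
  apply: measurable_funM; last exact: measurable_mean_mobility.
  by apply: measurable_funX; exact: measurable_mean_velocity.
have E0 z : 0 <= mean_velocity i j (st z) ^+ 2 * mean_mobility i j (st z).
  by rewrite mulr_ge0 ?sqr_ge0 // mean_mobility_ge0.
(* [c] is known to be nonnegative only almost everywhere, hence its positive part. *)
apply: (@le_trans _ _ (\int[H]_z (Num.max 0 (c i j (st z)))%:E)%E).
  apply: ae_ge0_le_integral => //.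
  - by move=> z _; rewrite lee_fin.
  - exact/measurable_EFinP.
  - by move=> z _; rewrite lee_fin le_max lexx.
  - apply/measurable_EFinP; apply: measurable_maxr => //; exact: measurableT_comp.
  - apply: filterS mean_velocity_flux => z Hz _; have [_ +] := Hz (i, j).
    by rewrite lee_fin le_max => ->; rewrite orbT.
apply: le_of_eq; apply: ae_eq_integral => //.
- apply/measurable_EFinP; apply: measurable_maxr => //; exact: measurableT_comp.
- by apply/measurable_EFinP; exact: measurableT_comp.
- apply: filterS condexp_flux_bound => z Hz _; have [_ c0] := Hz (i, j).
  by congr EFin; exact/max_idPr.
Qed.

End conditional_velocities.

Section conditional_second_moment.
Context {d d'} {S : measurableType d} {E : measurableType d'} {R : realType}.
Variables (H : {finite_measure set S -> \bar R}) (X : S -> E).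
Hypothesis (mX : mfun X).

Lemma condexp_sqr (h : S -> R) (f : E -> R) : mfun h ->
  H.-integrable setT (fun s => (h s ^+ 2)%:E) -> is_condexp H X h f ->
  (\int[H]_s (f (X s) ^+ 2)%:E <= \int[H]_s (h s ^+ 2)%:E)%E.
Proof.
move=> mh ih2 fP; have [mf iff _] := fP.
have i1 : L1 H (cst (1 : R)) by exact: finite_measure_integrable_cst.
have i0 : L1 H (cst (0 : R)) by exact: finite_measure_integrable_cst.
have ih : L1 H h by exact: L1_sqr.
have [g gP] : exists g, is_condexp H X (fun s => h s ^+ 2) g by exact: condexp.
have [mg ig _] := gP.
have cst_condexp (r : R) : is_condexp H X (cst r) (cst r).
  by split=> //; exact: finite_measure_integrable_cst.
have ae_le : {ae H, forall s, f (X s) ^+ 2 <= g (X s)}.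
  have : {ae H, forall s, forall al : rat, 0 <= g (X s) + - (2 * ratr al) * f (X s)
      + ratr al ^+ 2 * cst 1 (X s) + 0 * cst 0 (X s)}.
    apply: ae_countable => al.
    apply: (condexp_linear3 mX ih2 ih i1 i0) => // s.
    by have := sqr_ge0 (ratr al - h s); rewrite sqrrB /=; lra.
  apply: filterS => s Hs; rewrite -[leRHS]mulr1.
  apply: (@discriminant_rat _ _ _ _ (fun=> 1)) => // [al k|e e0].
    by have := Hs al; rewrite /= mul0r addr0.
  by exists 0%N; rewrite lerDl ltW.
have -> : (\int[H]_s (h s ^+ 2)%:E = \int[H]_s (g (X s))%:E)%E.
  rewrite -(fineK (integrable_fin_num measurableT ih2)).
  rewrite -(fineK (integrable_fin_num measurableT ig)) -!/(Rintegral _ _ _).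
  by rewrite (is_condexp_int gP).
have mgX : mfun (g \o X) by exact: measurableT_comp.
have g0 : {ae H, forall s, 0 <= g (X s)}.
  by apply: filterS ae_le => s; apply: le_trans; exact: sqr_ge0.
apply: (@le_trans _ _ (\int[H]_s (Num.max 0 (g (X s)))%:E)%E).
  apply: ae_ge0_le_integral => //.
  - by move=> s _; rewrite lee_fin sqr_ge0.
  - apply/measurable_EFinP; apply: measurable_funX; exact: measurableT_comp.
  - by move=> s _; rewrite lee_fin le_max lexx.
  - by apply/measurable_EFinP; apply: measurable_maxr.
  - by apply: filterS ae_le => s fg _; rewrite lee_fin le_max fg orbT.
apply: le_of_eq; apply: ae_eq_integral => //.
- by apply/measurable_EFinP; apply: measurable_maxr.
- exact/measurable_EFinP.
- by apply: filterS g0 => s gs _; congr EFin; exact/max_idPr.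
Qed.

End conditional_second_moment.

Lemma enorm_sqr (R : realType) d (x : 'rV[R]_d) : enorm x ^+ 2 = \sum_k x 0 k ^+ 2.
Proof.
rewrite /enorm sqr_sqrtr /edot; last by apply: sumr_ge0 => k _; rewrite -expr2 sqr_ge0.
by apply: eq_bigr => k _; rewrite expr2.
Qed.

(** * The action of the superposition *)

Section energy.
Context {R : realType} {d n : nat} {dY : measure_display} {Y : measurableType dY}.
Variables (Omega : set 'rV[R]_d) (q : 'I_n.+1 -> 'I_n.+1 -> R) (theta : R -> R -> R).
Hypothesis mOmega : measurable Omega.
Hypothesis q0 : forall i j, 0 <= q i j.
Hypothesis theta_interp : interpolation_function theta.
Variable G : probability Y R.
Variables X0 W : Y -> 'rV[R]_d.
Hypotheses (mX0 : mfun X0) (mW : mfun W).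
Variable P : 'I_n.+1 -> Y * R -> R.
Hypotheses (mP : forall i, mfun (P i))
  (P0 : forall i z, 0 <= P i z) (P1 : forall z, \sum_i P i z = 1).
Local Notation E := ('rV[R]_d * R)%type.
Local Notation st := (space_time X0 W).
Local Notation H := (prodfin G (@leb_unit R)).
Local Notation leb := (@lebesgue_measure R).
Local Notation rho := (rho G mX0 mW mP P0 P1).

Variables (f : 'I_n.+1 -> E -> R) (vel : 'I_n.+1 -> 'I_n.+1 -> E -> R).
Hypotheses (mf : forall i, mfun (f i)) (f01 : forall i x, 0 <= f i x <= 1).
Hypothesis mvel : forall i j, mfun (vel i j).
Variable Nul : set R.
Hypothesis NulP : forall t i A, ~ Nul t -> measurable A ->
  rho t i A = (\int[ord_msum (rho t)]_(x in A) (f i (x, t))%:E)%E.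
Hypothesis vel_Nul : forall i j x t, Nul t -> vel i j (x, t) = 0.

Local Notation th := (mean_mobility theta f).

(** Species [i] on the space of pairs and times. The velocity of species [i] is the conditional
    expectation of the displacement under this measure. *)
Definition species_measure i : {finite_measure set (Y * R)%type -> \bar R} :=
  wimage (weight_integrable G mP P0 P1 i) (P0 i) (@measurable_id _ _ setT).

Variable uu : 'I_n.+1 -> 'I_d -> E -> R.
Hypothesis muu : forall i k, mfun (uu i k).

Definition velocity (z : E) : 'M[R]_(n.+1, d) := \matrix_(i, k) uu i k z.
Definition flux_velocity (z : E) : 'M[R]_n.+1 := \matrix_(i, j) vel i j z.

Let mst : mfun st. Proof. exact: measurable_space_time. Qed.
Let f_ge0 i x : 0 <= f i x. Proof. by have /andP[] := f01 i x. Qed.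
Let th_ge0 i j x : 0 <= th i j x. Proof. exact: (theta_ge0 theta_interp). Qed.
Let mth i j : mfun (th i j).
Proof. exact: (measurable_theta theta_interp). Qed.
Let th_sym i j x : th i j x = th j i x. Proof. exact: (theta_sym theta_interp). Qed.

Let m_slice (g : E -> R) t : mfun g ->
  mfun (fun x : 'rV[R]_d => g (x, t)).
Proof. by move=> mg; exact: (measurableT_comp mg (pair2_measurable t)). Qed.

Let mobility_ge0 t i j x : 0 <= mobility theta (rho t) i j x.
Proof. by apply: (theta_ge0 theta_interp); exact: density_ge0. Qed.

Let mmob t i j : mfun (mobility theta (rho t) i j).
Proof. exact: measurable_mobility. Qed.

(** At exceptional times the velocity is zero and both sides vanish; at the others the mobilities
    agree almost everywhere. *)
Lemma velocity_mobility t i j a b : {ae ord_msum (rho t), forall x,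
  vel a b (x, t) * mobility theta (rho t) i j x = vel a b (x, t) * th i j (x, t)}.
Proof.
have [nt|nt] := pselect (Nul t); first by apply: aeW => x; rewrite vel_Nul // !mul0r.
have := mobility_slice theta mf NulP i j nt.
by apply: filterS => x ->.
Qed.

Definition kinetic i (z : Y * R) : R := \sum_k uu i k (st z) ^+ 2 * P i z.
Definition potential i j (z : Y * R) : R := vel i j (st z) ^+ 2 * th i j (st z).

Lemma kinetic_ge0 i z : 0 <= kinetic i z.
Proof. by apply: sumr_ge0 => k _; rewrite mulr_ge0 // sqr_ge0. Qed.

Lemma potential_ge0 i j z : 0 <= potential i j z.
Proof. by rewrite mulr_ge0 ?sqr_ge0. Qed.

Lemma measurable_kinetic i : mfun (kinetic i).
Proof.
apply: measurable_sum => k; apply: measurable_funM => //; apply: measurable_funX.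
exact: measurableT_comp.
Qed.

Lemma measurable_potential i j : mfun (potential i j).
Proof.
apply: (measurableT_comp (_ : mfun (fun x => vel i j x ^+ 2 * th i j x)) mst).
by apply: measurable_funM => //; exact: measurable_funX.
Qed.

Let row_sqr i x : enorm (row i (velocity x)) ^+ 2 = \sum_k uu i k x ^+ 2.
Proof. by rewrite enorm_sqr; apply: eq_bigr => k _; rewrite !mxE. Qed.

Let m_row_sqr i t :
  mfun (fun x : 'rV[R]_d => enorm (row i (velocity (x, t))) ^+ 2).
Proof.
under eq_fun do rewrite row_sqr.
by apply: measurable_sum => k; apply: measurable_funX; exact: m_slice.
Qed.

Lemma kinetic_slice t i :
  (\int[rho t i]_(x in Omega) (enorm (row i (velocity (x, t))) ^+ 2)%:E <=
   \int[G]_y (kinetic i (y, t))%:E)%E.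
Proof.
apply: (@le_trans _ _ (\int[rho t i]_x (enorm (row i (velocity (x, t))) ^+ 2)%:E)%E).
  apply: ge0_subset_integral => //.
  - by apply/measurable_EFinP.
  - by move=> x _; rewrite lee_fin sqr_ge0.
rewrite ge0_integral_rho.
- apply: le_of_eq; apply: eq_integral => y _.
  by rewrite row_sqr -EFinM mulr_suml.
- exact/measurable_EFinP.
- by move=> x; rewrite lee_fin sqr_ge0.
Qed.

Lemma potential_slice t i j :
  (\int[ord_msum (rho t)]_(x in Omega)
     (`|flux_velocity (x, t) i j| ^+ 2 * mobility theta (rho t) i j x * q i j)%:E <=
   (q i j)%:E * \int[G]_y (potential i j (y, t))%:E)%E.
Proof.
have mv : mfun (fun x : 'rV[R]_d => `|flux_velocity (x, t) i j| ^+ 2).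
  under eq_fun do rewrite mxE.
  by apply: measurable_funX; apply: measurableT_comp => //; exact: m_slice.
apply: (@le_trans _ _ (\int[ord_msum (rho t)]_x
     (`|flux_velocity (x, t) i j| ^+ 2 * mobility theta (rho t) i j x * q i j)%:E)%E).
  apply: ge0_subset_integral => //.
  - apply/measurable_EFinP; apply: measurable_funM => //; exact: measurable_funM.
  - by move=> x _; rewrite lee_fin !mulr_ge0 // exprn_ge0.
have mp : mfun (fun x : 'rV[R]_d => vel i j (x, t) ^+ 2 * th i j (x, t)).
  apply: m_slice (_ : mfun (fun x => vel i j x ^+ 2 * th i j x)).
  by apply: measurable_funM => //; exact: measurable_funX.
rewrite (@ae_eq_integral _ _ _ _ _
   (fun x => ((q i j)%:E * (vel i j (x, t) ^+ 2 * th i j (x, t))%:E)%E)) //.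
- rewrite ge0_integralZl //.
  + rewrite ge0_integral_rho_total //; first exact/measurable_EFinP.
    by move=> x; rewrite lee_fin mulr_ge0 ?sqr_ge0.
  + exact/measurable_EFinP.
  + by move=> x _; rewrite lee_fin mulr_ge0 ?sqr_ge0.
  + by rewrite lee_fin.
- apply/measurable_EFinP; apply: measurable_funM => //; exact: measurable_funM.
- by apply/measurable_EFinP; exact: measurable_funM.
- apply: filterS (velocity_mobility t i j i j) => x E_ _.
  rewrite mxE real_normK ?num_real // -EFinM; congr EFin.
  transitivity (vel i j (x, t) * (vel i j (x, t) * mobility theta (rho t) i j x) * q i j).
    by ring.
  by rewrite E_; ring.
Qed.

Definition total_energy : \bar R :=
  (\sum_i \int[H]_z (kinetic i z)%:E +
   2^-1%:E * \sum_i \sum_j (q i j)%:E * \int[H]_z (potential i j z)%:E)%E.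

(** The action at time [t] is bounded by [Phi t], which is measurable by construction; Tonelli's
    theorem then computes the integral of [Phi]. *)
Lemma energy_le :
  (\int[leb]_(t in `[0%R, 1%R]) norm2_rho Omega q theta (rho t)
     (fun x => velocity (x, t)) (fun x => flux_velocity (x, t)) <= total_energy)%E.
Proof.
pose a i t := (\int[G]_y (kinetic i (y, t))%:E)%E.
pose b i j t := (\int[G]_y (potential i j (y, t))%:E)%E.
have a0 i t : (0 <= a i t)%E by apply: integral_ge0 => y _; rewrite lee_fin kinetic_ge0.
have b0 i j t : (0 <= b i j t)%E by apply: integral_ge0 => y _; rewrite lee_fin potential_ge0.
have ma i : mfun (a i).
  apply: (@ge0_prodfin_slice _ _ _ _ _ _ (EFin \o kinetic i)).
    by apply/measurable_EFinP; exact: measurable_kinetic.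
  by move=> z; rewrite lee_fin kinetic_ge0.
have mb i j : mfun (b i j).
  apply: (@ge0_prodfin_slice _ _ _ _ _ _ (EFin \o potential i j)).
    by apply/measurable_EFinP; exact: measurable_potential.
  by move=> z; rewrite lee_fin potential_ge0.
have b1 i j t : (0 <= (q i j)%:E * b i j t)%E by rewrite mule_ge0 // lee_fin.
have mb1 i j : mfun (fun t => (q i j)%:E * b i j t)%E.
  exact: emeasurable_funM.
have half0 : (0 <= (2^-1 : R)%:E)%E by rewrite lee_fin.
pose Phi t := (\sum_i a i t + 2^-1%:E * \sum_i \sum_j (q i j)%:E * b i j t)%E.
have mS : mfun (fun t => \sum_i \sum_j (q i j)%:E * b i j t)%E.
  by apply: emeasurable_sum => i; exact: emeasurable_sum.
have S0 t : (0 <= \sum_i \sum_j (q i j)%:E * b i j t)%E.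
  by apply: sume_ge0 => i _; exact: sume_ge0.
have Phi_ge0 t : (0 <= Phi t)%E by rewrite adde_ge0 ?mule_ge0 // sume_ge0.
have mPhi : mfun Phi.
  apply: emeasurable_funD; first exact: emeasurable_sum.
  exact: emeasurable_funM.
apply: (@le_trans _ _ (\int[leb]_(t in `[0%R, 1%R]) Phi t)%E).
  apply: ge0_le_integral_nonmeas => t _.
    apply: adde_ge0.
      by apply: sume_ge0 => i _; apply: integral_ge0 => x _; rewrite lee_fin sqr_ge0.
    apply: mule_ge0 => //; apply: sume_ge0 => i _; apply: sume_ge0 => j _.
    by apply: integral_ge0 => x _; rewrite lee_fin !mulr_ge0 // exprn_ge0.
  apply: leeD; first by apply: lee_sum => i _; exact: kinetic_slice.
  apply: lee_wpmul2l => //; apply: lee_sum => i _; apply: lee_sum => j _.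
  exact: potential_slice.
rewrite -ge0_integral_leb_unit // /total_energy ge0_integralD //; last 4 first.
- by move=> t _; exact: sume_ge0.
- exact: emeasurable_sum.
- by move=> t _; exact: mule_ge0.
- exact: emeasurable_funM.
rewrite ge0_integral_sum // ge0_integralZl // le_eqVlt; apply/orP; left; apply/eqP.
congr (_ + _)%E.
  apply: eq_bigr => i _; rewrite ge0_prodfin21 //.
    by apply/measurable_EFinP; exact: measurable_kinetic.
  by move=> z; rewrite lee_fin kinetic_ge0.
congr (_ * _)%E; rewrite ge0_integral_sum //.
- apply: eq_bigr => i _; rewrite ge0_integral_sum //.
  apply: eq_bigr => j _; rewrite ge0_integralZl // ?lee_fin //; congr (_ * _)%E.
  rewrite ge0_prodfin21 //; first by apply/measurable_EFinP; exact: measurable_potential.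
  by move=> z; rewrite lee_fin potential_ge0.
- by move=> i; exact: emeasurable_sum.
- by move=> i t _; exact: sume_ge0.
Qed.

End energy.

Lemma Rintegral_sum d (T : measurableType d) (R : realType)
    (mu : {measure set T -> \bar R}) (I : Type) (s : seq I) (g : I -> T -> R) :
  (forall i, L1 mu (g i)) -> L1 mu (fun x => \sum_(i <- s) g i x) /\
  \int[mu]_x (\sum_(i <- s) g i x) = \sum_(i <- s) \int[mu]_x g i x.
Proof.
move=> ig; elim: s => [|i s [IH1 IH2]].
  split; last by under eq_Rintegral do rewrite big_nil; rewrite big_nil Rintegral_cst // mul0r.
  apply: (eq_integrable measurableT (cst 0%E)); last exact: integrable0.
  by move=> x _ /=; rewrite big_nil.
have i1 := integrableD measurableT (ig i) IH1.
split.
  by apply: (eq_integrable measurableT _ _ _ i1) => x _; rewrite /= big_cons.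
by rewrite big_cons -IH2 -RintegralD //; apply: eq_Rintegral => x _; rewrite big_cons.
Qed.

(** [fine] sends both infinities to 0, which covers the case where [g] is not integrable. *)
Lemma RintegralN d (T : measurableType d) (R : realType)
    (mu : {measure set T -> \bar R}) (g : T -> R) :
  \int[mu]_x (- g x) = - \int[mu]_x g x.
Proof.
rewrite /Rintegral integralE [in RHS]integralE.
rewrite (_ : (fun x => (- g x)%:E) = (\- (EFin \o g))%E); last first.
  by apply/funext => x; rewrite /= EFinN.
rewrite funeposN funenegN.
have : (0 <= \int[mu]_x ((EFin \o g)^\+ x))%E by exact: integral_ge0.
have : (0 <= \int[mu]_x ((EFin \o g)^\- x))%E by exact: integral_ge0.
case: integral => [a||] //; case: integral => [b||] //= _ _; rewrite ?oppr0 //.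
by rewrite opprB.
Qed.

Lemma integrable_ae_eq d (T : measurableType d) (R : realType)
    (mu : {measure set T -> \bar R}) (g h : T -> R) : mfun h ->
  {ae mu, forall x, g x = h x} -> L1 mu g -> L1 mu h.
Proof.
move=> mh gh ig; have mg := measurable_int _ ig.
apply/integrableP; split; first exact/measurable_EFinP.
have /integrableP[_] := ig; congr (_ < _)%E; apply: ae_eq_integral => //.
- exact: measurableT_comp.
- by apply: measurableT_comp => //; exact/measurable_EFinP.
- by apply: filterS gh => x /= -> _.
Qed.

Lemma Rintegral_space_time (R : realType) dY (Y : measurableType dY) (G : probability Y R)
    (g : Y * R -> R) : L1 (prodfin G (@leb_unit R)) g ->
  \int[@lebesgue_measure R]_(t in `[0, 1]) \int[G]_y g (y, t) =
  \int[prodfin G (@leb_unit R)]_z g z.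
Proof.
move=> ig; rewrite Rintegral_prodfin21 // Rintegral_leb_unit //.
exact: Rintegral_slice_measurable ig.
Qed.

(** * The continuity equation for the superposition *)

Section continuity_equation.
Context {R : realType} {d n : nat} {dY : measure_display} {Y : measurableType dY}.
Variables (Omega : set 'rV[R]_d) (q : 'I_n.+1 -> 'I_n.+1 -> R) (theta : R -> R -> R).
Hypothesis mOmega : measurable Omega.
Hypothesis theta_interp : interpolation_function theta.
Variable G : probability Y R.
Variables X0 W : Y -> 'rV[R]_d.
Hypotheses (mX0 : mfun X0) (mW : mfun W).
Variable P : 'I_n.+1 -> Y * R -> R.
Hypotheses (mP : forall i, mfun (P i))
  (P0 : forall i z, 0 <= P i z) (P1 : forall z, \sum_i P i z = 1).
Local Notation E := ('rV[R]_d * R)%type.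
Local Notation st := (space_time X0 W).
Local Notation H := (prodfin G (@leb_unit R)).
Local Notation leb := (@lebesgue_measure R).
Local Notation rho := (rho G mX0 mW mP P0 P1).
Variable M : 'I_n.+1 -> 'I_n.+1 -> Y * R -> R.
Hypothesis iM : forall i j, L1 H (M i j).
Hypothesis posO : forall t, 0 <= t <= 1 -> {ae G, forall y, Omega (position X0 W t y)}.
Hypothesis contP : forall i y, continuous (fun t => P i (y, t)).
Hypothesis weakP : forall i y (phi : R^o -> R), test_function (`]0, 1[ : set R) phi ->
  \int[leb_unit]_t ('D_1 (phi : R^o -> R^o) t * P i (y, t)) =
  - \int[leb_unit]_t (phi t * (2^-1 * \sum_j (M i j (y, t) - M j i (y, t)) * q i j)).

Variables (f : 'I_n.+1 -> E -> R) (vel : 'I_n.+1 -> 'I_n.+1 -> E -> R).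
Hypotheses (mf : forall i, mfun (f i)) (f01 : forall i x, 0 <= f i x <= 1).
Hypothesis mvel : forall i j, mfun (vel i j).
Variable Nul : set R.
Hypothesis NulP : forall t i A, ~ Nul t -> measurable A ->
  rho t i A = (\int[ord_msum (rho t)]_(x in A) (f i (x, t))%:E)%E.
Hypothesis vel_Nul : forall i j x t, Nul t -> vel i j (x, t) = 0.

Local Notation th := (mean_mobility theta f).

Variable N : 'I_n.+1 -> 'I_n.+1 -> E -> R.
Hypothesis NP : forall i j, is_condexp H st (M i j) (N i j).
Hypothesis velN : {ae H, forall z, forall p : 'I_n.+1 * 'I_n.+1,
  th p.1 p.2 (st z) * vel p.1 p.2 (st z) = N p.1 p.2 (st z)}.

Local Notation HP i := (species_measure G mP P0 P1 i).

Hypothesis iW2 : forall k, H.-integrable setT (fun z => (W z.1 0 k ^+ 2)%:E).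
Variable uu : 'I_n.+1 -> 'I_d -> E -> R.
Hypothesis uuP : forall i k, is_condexp (HP i) st (fun z => W z.1 0 k) (uu i k).

Let mst : mfun st. Proof. exact: measurable_space_time. Qed.
Let f_ge0 i x : 0 <= f i x. Proof. by have /andP[] := f01 i x. Qed.
Let th_ge0 i j x : 0 <= th i j x. Proof. exact: (theta_ge0 theta_interp). Qed.
Let mth i j : mfun (th i j).
Proof. exact: (measurable_theta theta_interp). Qed.
Let th_sym i j x : th i j x = th j i x. Proof. exact: (theta_sym theta_interp). Qed.
Let muu i k : mfun (uu i k). Proof. by have [] := uuP i k. Qed.
Let mN i j : mfun (N i j). Proof. by have [] := NP i j. Qed.
Let iN i j : L1 H (N i j \o st). Proof. by have [] := NP i j. Qed.
Let mWk k : mfun (fun z : Y * R => W z.1 0 k).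
Proof.
exact: (measurableT_comp (measurable_mx_entry 0 k) (measurableT_comp mW measurable_fst)).
Qed.

Let m_slice (g : E -> R) t : mfun g ->
  mfun (fun x : 'rV[R]_d => g (x, t)).
Proof. by move=> mg; exact: (measurableT_comp mg (pair2_measurable t)). Qed.

Let mvelth i j : mfun (fun x : E => th i j x * vel i j x).
Proof. exact: measurable_funM. Qed.

Let ivelth i j : L1 H (fun z => th i j (st z) * vel i j (st z)).
Proof.
apply: (integrable_ae_eq _ _ (iN i j)).
  exact: (measurableT_comp (mvelth i j) mst).
by apply: filterS velN => z /(_ (i, j)) /= ->.
Qed.

Let iW k : L1 H (fun z => W z.1 0 k).
Proof. exact: (L1_sqr (mWk k) (iW2 k)). Qed.

Let iWP i (g : Y * R -> R) : mfun g -> L1 H g -> L1 H (fun z => g z * P i z).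
Proof.
move=> mg ig; rewrite (_ : (fun z => _) = P i \* g); last first.
  by apply/funext => z; rewrite /= mulrC.
apply: integrable_bounded_mul => //; exists 1 => z; exact: weight_norm.
Qed.

Lemma CE_probability t : 0 <= t <= 1 -> prob_vec Omega (rho t).
Proof.
move=> t01; have := posO t01.
have mC : measurable (position X0 W t @^-1` (~` Omega)).
  rewrite -[X in measurable X]setTI; apply: measurable_position => //.
  exact: measurableC.
have -> : {ae G, forall y, Omega (position X0 W t y)} =
   G.-negligible (position X0 W t @^-1` (~` Omega)) by [].
move=> /(measure_negligible mC) GO; split.
  move=> i; apply: null_set_integral => //; apply: measurable_funTS.
  exact: measurable_int (weight_slice_integrable G mP P0 P1 i t).
have -> : (\sum_i rho t i Omega = ord_msum (rho t) Omega)%E by [].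
rewrite rho_total // -[X in G X]setCK probability_setC //.
by rewrite preimage_setC GO sube0.
Qed.

(** Dominated convergence: for each pair the trajectory and the weight are continuous in time, and
    the integrand is bounded like [g]. *)
Lemma CE_narrow : narrowly_continuous 0 1 rho.
Proof.
move=> i g cg [K [Kr bg]]; apply: continuous_subspaceT => t.
have gK x : `|g x| <= K + 1 by apply: bg => //; rewrite ltrDl.
have mg : mfun g by exact: continuous_mx_measurable.
pose F (s : R) (y : Y) : R := g (position X0 W s y) * P i (y, s).
rewrite (_ : (fun s : R => _) = fun s : R => \int[G]_y F s y); last first.
  by apply/funext => s; rewrite Rintegral_rho.
have mF s : mfun (F s).
  apply: measurable_funM.
    exact: measurableT_comp mg (measurable_position mX0 mW s).
  exact: (measurableT_comp (mP i) (pair2_measurable s)).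
have FK s y : `|F s y| <= K + 1.
  rewrite normrM -[leRHS]mulr1 ler_pM //; exact: weight_norm.
have tI : t \in `]t - 1, t + 1[%classic by rewrite inE /= in_itv /=; apply/andP; split; lra.
apply: (@continuity_under_integral R dY Y G F setT measurableT (t - 1) (t + 1) _ _
   (cst (K + 1)) _ _ t tI).
- by move=> s _; exact: integrable_bounded (FK s).
- apply: aeW => y _ s _; apply: cvgM; last exact: contP.
  by apply: continuous_comp; [exact: continuous_line|exact: cg].
- exact: finite_measure_integrable_cst.
- by move=> s _; apply: aeW => y _; exact: FK.
Qed.

Lemma CE_velocity_measurable : measurable_fun ([set: 'rV[R]_d] `*` (`[0, 1] : set R)) (velocity uu).
Proof.
apply: measurable_funTS; apply: measurable_fun_mx => i k.
by under eq_fun do rewrite mxE; exact: muu.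
Qed.

Lemma CE_flux_velocity_measurable : measurable_fun ([set: 'rV[R]_d] `*` (`[0, 1] : set R)) (flux_velocity vel).
Proof.
apply: measurable_funTS; apply: measurable_fun_mx => i j.
by under eq_fun do rewrite mxE; exact: mvel.
Qed.

(** The norm is at most 1 plus its square, so finite mass and finite kinetic energy suffice. *)
Lemma CE_velocity_integrable i :
  (\int[H]_z (kinetic X0 W P uu i z)%:E < +oo)%E ->
  (\int[leb]_(t in `[0%R, 1%R]) \int[rho t i]_(x in Omega)
     (enorm (row i (velocity uu (x, t))))%:E < +oo)%E.
Proof.
move=> kin.
have mk := measurable_kinetic mX0 mW mP muu i.
have k0 := kinetic_ge0 X0 W P0 uu i.
pose g z := P i z + kinetic X0 W P uu i z.
have g0 z : 0 <= g z by rewrite addr_ge0.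
have mg : mfun g by exact: measurable_funD.
have ms t : mfun (fun x : 'rV[R]_d => enorm (row i (velocity uu (x, t))) ^+ 2).
  under eq_fun do rewrite enorm_sqr.
  apply: measurable_sum => k; apply: measurable_funX; under eq_fun do rewrite !mxE.
  exact: m_slice.
have mG : mfun (fun t => \int[G]_y (g (y, t))%:E)%E.
  apply: (@ge0_prodfin_slice _ _ _ _ _ _ (EFin \o g)); first exact/measurable_EFinP.
  by move=> z; rewrite lee_fin.
apply: (@le_lt_trans _ _ (\int[leb]_(t in `[0%R, 1%R]) \int[G]_y (g (y, t))%:E)%E).
  apply: ge0_le_integral_nonmeas => t _.
    by apply: integral_ge0 => x _; rewrite lee_fin sqrtr_ge0.
  apply: (@le_trans _ _ (\int[rho t i]_(x in Omega)
      (1 + enorm (row i (velocity uu (x, t))) ^+ 2)%:E)%E).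
    apply: ge0_le_integral_nonmeas => x _; first by rewrite lee_fin sqrtr_ge0.
    rewrite lee_fin; have := sqr_ge0 (enorm (row i (velocity uu (x, t))) - 1).
    have : 0 <= enorm (row i (velocity uu (x, t))) by exact: sqrtr_ge0.
    by nra.
  apply: (@le_trans _ _ (\int[rho t i]_x
      (1 + enorm (row i (velocity uu (x, t))) ^+ 2)%:E)%E).
    apply: ge0_subset_integral => //.
      by apply/measurable_EFinP; apply: measurable_funD.
    by move=> x _; rewrite lee_fin addr_ge0 // sqr_ge0.
  rewrite ge0_integral_rho.
  - apply: le_of_eq; apply: eq_integral => y _.
    rewrite -EFinM mulrDl mul1r /g /kinetic enorm_sqr mulr_suml.
    by congr (_ + _)%:E; apply: eq_bigr => k _; rewrite !mxE.
  - by apply/measurable_EFinP; apply: measurable_funD.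
  - by move=> x; rewrite lee_fin addr_ge0 // sqr_ge0.
rewrite -ge0_integral_leb_unit //; last first.
  by move=> t; apply: integral_ge0 => y _; rewrite lee_fin.
rewrite -(@ge0_prodfin21 _ _ _ _ _ G leb_unit (EFin \o g)) //; last exact/measurable_EFinP.
rewrite (eq_integral (fun z => (P i z)%:E + (kinetic X0 W P uu i z)%:E)%E) //.
rewrite ge0_integralD //; last 4 first.
- by move=> z _; rewrite lee_fin.
- exact/measurable_EFinP.
- by move=> z _; rewrite lee_fin.
- exact/measurable_EFinP.
rewrite lte_add_pinfty //.
exact: integrable_lty (weight_integrable G mP P0 P1 i).
Qed.

(** Velocity times mobility is almost everywhere the conditional flux [N], integrable as a
    conditional expectation. *)
Lemma CE_flux_integrable i j :
  (\int[leb]_(t in `[0%R, 1%R]) \int[ord_msum (rho t)]_(x in Omega)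
     (`|flux_velocity vel (x, t) i j| * mobility theta (rho t) i j x)%:E < +oo)%E.
Proof.
pose g x := `|th i j x * vel i j x|.
have mg : mfun g by exact: measurableT_comp.
have mgst : mfun (EFin \o g \o st) by apply: measurableT_comp => //; exact/measurable_EFinP.
have mG : mfun (fun t => \int[G]_y (g (st (y, t)))%:E)%E.
  apply: (@ge0_prodfin_slice _ _ _ _ _ _ (EFin \o g \o st)) => // z.
  by rewrite lee_fin normr_ge0.
have mob0 t x : 0 <= mobility theta (rho t) i j x.
  by apply: (theta_ge0 theta_interp); exact: density_ge0.
have mv t : mfun (fun x : 'rV[R]_d => `|flux_velocity vel (x, t) i j|).
  under eq_fun do rewrite mxE.
  by apply: measurableT_comp => //; exact: m_slice.
have mvm t : mfun (fun x : 'rV[R]_d =>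
     `|flux_velocity vel (x, t) i j| * mobility theta (rho t) i j x).
  by apply: measurable_funM => //; exact: measurable_mobility.
apply: (@le_lt_trans _ _ (\int[leb]_(t in `[0%R, 1%R]) \int[G]_y (g (st (y, t)))%:E)%E).
  apply: ge0_le_integral_nonmeas => t _.
    by apply: integral_ge0 => x _; rewrite lee_fin mulr_ge0.
  apply: (@le_trans _ _ (\int[ord_msum (rho t)]_x
     (`|flux_velocity vel (x, t) i j| * mobility theta (rho t) i j x)%:E)%E).
    apply: ge0_subset_integral => //; first exact/measurable_EFinP.
    by move=> x _; rewrite lee_fin mulr_ge0.
  rewrite (@ae_eq_integral _ _ _ _ _ (fun x => (g (x, t))%:E)) //.
  - rewrite ge0_integral_rho_total; first exact: lexx.
      by apply/measurable_EFinP; exact: m_slice.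
    by move=> x; rewrite lee_fin normr_ge0.
  - exact/measurable_EFinP.
  - by apply/measurable_EFinP; exact: m_slice.
  - apply: filterS (velocity_mobility theta mf NulP vel_Nul t i j i j) => x E_ _.
    by rewrite mxE -[in LHS](ger0_norm (mob0 t x)) -normrM E_ /g mulrC.
rewrite -ge0_integral_leb_unit //; last first.
  by move=> t; apply: integral_ge0 => y _; rewrite lee_fin normr_ge0.
rewrite -(@ge0_prodfin21 _ _ _ _ _ G leb_unit (EFin \o g \o st)) //; last by move=> z; rewrite lee_fin normr_ge0.
have /integrableP[_] := ivelth i j.
by [].
Qed.

Section weak_formulation.
Variable eta : 'rV[R]_d * R^o -> R.
Hypothesis teta : test_function (setT `*` `]0, 1[ : set ('rV[R]_d * R^o)) eta.

Let meta : mfun (eta : E -> R).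
Proof. by apply: continuous_mx_prod_measurable; exact: test_function_continuous teta. Qed.

Let deriv_bounded (v : 'rV[R]_d * R^o) :
  mfun ((fun x => 'D_v (eta : _ -> R^o) x) : E -> R) /\
  exists K : R, forall x, `|'D_v (eta : _ -> R^o) x| <= K.
Proof.
split; last exact: test_function_derive_bounded teta.
by apply: continuous_mx_prod_measurable; exact: test_function_derive_continuous teta.
Qed.

Let mdt : mfun (diff_t eta : E -> R). Proof. exact: (deriv_bounded (0, 1)).1. Qed.

Let bdt : exists K : R, forall x, `|diff_t eta x| <= K. Proof. exact: (deriv_bounded (0, 1)).2. Qed.

Let dk k (x : E) : R := 'D_((delta_mx 0 k, 0) : 'rV[R]_d * R^o) (eta : _ -> R^o) x.

Let mdk k : mfun (dk k). Proof. exact: (deriv_bounded (delta_mx 0 k, 0)).1. Qed.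

Let bdk k : exists K : R, forall x, `|dk k x| <= K.
Proof. exact: (deriv_bounded (delta_mx 0 k, 0)).2. Qed.

Let bst (F : E -> R) (g : Y * R -> R) : mfun F ->
  (exists K : R, forall x, `|F x| <= K) -> L1 H g -> L1 H (fun z => F (st z) * g z).
Proof.
move=> mF [K FK] ig; apply: (@integrable_bounded_mul _ _ _ _ (F \o st)) => //.
  exact: measurableT_comp.
by exists K => z; exact: FK.
Qed.

Lemma weak_time i :
  \int[leb]_(t in `[0, 1]) \int[rho t i]_x diff_t eta (x, t) =
  \int[H]_z (diff_t eta (st z) * P i z).
Proof.
rewrite -Rintegral_space_time; last exact: bst mdt bdt (weight_integrable G mP P0 P1 i).
by apply: eq_Rintegral => t _; rewrite Rintegral_rho //; exact: m_slice.
Qed.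

(** The partial derivatives of [eta] are bounded functions of space-time, so against them the
    conditional velocity may be exchanged for the actual displacement. *)
Lemma weak_space i :
  L1 H (fun z => edot (grad_x eta (st z)) (W z.1) * P i z) /\
  \int[leb]_(t in `[0, 1]) \int[rho t i]_x edot (grad_x eta (x, t)) (row i (velocity uu (x, t))) =
  \int[H]_z (edot (grad_x eta (st z)) (W z.1) * P i z).
Proof.
have edotE x (w : 'rV[R]_d) : edot (grad_x eta x) w = \sum_k dk k x * w 0 k.
  by apply: eq_bigr => k _; rewrite mxE.
pose g1 k z := dk k (st z) * uu i k (st z) * P i z.
pose g2 k z := dk k (st z) * W z.1 0 k * P i z.
have ig2 k : L1 H (g2 k).
  have i2 := bst (mdk k) (bdk k) (iW k).
  by apply: (iWP i _ i2); apply/measurable_EFinP; exact: measurable_int i2.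
have mdu k : mfun (fun x => dk k x * uu i k x) by exact: measurable_funM.
have ig1 k : L1 H (g1 k).
  have [_ iu _] := uuP i k.
  have mdst : mfun (dk k \o st) by exact: measurableT_comp.
  have bdst : exists K : R, forall z, `|(dk k \o st) z| <= K.
    by have [K dK] := bdk k; exists K => z; exact: dK.
  have i1 := integrable_bounded_mul mdst bdst iu.
  apply: (wimage_integrable (F := fun z => dk k (st z) * uu i k (st z)) _ i1).
  exact: measurableT_comp (mdu k) mst.
have g12 k : \int[H]_z g1 k z = \int[H]_z g2 k z.
  have [_ _ /(_ _ (mdk k) (bdk k))] := uuP i k.
  rewrite !Rintegral_wimage //.
    by apply: measurable_funM => //; exact: measurableT_comp.
  exact: (measurableT_comp (mdu k) mst).
have [is1 s1] := Rintegral_sum (index_enum 'I_d) ig1.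
have [is2 s2] := Rintegral_sum (index_enum 'I_d) ig2.
have E2 : (fun z => edot (grad_x eta (st z)) (W z.1) * P i z) = fun z => \sum_k g2 k z.
  by apply/funext => z; rewrite edotE mulr_suml.
rewrite E2; split=> //.
rewrite s2 -(eq_bigr _ (fun k _ => g12 k)) -s1 -Rintegral_space_time //.
apply: eq_Rintegral => t _.
under eq_Rintegral do rewrite edotE.
under eq_Rintegral => x _ do under eq_bigr => k _ do rewrite !mxE.
rewrite Rintegral_rho; last first.
  by apply: measurable_sum => k; exact: m_slice (mdu k).
by apply: eq_Rintegral => y _; rewrite mulr_suml.
Qed.

(** Against the bounded function [eta] the fluxes are exchanged for their conditional expectations,
    these for velocity times mean mobility, and that for the mobility on slices. Symmetry of [theta]
    allows one mobility for both orientations of an edge. *)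
Lemma weak_flux i j :
  L1 H (fun z => eta (st z) * (M i j z - M j i z) * q i j) /\
  \int[leb]_(t in `[0, 1]) \int[ord_msum (rho t)]_x
    (eta (x, t) * mobility theta (rho t) i j x *
     (flux_velocity vel (x, t) i j - flux_velocity vel (x, t) j i) * q i j) =
  \int[H]_z (eta (st z) * (M i j z - M j i z) * q i j).
Proof.
have beta := test_function_bounded teta.
pose A (m m' : Y * R -> R) z := eta (st z) * (m z - m' z) * q i j.
have AE m m' : L1 H m -> L1 H m' -> L1 H (A m m') /\
    \int[H]_z A m m' z = (\int[H]_z (eta (st z) * m z) - \int[H]_z (eta (st z) * m' z)) * q i j.
  move=> im im'.
  have j1 := bst meta beta im; have j2 := bst meta beta im'.
  have j4 := L1B j1 j2.
  have -> : A m m' = fun z => (eta (st z) * m z - eta (st z) * m' z) * q i j.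
    by apply/funext => z; rewrite /A mulrBr.
  split; last by rewrite -RintegralB // -RintegralZr.
  have j5 := integrableZr measurableT (q i j) j4.
  by apply: (eq_integrable measurableT _ _ _ j5).
have [iAM AM] := AE _ _ (iM i j) (iM j i); split=> //.
have [iAN AN] := AE _ _ (iN i j) (iN j i).
pose V x := eta x * (th i j x * vel i j x - th j i x * vel j i x) * q i j.
have mV : mfun V.
  by apply: measurable_funM => //; apply: measurable_funM => //; exact: measurable_funB.
have aeV : {ae H, forall z, A (N i j \o st) (N j i \o st) z = V (st z)}.
  apply: filterS velN => z Hz; have := Hz (i, j); have := Hz (j, i); rewrite /= /A /V.
  by move=> /= -> ->.
have mVst : mfun (V \o st) by exact: measurableT_comp.
have iV : L1 H (V \o st) by exact: integrable_ae_eq aeV iAN.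
transitivity (\int[H]_z V (st z)).
  rewrite -(Rintegral_space_time iV); apply: eq_Rintegral => t _.
  rewrite -(Rintegral_rho_total G mX0 mW mP P0 P1 t (F := fun x => V (x, t))); last exact: m_slice.
  apply: Rintegral_ae_eq; first last.
  - apply: filterS2 (velocity_mobility theta mf NulP vel_Nul t i j i j)
      (velocity_mobility theta mf NulP vel_Nul t i j j i) => x E1 E2.
    rewrite !mxE /V (th_sym j i) /=.
    transitivity (eta (x, t) * (vel i j (x, t) * mobility theta (rho t) i j x -
       vel j i (x, t) * mobility theta (rho t) i j x) * q i j); first by ring.
    by rewrite E1 E2; ring.
  - exact: m_slice.
  - apply: measurable_funM => //; apply: measurable_funM.
      by apply: measurable_funM; [exact: m_slice|exact: measurable_mobility].
    by under eq_fun do rewrite !mxE; apply: measurable_funB; exact: m_slice.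
rewrite -(Rintegral_ae_eq _ mVst aeV); last first.
  by apply/measurable_EFinP; exact: measurable_int iAN.
rewrite AN AM.
have [_ _ NE1] := NP i j; have [_ _ NE2] := NP j i.
by rewrite NE1 // NE2.
Qed.

(** For each pair, the weak equation of its graph curve is applied to [eta] along its own segment,
    then integrated over the pairs. *)
Lemma CE_weak_formulation i :
  \int[leb]_(t in `[0, 1]) \int[rho t i]_x diff_t eta (x, t)
  = - (\int[leb]_(t in `[0, 1]) \int[rho t i]_x
        edot (grad_x eta (x, t)) (row i (velocity uu (x, t))))
    - 2^-1 * \sum_j \int[leb]_(t in `[0, 1]) \int[ord_msum (rho t)]_x
        (eta (x, t) * mobility theta (rho t) i j x *
           (flux_velocity vel (x, t) i j - flux_velocity vel (x, t) j i) * q i j).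
Proof.
have [i_s sE] := weak_space i.
have it := bst mdt bdt (weight_integrable G mP P0 P1 i).
rewrite weak_time sE (eq_bigr _ (fun j _ => (weak_flux i j).2)).
have [im mE] := Rintegral_sum (index_enum 'I_n.+1) (fun j => (weak_flux i j).1).
rewrite -mE -RintegralZl //.
have itsD := integrableD measurableT it i_s.
have its : L1 H (fun z =>
    (diff_t eta (st z) + edot (grad_x eta (st z)) (W z.1)) * P i z).
  by apply: (eq_integrable measurableT _ _ _ itsD) => z _; rewrite /= -EFinD mulrDl.
have imZ := integrableZl measurableT 2^-1 im.
(* The transport term joins the time derivative; together they form the derivative of [eta] along
   the segment. *)
apply: (addIr (\int[H]_z (edot (grad_x eta (st z)) (W z.1) * P i z))).
rewrite addrAC addNr add0r -RintegralD //.
under eq_Rintegral do rewrite -mulrDl.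
rewrite (Rintegral_prodfin12 its) (Rintegral_prodfin12 imZ) -RintegralN.
apply: eq_Rintegral => y _.
have Ceta : Ck 1 setT eta by have [+ _] := teta; exact.
have tphi := test_function_line (X0 y) (W y) teta.
have := weakP i y tphi.
under eq_Rintegral => t _ do rewrite derive_material //.
move=> ->; congr (- _); apply: eq_Rintegral => t _.
by rewrite mulrCA mulr_sumr; congr (_ * _); apply: eq_bigr => j _; rewrite mulrA.
Qed.

End weak_formulation.
End continuity_equation.

(** * Existence of the superposed solution, with a bound on its action *)

Section superposition_theorem.
Context {R : realType} {d n : nat} {dY : measure_display} {Y : measurableType dY}.
Variables (Omega : set 'rV[R]_d) (q : 'I_n.+1 -> 'I_n.+1 -> R) (theta : R -> R -> R).
Hypothesis mOmega : measurable Omega.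
Hypothesis q0 : forall i j, 0 <= q i j.
Hypothesis theta_interp : interpolation_function theta.
Variable G : probability Y R.
Variables X0 W : Y -> 'rV[R]_d.
Hypotheses (mX0 : mfun X0) (mW : mfun W).
Variable P : 'I_n.+1 -> Y * R -> R.
Hypotheses (mP : forall i, mfun (P i))
  (P0 : forall i z, 0 <= P i z) (P1 : forall z, \sum_i P i z = 1).
Variables M C : 'I_n.+1 -> 'I_n.+1 -> Y * R -> R.
Local Notation E := ('rV[R]_d * R)%type.
Local Notation st := (space_time X0 W).
Local Notation H := (prodfin G (@leb_unit R)).
Local Notation leb := (@lebesgue_measure R).
Hypothesis mM : forall i j, mfun (M i j).
Hypothesis iC : forall i j, L1 H (C i j).
Hypothesis MC : forall i j a b al z, linear_majorant theta a b ->
  2 * al * M i j z - al ^+ 2 * (a * P i z + b * P j z) <= C i j z.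
Hypothesis posO : forall t, 0 <= t <= 1 -> {ae G, forall y, Omega (position X0 W t y)}.
Hypothesis contP : forall i y, continuous (fun t => P i (y, t)).
Hypothesis weakP : forall i y (phi : R^o -> R), test_function (`]0, 1[ : set R) phi ->
  \int[leb_unit]_t ('D_1 (phi : R^o -> R^o) t * P i (y, t)) =
  - \int[leb_unit]_t (phi t * (2^-1 * \sum_j (M i j (y, t) - M j i (y, t)) * q i j)).
Hypothesis iW2 : forall k, G.-integrable setT (fun y => (W y 0 k ^+ 2)%:E).

Let mst : mfun st. Proof. exact: measurable_space_time. Qed.

(** The dual inequality with al = 1 and al = -1, for a single majorant, bounds |M| by the cost plus
    a bounded function. *)
Lemma flux_integrable i j : L1 H (M i j).
Proof.
have [A [B [AB _]]] := countable_linear_majorants theta_interp.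
have b k z : `|P k z| <= 1 by exact: weight_norm.
have iPc (r : R) k := L1Z r (weight_integrable G mP P0 P1 k).
have i1 := integrableD measurableT (iPc (A 0%N) i) (iPc (B 0%N) j).
have i2 := integrableD measurableT (iC i j) i1.
apply: (@le_integrable _ _ _ _ _ measurableT _ _ _ _ i2).
  exact/measurable_EFinP.
move=> z _; rewrite /= lee_fin; apply: le_trans (ler_norm _).
have := MC i j 1 z (AB 0%N); have := MC i j (-1) z (AB 0%N).
rewrite mulr1 sqrrN !expr1n !mul1r => h1 h2.
have s0 : 0 <= A 0%N * P i z + B 0%N * P j z.
  by apply: le_trans (AB 0%N _ _ (P0 i z) (P0 j z)); exact: (theta_ge0 theta_interp).
by rewrite ler_norml; apply/andP; split; lra.
Qed.

(** For the spatial part, Jensen's inequality is used for each species under its own weight; since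
    the weights sum to one, the bounds add up to the mean squared displacement. *)
Lemma superposition : exists rho u v,
  [/\ vector_CE Omega q theta 0 1 rho u v,
      (forall t i A, measurable A -> rho t i A =
         \int[G]_(y in position X0 W t @^-1` A) (P i (y, t))%:E)%E &
      (\int[leb]_(t in `[0%R, 1%R])
          norm2_rho Omega q theta (rho t) (fun x => u (x, t)) (fun x => v (x, t)) <=
       \sum_k \int[G]_y (W y 0 k ^+ 2)%:E +
       2^-1%:E * \sum_i \sum_j (q i j)%:E * \int[H]_z (C i j z)%:E)%E].
Proof.
have iM := flux_integrable.
have P01 i z : 0 <= P i z <= 1 by rewrite P0 (weight_le1 P0 P1).
have /choice[f fP0] i : exists f : E -> R, is_condexp H st (P i) f /\ forall x, 0 <= f x <= 1.
  exact: condexp_bounds01.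
have fP i := (fP0 i).1; have f01 i := (fP0 i).2.
have /choice[N' NP'] (p : 'I_n.+1 * 'I_n.+1) : exists g, is_condexp H st (M p.1 p.2) g.
  exact: condexp.
have /choice[c' cP'] (p : 'I_n.+1 * 'I_n.+1) : exists g, is_condexp H st (C p.1 p.2) g.
  exact: condexp.
pose N i j := N' (i, j); pose c i j := c' (i, j).
have NP i j : is_condexp H st (M i j) (N i j) by exact: (NP' (i, j)).
have cP i j : is_condexp H st (C i j) (c i j) by exact: (cP' (i, j)).
have mf i : mfun (f i) by have [] := fP i.
pose HP i := species_measure G mP P0 P1 i.
have mWk k : mfun (fun y => W y 0 k).
  exact: (measurableT_comp (measurable_mx_entry 0 k) mW).
have mWz k : mfun (fun z : Y * R => W z.1 0 k).
  exact: (measurableT_comp (mWk k) measurable_fst).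
have mWz2 k : mfun (fun z : Y * R => (W z.1 0 k ^+ 2)).
  exact: measurable_funX.
have HW2 k : (\int[H]_z (W z.1 0 k ^+ 2)%:E = \int[G]_y (W y 0 k ^+ 2)%:E)%E.
  rewrite ge0_prodfin12 //; last 2 first.
  - exact/measurable_EFinP.
  - by move=> z; rewrite lee_fin sqr_ge0.
  apply: eq_integral => y _ /=; rewrite integral_cst //.
  by rewrite [X in (_ * X)%E]leb_unit_setT mule1.
have iW2H k : H.-integrable setT (fun z => (W z.1 0 k ^+ 2)%:E).
  apply/integrableP; split; first exact/measurable_EFinP.
  under eq_integral do rewrite gee0_abs ?lee_fin ?sqr_ge0 //.
  by rewrite HW2; apply: integrable_lty (iW2 k).
have iWP2 i k : (HP i).-integrable setT (fun z => (W z.1 0 k ^+ 2)%:E).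
  apply: integrable_wimage => //.
  apply: (@le_integrable _ _ _ _ _ measurableT _ _ _ _ (iW2H k)).
    by apply/measurable_EFinP; exact: measurable_funM.
  move=> z _; rewrite lee_fin normrM ler_piMr // weight_norm //.
have /choice[uu' uuP'] (p : 'I_n.+1 * 'I_d) :
    exists g, is_condexp (HP p.1) st (fun z => W z.1 0 p.2) g.
  by apply: condexp => //; exact: (L1_sqr (mWz p.2) (iWP2 p.1 p.2)).
pose uu i k := uu' (i, k).
have uuP i k : is_condexp (HP i) st (fun z => W z.1 0 k) (uu i k) by exact: (uuP' (i, k)).
have muu i k : mfun (uu i k) by have [] := uuP i k.
have [Nul [mNul Nul0 NulP]] := rho_slice mX0 mW mP P0 P1 fP f01.
pose vel := mean_velocity theta f N Nul.
have mvel i j : mfun (vel i j).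
  exact: (measurable_mean_velocity theta_interp fP f01 NP mNul).
have vel_Nul i j (x : 'rV[R]_d) t : Nul t -> vel i j (x, t) = 0.
  by move=> Nt; rewrite /vel /mean_velocity indicE memNset ?mul0r.
have velN := mean_velocity_flux theta_interp mX0 mW mP P0 P1 iM iC MC fP f01 NP cP mNul Nul0.
have velN1 : {ae H, forall z, forall p : 'I_n.+1 * 'I_n.+1,
  mean_mobility theta f p.1 p.2 (st z) * vel p.1 p.2 (st z) = N p.1 p.2 (st z)}.
  by apply: filterS velN => z Hz p; exact: (Hz p).1.
have kinE i : (\int[H]_z (kinetic X0 W P uu i z)%:E <=
    \sum_k \int[H]_z (W z.1 0 k ^+ 2 * P i z)%:E)%E.
  have mu2 k : mfun (fun z => uu i k (st z) ^+ 2).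
    by apply: measurable_funX; exact: (measurableT_comp (muu i k) mst).
  have muP k : mfun (fun z => uu i k (st z) ^+ 2 * P i z).
    exact: measurable_funM.
  under eq_integral do rewrite /kinetic -sumEFin.
  rewrite ge0_integral_sum //; last 2 first.
  - by move=> k; apply/measurable_EFinP.
  - by move=> k z _; rewrite lee_fin mulr_ge0 // sqr_ge0.
  apply: lee_sum => k _.
  have := condexp_sqr mst (mWz k) (iWP2 i k) (uuP i k).
  rewrite !ge0_integral_wimage //.
  - exact/measurable_EFinP.
  - by move=> z; rewrite lee_fin sqr_ge0.
  - exact/measurable_EFinP.
  - by move=> z; rewrite lee_fin sqr_ge0.
have WP_le i k : (\int[H]_z (W z.1 0 k ^+ 2 * P i z)%:E < +oo)%E.
  apply: (@le_lt_trans _ _ (\int[H]_z (W z.1 0 k ^+ 2)%:E)%E); last by apply: integrable_lty (iW2H k).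
  apply: ge0_le_integral_nonmeas => z _; first by rewrite lee_fin mulr_ge0 ?sqr_ge0.
  by rewrite lee_fin ler_piMr ?sqr_ge0 // weight_le1.
have kin_lty i : (\int[H]_z (kinetic X0 W P uu i z)%:E < +oo)%E.
  by apply: le_lt_trans (kinE i) _; apply: lte_sum_pinfty.
exists (rho G mX0 mW mP P0 P1), (velocity uu), (flux_velocity vel); split => //.
  split.
  - by move=> t; rewrite in_itv /= => t01; exact: CE_probability.
  - exact: CE_narrow.
  - exact: CE_velocity_measurable uuP.
  - by move=> i; exact: CE_velocity_integrable.
  - exact: CE_flux_velocity_measurable.
  - exact: (CE_flux_integrable mOmega theta_interp mf f01 mvel NulP vel_Nul NP velN1).
  - move=> eta i teta.
    exact: (CE_weak_formulation theta_interp iM weakP mf f01 mvel NulP vel_Nul NP velN1 iW2H uuP teta).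
apply: (le_trans (energy_le mOmega q0 theta_interp mf f01 mvel NulP vel_Nul muu)).
apply: leeD.
  apply: (@le_trans _ _ (\sum_i \sum_k \int[H]_z (W z.1 0 k ^+ 2 * P i z)%:E)%E).
    by apply: lee_sum => i _; exact: kinE.
  rewrite exchange_big /=; apply: lee_sum => k _; rewrite -HW2.
  rewrite -ge0_integral_sum //.
  - apply: ge0_le_integral_nonmeas => z _.
      by apply: sume_ge0 => i _; rewrite lee_fin mulr_ge0 ?sqr_ge0.
    by rewrite sumEFin -mulr_sumr P1 mulr1.
  - by move=> i; apply/measurable_EFinP; exact: measurable_funM.
  - by move=> i z _; rewrite lee_fin mulr_ge0 ?sqr_ge0.
apply: lee_wpmul2l; first by rewrite lee_fin.
apply: lee_sum => i _; apply: lee_sum => j _; apply: lee_wpmul2l; first by rewrite lee_fin.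
exact: (potential_le theta_interp mX0 mW mP P0 P1 iM iC MC fP f01 NP cP mNul Nul0).
Qed.

End superposition_theorem.

(** * Curves on the graph *)

Section residual.
Context {R : realType}.

(* The three weights sum to [1], equal [(1, 0, 0)] and [(0, 1, 0)] at the times
   [0] and [1], and their derivatives are bounded by [t (1 - t)], that is by
   the square root of the last one. *)
Definition residual (e e' h t : R) : R :=
  (1 - t) ^+ 2 * (1 + 2 * t - t ^+ 2) * e + t ^+ 2 * (2 - t ^+ 2) * e' +
  2 * t ^+ 2 * (1 - t) ^+ 2 * h.

Definition residual_rate (e e' h t : R) : R :=
  4 * (t * (1 - t)) * ((t - 2) * e + (1 + t) * e' + (1 - 2 * t) * h).

Lemma residual0 (e e' h : R) : residual e e' h 0 = e.
Proof. by rewrite /residual; ring. Qed.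

Lemma residual1 (e e' h : R) : residual e e' h 1 = e'.
Proof. by rewrite /residual; ring. Qed.

Lemma residual_sum (I : Type) (s : seq I) (e e' h : I -> R) (m t : R) :
  \sum_(i <- s) e i = m -> \sum_(i <- s) e' i = m -> \sum_(i <- s) h i = m ->
  \sum_(i <- s) residual (e i) (e' i) (h i) t = m /\
  \sum_(i <- s) residual_rate (e i) (e' i) (h i) t = 0.
Proof.
move=> em e'm hm; split.
  by rewrite !big_split -!mulr_sumr em e'm hm /=; ring.
by rewrite -mulr_sumr !big_split -!mulr_sumr em e'm hm /=; ring.
Qed.

(** The coefficients of [e] and [e'] are nonnegative on [0, 1]. The remaining term is the mass
    guaranteed on every node, which bounds the mobility of the correcting curve from below. *)
Lemma residual_ge (e e' h t : R) : 0 <= e -> 0 <= e' -> 0 <= t <= 1 ->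
  2 * (t * (1 - t)) ^+ 2 * h <= residual e e' h t.
Proof.
move=> e0 e'0 /andP[t0 t1]; rewrite /residual exprMn mulrA lerDr.
have t2 : t ^+ 2 <= 1 by rewrite expr_le1.
by apply: addr_ge0; rewrite mulr_ge0 // mulr_ge0 ?sqr_ge0 //; lra.
Qed.

Lemma residual_rate_le (e e' h m t : R) : 0 <= e <= m -> 0 <= e' <= m -> 0 <= h <= m -> 0 <= t <= 1 ->
  `|residual_rate e e' h t| <= 20 * m * (t * (1 - t)).
Proof.
move=> /andP[e0 em] /andP[e'0 e'm] /andP[h0 hm] /andP[t0 t1].
have tt : 0 <= t * (1 - t) by rewrite mulr_ge0 // subr_ge0.
rewrite /residual_rate normrM ger0_norm ?mulr_ge0 ?subr_ge0 //.
(* On [0, 1] the three coefficients are at most 2, 2 and 1 in absolute value: hence the 5, and 20 in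
   the statement. *)
rewrite [leRHS](_ : _ = 4 * (t * (1 - t)) * (5 * m)); last by ring.
apply: ler_wpM2l; first by rewrite mulr_ge0.
by rewrite ler_norml; apply/andP; split; nra.
Qed.

Lemma is_derive_residual (e e' h t : R) :
  is_derive (t : R^o) 1 (residual e e' h : R^o -> R^o) (residual_rate e e' h t).
Proof.
rewrite /residual.
apply: is_derive_eq.
rewrite /residual_rate !scaler1 /= /GRing.scale /=; ring.
Qed.

(** The boundary terms vanish, as the endpoints lie outside the support of [phi]. *)
Lemma test_function_by_parts (phi : R^o -> R) (F f : R -> R) :
  test_function (`]0, 1[ : set R) phi -> continuous f ->
  (forall t : R, is_derive (t : R^o) 1 (F : R^o -> R^o) (f t)) ->
  \int[leb_unit]_t ('D_1 (phi : R^o -> R^o) t * F t) = - \int[leb_unit]_t (phi t * f t).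
Proof.
move=> tphi cf dF.
have cphi : continuous (phi : R -> R) := test_function_continuous tphi.
have cphi' : continuous (fun t : R => 'D_1 (phi : R^o -> R^o) t).
  exact: test_function_derive_continuous tphi.
have Fd (t : R) : derivable (F : R^o -> R^o) t 1 by have [] := dF t.
have cF : continuous F.
  by move=> t; apply: differentiable_continuous; apply/derivable1_diffP.
have phid (t : R) : derivable (phi : R^o -> R^o) t 1.
  by have [/(_ 1%N) [_ /(_ 1) [+ _]] _] := tphi => /(_ t); exact.
have phi0 (t : R) : t \notin `]0, 1[ -> phi t = 0.
  by move=> /negP t01; have [_ [K [_ KU] K0]] := tphi; apply: K0 => /KU.
have cvg_bnd (g : R -> R) (t : R) : continuous g -> g @ t^'+ --> g t /\ g @ t^'- --> g t.
  by move=> cg; split; [exact: cvg_at_right_filter (cg t)|exact: cvg_at_left_filter (cg t)].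
rewrite !Rintegral_leb_unit; last 2 first.
- apply: measurable_funM; exact: continuous_measurable_fun.
- apply: measurable_funM; exact: continuous_measurable_fun.
rewrite (@Rintegration_by_parts _ phi F (fun t => 'D_1 (phi : R^o -> R^o) t) f 0 1) //.
- rewrite !phi0 /= ?in_itv /= ?ltxx ?andbF // !mul0r subrr sub0r opprK.
  by [].
- exact: continuous_subspaceT.
- by split; [move=> t _; exact: phid|exact: (cvg_bnd _ _ cphi).1|exact: (cvg_bnd _ _ cphi).2].
- by move=> t _; rewrite derive1E.
- exact: continuous_subspaceT.
- by split; [move=> t _; exact: Fd|exact: (cvg_bnd _ _ cF).1|exact: (cvg_bnd _ _ cF).2].
- by move=> t _; rewrite derive1E; have [] := dF t.
Qed.

(** Extends curves from [0, 1] to all times by their end values, which keeps positivity, total mass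
    and continuity on the whole line. *)
Definition clip (t : R) : R := Num.max 0 (Num.min 1 t).

Lemma clip01 t : 0 <= clip t <= 1.
Proof. by rewrite /clip le_max lexx /= ge_max ler01 ge_min lexx. Qed.

Lemma clip_id t : t \in `[0, 1] -> clip t = t.
Proof. by rewrite in_itv => /= /andP[t0 t1]; rewrite /clip (min_idPr t1) (max_idPr t0). Qed.

Lemma continuous_clip : continuous clip.
Proof.
move=> t; apply: (@continuous_max _ _ (cst 0)); first exact: cvg_cst.
by apply: (@continuous_min _ _ (cst 1)); [exact: cvg_cst|exact: cvg_id].
Qed.

Lemma continuous_residual (e e' h : R) : continuous (residual e e' h).
Proof.
by move=> t; apply: differentiable_continuous; apply/derivable1_diffP;
  have [] := is_derive_residual e e' h t.
Qed.

Lemma continuous_residual_rate (e e' h : R) : continuous (residual_rate e e' h).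
Proof.
have dr (t : R) : derivable (residual_rate e e' h : R^o -> R^o) t 1.
  by rewrite /residual_rate; exact: ex_derive.
by move=> t; apply: differentiable_continuous; apply/derivable1_diffP.
Qed.

(** On the unit interval [clip] is the identity, so both integrals are those of the smooth curve. *)
Lemma residual_weak (phi : R^o -> R) (e e' h : R) : test_function (`]0, 1[ : set R) phi ->
  \int[leb_unit]_t ('D_1 (phi : R^o -> R^o) t * residual e e' h (clip t)) =
  - \int[leb_unit]_t (phi t * residual_rate e e' h (clip t)).
Proof.
move=> tphi.
have := test_function_by_parts tphi (@continuous_residual_rate e e' h)
  (is_derive_residual e e' h).
have cphi : continuous (phi : R -> R) := test_function_continuous tphi.
have cphi' : continuous (fun t : R => 'D_1 (phi : R^o -> R^o) t).
  exact: test_function_derive_continuous tphi.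
have mclip : mfun clip by exact: continuous_measurable_fun continuous_clip.
have mr := continuous_measurable_fun (@continuous_residual e e' h).
have mr' := continuous_measurable_fun (@continuous_residual_rate e e' h).
have mphi := continuous_measurable_fun cphi.
have mphi' := continuous_measurable_fun cphi'.
have mrc : mfun (fun t => residual e e' h (clip t)) by exact: measurableT_comp.
have mrc' : mfun (fun t => residual_rate e e' h (clip t)).
  exact: measurableT_comp.
rewrite (Rintegral_ae_eq (f := fun t => 'D_1 (phi : R^o -> R^o) t * residual e e' h t)
  (g := fun t => 'D_1 (phi : R^o -> R^o) t * residual e e' h (clip t))) => [->||| ].
- congr (- _); apply: Rintegral_ae_eq; [exact: measurable_funM|exact: measurable_funM|].
  by apply: leb_unit_ae => t /clip_id ->.
- exact: measurable_funM.
- exact: measurable_funM.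
- by apply: leb_unit_ae => t /clip_id ->.
Qed.

End residual.

Section flux_matrices.
Context {R : realType} {n : nat}.
Variable q : 'I_n.+1 -> 'I_n.+1 -> R.
Hypotheses (q_sym : graph_symmetric q) (q_conn : graph_connected q).

(* The fluxes transporting a unit of mass from the node [0] to the node [k]. *)
Lemma unit_flux : exists L : 'I_n.+1 -> 'I_n.+1 -> 'I_n.+1 -> R, forall k i,
  2^-1 * \sum_j (L k i j - L k j i) * q i j = (i == k)%:R - (i == ord0)%:R.
Proof.
suff H k : exists L : 'I_n.+1 -> 'I_n.+1 -> R, forall i,
    2^-1 * \sum_j (L i j - L j i) * q i j = (i == k)%:R - (i == ord0)%:R.
  by have /choice[L LP] := H; exists L.
pose reach a := exists L : 'I_n.+1 -> 'I_n.+1 -> R, forall i,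
  2^-1 * \sum_j (L i j - L j i) * q i j = (i == a)%:R - (i == ord0)%:R.
have reach0 : reach ord0.
  exists (fun _ _ => 0) => i; rewrite big1 ?mulr0 ?subrr // => j _.
  by rewrite ?subrr mul0r.
suff reach_path s a : reach a -> path (fun a b => 0 < q a b) a s -> reach (last a s).
  by have /connectP[s sp ->] := q_conn ord0 k; exact: reach_path.
elim: s a => [//|b s IH] a [L LP] /= /andP[qab sp].
(* One more edge moves a unit from [a] to [b]; the amount 2 / q a b compensates for the edge weight
   and for the factor 1/2 of the equation. *)
apply: IH sp; exists (fun x y => L x y + (x == b)%:R * (y == a)%:R * (2 / q a b)) => i.
have E : \sum_j ((i == b)%:R * (j == a)%:R * (2 / q a b) -
     (j == b)%:R * (i == a)%:R * (2 / q a b)) * q i j = 2 * ((i == b)%:R - (i == a)%:R).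
  have qab0 : q a b != 0 by rewrite gt_eqF.
  under eq_bigr do rewrite mulrBl; rewrite sumrB mulrBr; congr (_ - _).
    rewrite (bigD1 a) //= eqxx big1 ?addr0; last first.
      by move=> j /negbTE ->; rewrite mulr0 !mul0r.
    have [->|_] := eqVneq i b; last by rewrite !mul0r mulr0.
    by rewrite (q_sym b a) !mul1r divfK ?mulr1.
  rewrite (bigD1 b) //= eqxx big1 ?addr0; last first.
    by move=> j /negbTE ->; rewrite !mul0r.
  have [->|_] := eqVneq i a; last by rewrite mulr0 !mul0r mulr0.
  by rewrite !mul1r divfK ?mulr1.
under eq_bigr do rewrite opprD addrACA mulrDl.
by rewrite big_split /= E mulrDr LP mulrA mulVf ?mul1r ?pnatr_eq0 // addrC addrA subrK.
Qed.

End flux_matrices.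

(** * Graph curves with the cost in dual form *)

Section transport_curve.
Context {R : realType} {n : nat}.
Variables (q : 'I_n.+1 -> 'I_n.+1 -> R) (theta : R -> R -> R).
Local Notation leb := (@lebesgue_measure R).

(* A curve [p] of probabilities on the graph with fluxes [M]; [tc_cost] is the
   dual form of [M^2 <= C theta(p_i, p_j)] and is stable under addition. *)
Record transport_curve (p : 'I_n.+1 -> R -> R) (M C : 'I_n.+1 -> 'I_n.+1 -> R -> R) : Prop := {
  tc_continuous : forall i, continuous (p i);
  tc_ge0 : forall i t, 0 <= p i t;
  tc_sum : forall t, \sum_i p i t = 1;
  tc_measurable : forall i j, mfun (M i j);
  tc_integrable : forall i j, L1 leb_unit (C i j);
  tc_flux_integrable : forall i j, L1 leb_unit (M i j);
  tc_cost_ge0 : forall i j t, 0 <= C i j t;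
  tc_no_edge : forall i j t, q i j = 0 -> C i j t = 0;
  tc_cost : forall i j a b al t, linear_majorant theta a b ->
    2 * al * M i j t - al ^+ 2 * (a * p i t + b * p j t) <= C i j t;
  tc_weak : forall i (phi : R^o -> R), test_function (`]0, 1[ : set R) phi ->
    \int[leb_unit]_t ('D_1 (phi : R^o -> R^o) t * p i t) =
    - \int[leb_unit]_t (phi t * (2^-1 * \sum_j (M i j t - M j i t) * q i j))
}.

Lemma Rintegral_leb_unit_oo (f g : R -> R) : mfun f ->
  (forall t, t \in `]0, 1[ -> f t = g t) ->
  \int[leb_unit]_t f t = \int[leb]_(t in `]0, 1[) g t.
Proof.
move=> mf fg; rewrite Rintegral_leb_unit //.
transitivity (\int[leb]_(t in `]0, 1[) f t).
  congr fine; apply: integral_itv_bndoo; apply/measurable_EFinP.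
  exact: measurable_funTS.
by apply: eq_Rintegral => t t01; apply: fg; move: t01; rewrite inE.
Qed.

Hypotheses (q0 : forall i j, 0 <= q i j) (q_sym : graph_symmetric q).
Hypothesis theta_interp : interpolation_function theta.

Section graph_curve.
Variables (p : R -> 'rV[R]_n.+1) (v : R -> 'M[R]_n.+1).
Hypothesis pv : graph_CE q theta p v.

Let P i t : R := p (clip t) 0 i.

Let clip_in (t : R) : clip t \in `[0, 1].
Proof. by rewrite in_itv /= clip01. Qed.

Let P_ge0 i t : 0 <= P i t.
Proof. by have [[/(_ _ (clip_in t)) [+ _] _] _ _ _] := pv; exact. Qed.

Let P_sum t : \sum_i P i t = 1.
Proof. by have [[/(_ _ (clip_in t)) [_ +] _] _ _ _] := pv. Qed.

Let cP i : continuous (P i).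
Proof.
move=> t; have [[_ cp] _ _ _] := pv.
have cpc : (p \o clip) s @[s --> t] --> p (clip t).
  have cl : clip s @[s --> t] --> within (`[0, 1] : set R) (nbhs (clip t)).
    move=> A wA; have H : nbhs t (clip @^-1` (fun x => x \in `[0, 1]%R -> A x)).
      exact: (continuous_clip wA).
    by apply: filterS H => s; apply; exact: clip_in.
  move/subspace_continuousP : cp => /(_ (clip t) (clip_in t)).
  exact: cvg_comp cl.
exact: continuous_comp cpc (@coord_continuous R 1 n.+1 0 i _).
Qed.

Let th i j t : R := theta (P i t) (P j t).

Let th_ge0 i j t : 0 <= th i j t.
Proof. exact: (theta_ge0 theta_interp). Qed.

Let mth i j : mfun (th i j).
Proof. by apply: measurable_theta => //; exact: continuous_measurable_fun. Qed.

(** Two truncations: to [0, 1], where [v] is known to be measurable, and to actual edges, because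
    the action gives no bound on the velocity where the weight is zero. *)
Let w i j : R -> R := (fun t => if q i j == 0 then 0 else v t i j) \_ (`[0, 1] : set R).

Let mw i j : mfun (w i j).
Proof.
have [_ mv _ _] := pv; have me := @measurable_mx_entry R n.+1 n.+1 i j.
have H : measurable_fun (`[0, 1] : set R) (fun t => if q i j == 0 then 0 else v t i j).
  case: (q i j == 0); first exact: measurable_cst.
  exact: (measurableT_comp me mv).
exact: (iffLR (measurable_restrictT _ _) H).
Qed.

Let M i j t : R := w i j t * th i j t.
Let C i j t : R := w i j t ^+ 2 * th i j t.

Let w_in i j t : t \in `[0, 1] -> w i j t = if q i j == 0 then 0 else v t i j.
Proof. by move=> t01; rewrite /w patchE mem_set. Qed.

Let C_ge0 i j t : 0 <= C i j t. Proof. by rewrite mulr_ge0 ?sqr_ge0. Qed.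

Let mC i j : mfun (C i j).
Proof. by apply: measurable_funM => //; exact: measurable_funX. Qed.

Lemma action_eq :
  (2^-1%:E * \sum_i \sum_j (q i j)%:E * \int[leb_unit]_t (C i j t)%:E = graph_action q theta p v)%E.
Proof.
transitivity (\int[leb_unit]_t (2^-1 * \sum_i \sum_j q i j * C i j t)%:E)%E.
  under [in RHS]eq_integral do rewrite EFinM -sumEFin.
  rewrite ge0_integralZl //; last 2 first.
  - apply: emeasurable_sum => i; apply/measurable_EFinP; apply: measurable_sum => j.
    exact: measurable_funM.
  - move=> t _; apply: sume_ge0 => i _; rewrite lee_fin; apply: sumr_ge0 => j _.
    by rewrite mulr_ge0.
  congr (_ * _)%E; rewrite ge0_integral_sum //; last 2 first.
  - by move=> i; apply/measurable_EFinP; apply: measurable_sum => j; exact: measurable_funM.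
  - by move=> i t _; rewrite lee_fin; apply: sumr_ge0 => j _; rewrite mulr_ge0.
  apply: eq_bigr => i _; under [in RHS]eq_integral do rewrite -sumEFin.
  rewrite ge0_integral_sum //; last 2 first.
  - by move=> j; apply/measurable_EFinP; exact: measurable_funM.
  - by move=> j t _; rewrite lee_fin mulr_ge0.
  apply: eq_bigr => j _; under [in RHS]eq_integral do rewrite EFinM.
  rewrite ge0_integralZl ?lee_fin //; first exact/measurable_EFinP.
  by move=> t _; rewrite lee_fin.
rewrite ge0_integral_leb_unit; last 2 first.
- apply/measurable_EFinP; apply: measurable_funM => //; apply: measurable_sum => i.
  by apply: measurable_sum => j; exact: measurable_funM.
- move=> t; rewrite lee_fin mulr_ge0 //; apply: sumr_ge0 => i _.
  by apply: sumr_ge0 => j _; rewrite mulr_ge0.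
apply: eq_integral => t /[!inE] t01; congr (_ * _)%:E.
apply: eq_bigr => i _; apply: eq_bigr => j _.
rewrite /C w_in // /th /P clip_id //; case: eqP => [->|_]; first by rewrite mul0r mulr0.
by rewrite mulrC.
Qed.

Hypothesis fin_action : (graph_action q theta p v < +oo)%E.

Let iC i j : L1 leb_unit (C i j).
Proof.
apply/integrableP; split; first exact/measurable_EFinP.
under eq_integral do rewrite /= ger0_norm //.
have [qij0|qij0] := eqVneq (q i j) 0.
  rewrite integral0_eq // => t _.
  by rewrite /C /w patchE qij0 eqxx if_same expr0n mul0r.
have qij : 0 < q i j by rewrite lt_neqAle eq_sym qij0 q0.
have int0 k l : (0 <= (q k l)%:E * \int[leb_unit]_t (C k l t)%:E)%E.
  by rewrite mule_ge0 ?lee_fin //; apply: integral_ge0 => t _; rewrite lee_fin.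
(* All terms of the action are nonnegative, so its finiteness bounds the cost of each edge of
   positive weight. *)
have le1 : ((q i j)%:E * \int[leb_unit]_t (C i j t)%:E <= 2%:E * graph_action q theta p v)%E.
  rewrite -action_eq muleA -EFinM mulfV // mul1e.
  rewrite (bigD1 i) //= (bigD1 j) //= -addeA leeDl //.
  apply: adde_ge0; first by apply: sume_ge0.
  by apply: sume_ge0 => k _; exact: sume_ge0.
rewrite ltNge leye_eq; apply/negP => /eqP E.
move: le1; rewrite E mulry gtr0_sg // mul1e leye_eq => /eqP E2.
have : (2%:E * graph_action q theta p v < +oo)%E by apply: lte_mul_pinfty.
by rewrite E2.
Qed.

Let C_no_edge i j t : q i j = 0 -> C i j t = 0.
Proof. by move=> qij; rewrite /C /w patchE qij eqxx if_same expr0n mul0r. Qed.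

(** Expand (w - al)^2 theta >= 0 and bound [theta] by the majorant in the quadratic term. *)
Let CM i j a b al t : linear_majorant theta a b ->
  2 * al * M i j t - al ^+ 2 * (a * P i t + b * P j t) <= C i j t.
Proof.
move=> ab; rewrite /M /C.
have h1 := ab _ _ (P_ge0 i t) (P_ge0 j t).
have h2 := th_ge0 i j t.
have h3 : al ^+ 2 * th i j t <= al ^+ 2 * (a * P i t + b * P j t).
  by rewrite ler_wpM2l ?sqr_ge0.
have : 0 <= (w i j t - al) ^+ 2 * th i j t by rewrite mulr_ge0 ?sqr_ge0.
by nra.
Qed.

Let mM i j : mfun (M i j). Proof. exact: measurable_funM. Qed.

Let iM i j : L1 leb_unit (M i j).
Proof.
have [a [b [ab _]]] := theta_tangent theta_interp ltr01 ltr01.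
have P_le1 k t : P k t <= 1 by rewrite -(P_sum t) (bigD1 k) //= lerDl sumr_ge0.
have [a0 b0] := linear_majorant_ge0 theta_interp ab.
have i1 : L1 leb_unit (cst (a + b)) by exact: finite_measure_integrable_cst.
have i2 := integrableD measurableT (iC i j) i1.
apply: (@le_integrable _ _ _ _ _ measurableT _ _ _ _ i2); first exact/measurable_EFinP.
move=> t _; rewrite /= lee_fin; apply: le_trans (ler_norm _).
have := CM i j 1 t ab; have := CM i j (-1) t ab.
rewrite mulr1 sqrrN !expr1n !mul1r => h1 h2.
have h3 : a * P i t <= a by rewrite ler_piMr.
have h4 : b * P j t <= b by rewrite ler_piMr.
have := C_ge0 i j t => h5.
by rewrite ler_norml; apply/andP; split; lra.
Qed.

(** Flux and cost are w theta and w^2 theta, so the cost is exactly the integrand of the action. *)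
Lemma graph_curve : exists P' M' C', [/\ transport_curve P' M' C',
  (forall i, P' i 0 = p 0 0 i), (forall i, P' i 1 = p 1 0 i) &
  (2^-1%:E * \sum_i \sum_j (q i j)%:E * \int[leb_unit]_t (C' i j t)%:E =
   graph_action q theta p v)%E].
Proof.
exists P, M, C; split; last exact: action_eq.
- split=> // i phi tphi.
    have mphi : mfun (phi : R -> R).
      by apply: continuous_measurable_fun; exact: (test_function_continuous tphi).
    have mphi' : mfun (fun t : R => 'D_1 (phi : R^o -> R^o) t).
      by apply: continuous_measurable_fun; exact: test_function_derive_continuous tphi.
    have oc (t : R) : t \in `]0, 1[ -> t \in `[0, 1].
      by rewrite !in_itv /= => /andP[/ltW -> /ltW ->].
    have [_ _ _ /(_ phi i tphi) W] := pv.
    rewrite (Rintegral_leb_unit_oo (g := fun t => 'D_1 (phi : R^o -> R^o) t * p t 0 i)); last 2 first.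
    * by apply: measurable_funM => //; exact: continuous_measurable_fun.
    * by move=> t /oc /clip_id t01; rewrite /P t01.
    rewrite W; congr (- _); apply/esym/Rintegral_leb_unit_oo.
      apply: measurable_funM => //; apply: measurable_funM => //; apply: measurable_sum => j.
      by apply: measurable_funM => //; exact: measurable_funB.
    move=> t /oc t01; congr (_ * (_ * _)); apply: eq_bigr => j _.
    (* Symmetry of [q] makes both orientations of a missing edge vanish together; symmetry of
       [theta] gives them one mobility. *)
    rewrite /M !w_in // (q_sym j i) {2}/th (theta_sym theta_interp (P_ge0 j t)) // /th /P clip_id //.
    by case: eqP => [->|_]; [rewrite !mulr0|ring].
- by move=> i; rewrite /P clip_id // in_itv /= lexx ler01.
- by move=> i; rewrite /P clip_id // in_itv /= lexx ler01.
Qed.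

End graph_curve.

End transport_curve.

Lemma continuous_leb_unit_integrable (R : realType) (f : R -> R) : continuous f ->
  L1 leb_unit f.
Proof.
move=> cf; apply: integrable_leb_unit; last exact: continuous_measurable_fun.
apply: continuous_compact_integrable; first exact: segment_compact.
exact: continuous_subspaceT.
Qed.

(** * Mixing a curve with a correction of its endpoints *)

Section mixture.
Context {R : realType} {n : nat}.
Variables (q : 'I_n.+1 -> 'I_n.+1 -> R) (theta : R -> R -> R).
Hypothesis theta_interp : interpolation_function theta.
Variable L : 'I_n.+1 -> 'I_n.+1 -> 'I_n.+1 -> R.
Hypothesis L_unit : forall k i,
  2^-1 * \sum_j (L k i j - L k j i) * q i j = (i == k)%:R - (i == ord0)%:R.

Definition flux_bound : R := \sum_i \sum_j \sum_k `|L k i j|.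

(** The flux is at most 20 eta t (1 - t) times [flux_bound], and each node carries at least 2 t^2 (1
    - t)^2 eta / (n + 1). The quotient of the square by this mass is [eta] times this constant, with
    200 = 20^2 / 2. *)
Definition residual_cost : R := 200 * flux_bound ^+ 2 * n.+1%:R.

Lemma residual_cost_ge0 : 0 <= residual_cost.
Proof. by rewrite mulr_ge0 // mulr_ge0 // sqr_ge0. Qed.

Lemma flux_bound_ge i j : \sum_k `|L k i j| <= flux_bound.
Proof.
rewrite /flux_bound [leRHS](bigD1 i) //= [X in _ <= X + _](bigD1 j) //= -addrA lerDl addr_ge0 //.
  by apply: sumr_ge0 => l _; apply: sumr_ge0.
by apply: sumr_ge0 => k _; apply: sumr_ge0 => l _; apply: sumr_ge0.
Qed.

(** Each node [k] receives its rate through the unit flux from the node [ord0]. The rates sum to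
    zero, so [ord0] is left with its own rate. *)
Definition residual_flux (eta : R) (e e' : 'I_n.+1 -> R) i j t : R :=
  \sum_k residual_rate (e k) (e' k) (eta / n.+1%:R) t * L k i j.

(* The curve [p] does not have the prescribed endpoints, and [e], [e'] are the
   masses missing from [(1 - eta) p] at the times [0] and [1]. *)
Definition mix_weight (eta : R) (p : 'I_n.+1 -> R -> R) (e e' : 'I_n.+1 -> R) i t : R :=
  (1 - eta) * p i t + residual (e i) (e' i) (eta / n.+1%:R) (clip t).

Definition mix_flux (eta : R) (M : 'I_n.+1 -> 'I_n.+1 -> R -> R) (e e' : 'I_n.+1 -> R) i j t : R :=
  (1 - eta) * M i j t + residual_flux eta e e' i j (clip t).

Definition mix_cost (eta : R) (C : 'I_n.+1 -> 'I_n.+1 -> R -> R) i j t : R :=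
  (1 - eta) * C i j t + eta * residual_cost.

Variables (eta : R) (p : 'I_n.+1 -> R -> R) (M C : 'I_n.+1 -> 'I_n.+1 -> R -> R)
  (e e' : 'I_n.+1 -> R).
Hypotheses (eta01 : 0 <= eta <= 1) (pMC : transport_curve q theta p M C).
Hypotheses (e0 : forall i, 0 <= e i) (e'0 : forall i, 0 <= e' i)
  (e_sum : \sum_i e i = eta) (e'_sum : \sum_i e' i = eta).

Let h := eta / n.+1%:R.

Let eta0 : 0 <= eta. Proof. by have /andP[] := eta01. Qed.
Let eta1 : 0 <= 1 - eta. Proof. by rewrite subr_ge0; have /andP[] := eta01. Qed.

Let h_sum : \sum_(i < n.+1) h = eta.
Proof. by rewrite sumr_const card_ord -[LHS]mulr_natr divfK // pnatr_eq0. Qed.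

Let h0 : 0 <= h. Proof. exact: divr_ge0. Qed.

Let le_eta (g : 'I_n.+1 -> R) k : (forall i, 0 <= g i) -> \sum_i g i = eta -> g k <= eta.
Proof. by move=> g0 <-; rewrite (bigD1 k) //= lerDl sumr_ge0. Qed.

Lemma mix_weight_ge0 i t : 0 <= mix_weight eta p e e' i t.
Proof.
rewrite addr_ge0 ?mulr_ge0 ?(tc_ge0 pMC) //.
by apply: le_trans (residual_ge _ (e0 i) (e'0 i) (clip01 t)); rewrite mulr_ge0 // mulr_ge0 // sqr_ge0.
Qed.

Lemma mix_weight_sum t : \sum_i mix_weight eta p e e' i t = 1.
Proof.
rewrite big_split /= -mulr_sumr (tc_sum pMC) mulr1.
by rewrite (residual_sum (h := fun=> h) (clip t) e_sum e'_sum h_sum).1 subrK.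
Qed.

Lemma mix_weight_continuous i : continuous (mix_weight eta p e e' i).
Proof.
move=> t; apply: cvgD; first by apply: cvgM; [exact: cvg_cst|exact: (tc_continuous pMC)].
by apply: continuous_comp; [exact: continuous_clip|exact: continuous_residual].
Qed.

Lemma residual_flux_le i j t : 0 <= t <= 1 ->
  residual_flux eta e e' i j t ^+ 2 <=
  (2 * (t * (1 - t)) ^+ 2 * h) * (eta * residual_cost).
Proof.
move=> t01; have tt : 0 <= t * (1 - t) by case/andP: t01 => t0 t1; rewrite mulr_ge0 // subr_ge0.
have b : `|residual_flux eta e e' i j t| <= 20 * eta * (t * (1 - t)) * flux_bound.
  apply: (le_trans (ler_norm_sum _ _ _)).
  apply: (@le_trans _ _ (\sum_k 20 * eta * (t * (1 - t)) * `|L k i j|)).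
    apply: ler_sum => k _; rewrite normrM ler_wpM2r //; apply: residual_rate_le => //.
    - by rewrite e0 /= le_eta.
    - by rewrite e'0 /= le_eta.
    - by rewrite h0 /=; apply: (le_eta (g := fun=> h)).
  rewrite -mulr_sumr ler_wpM2l ?flux_bound_ge //.
  by rewrite mulr_ge0 // mulr_ge0.
have n0 : n.+1%:R != 0 :> R by rewrite pnatr_eq0.
rewrite [leRHS](_ : _ = (20 * eta * (t * (1 - t)) * flux_bound) ^+ 2); last first.
  rewrite /residual_cost /h; field.
  by move: n0; rewrite -natr1 natr1.
rewrite -real_normK ?num_real // ler_sqr ?nnegrE //.
exact: le_trans b.
Qed.

(** The dual inequality is additive, so the two parts are treated separately. For the correction, a
    + b >= 1 follows from [theta] being 1 at (1, 1); hence the majorant of the residual masses is at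
    least the common lower bound [s], and 2 al m - al^2 s <= m^2 / s. *)
Lemma mix_cost_ge i j a b al t : linear_majorant theta a b ->
  2 * al * mix_flux eta M e e' i j t -
    al ^+ 2 * (a * mix_weight eta p e e' i t + b * mix_weight eta p e e' j t)
  <= mix_cost eta C i j t.
Proof.
move=> ab; have := tc_cost pMC i j al t ab; rewrite /mix_flux /mix_weight /mix_cost.
have [a0 b0] := linear_majorant_ge0 theta_interp ab.
have ab1 : 1 <= a + b.
  by have := ab 1 1 ler01 ler01; rewrite (theta11 theta_interp) !mulr1.
set s := 2 * (clip t * (1 - clip t)) ^+ 2 * h.
have s0 : 0 <= s by rewrite mulr_ge0 // mulr_ge0 // sqr_ge0.
have Si : s <= residual (e i) (e' i) (eta / n.+1%:R) (clip t) by apply: residual_ge => //; exact: clip01.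
have Sj : s <= residual (e j) (e' j) (eta / n.+1%:R) (clip t) by apply: residual_ge => //; exact: clip01.
have m2 := residual_flux_le i j (clip01 t); rewrite -/s in m2.
set m := residual_flux _ _ _ _ _ _ in m2 *.
set K := eta * residual_cost in m2 *.
have K0 : 0 <= K by rewrite mulr_ge0 // residual_cost_ge0.
have sS : s <= a * residual (e i) (e' i) (eta / n.+1%:R) (clip t) +
    b * residual (e j) (e' j) (eta / n.+1%:R) (clip t).
  apply: (@le_trans _ _ (a * s + b * s)); last by apply: lerD; apply: ler_wpM2l.
  by rewrite -mulrDl ler_peMl.
move: sS; set Q := a * residual _ _ _ _ + _ => sS.
have rest : 2 * al * m - al ^+ 2 * Q <= K.
  apply: (@le_trans _ _ (2 * al * m - al ^+ 2 * s)).
    by rewrite lerD2l lerN2 ler_wpM2l ?sqr_ge0.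
  (* [s] vanishes at the two end times, or if eta is 0; the flux is then zero as well. *)
  have [s00|s00] := eqVneq s 0.
    move: m2; rewrite s00 mul0r mulr0 subr0 => m2.
    have -> : m = 0 by apply/eqP; rewrite -sqrf_eq0 eq_le m2 sqr_ge0.
    by rewrite mulr0.
  have s1 : 0 < s by rewrite lt_neqAle eq_sym s00.
  rewrite -(ler_pM2l s1); have := sqr_ge0 (m - al * s); nra.
move=> /(ler_wpM2l eta1); move: rest; rewrite /Q; lra.
Qed.

Lemma mix_weak i (phi : R^o -> R) : test_function (`]0, 1[ : set R) phi ->
  \int[leb_unit]_t ('D_1 (phi : R^o -> R^o) t * mix_weight eta p e e' i t) =
  - \int[leb_unit]_t (phi t *
      (2^-1 * \sum_j (mix_flux eta M e e' i j t - mix_flux eta M e e' j i t) * q i j)).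
Proof.
move=> tphi.
have cphi : continuous (phi : R -> R) := test_function_continuous tphi.
have cphi' : continuous (fun t : R => 'D_1 (phi : R^o -> R^o) t).
  exact: test_function_derive_continuous tphi.
have mphi := continuous_measurable_fun cphi.
have cr : continuous (fun t : R => residual (e i) (e' i) h (clip t)).
  by move=> t; apply: continuous_comp; [exact: continuous_clip|exact: continuous_residual].
have cr' : continuous (fun t : R => residual_rate (e i) (e' i) h (clip t)).
  by move=> t; apply: continuous_comp; [exact: continuous_clip|exact: continuous_residual_rate].
pose D t := 'D_1 (phi : R^o -> R^o) t.
pose F t := 2^-1 * \sum_j (M i j t - M j i t) * q i j.
(* The net inflow of the correction at [i] is its rate there: the term at [ord0] carries the sum of
   all rates, which is zero. *)
have fluxE t : 2^-1 * \sum_j (mix_flux eta M e e' i j t - mix_flux eta M e e' j i t) * q i j =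
    (1 - eta) * F t + residual_rate (e i) (e' i) h (clip t).
  pose r k := residual_rate (e k) (e' k) h (clip t).
  have r_sum : \sum_k r k = 0 := (residual_sum (h := fun=> h) (clip t) e_sum e'_sum h_sum).2.
  rewrite (eq_bigr (fun j => (1 - eta) * ((M i j t - M j i t) * q i j) +
     \sum_k r k * ((L k i j - L k j i) * q i j))); last first.
    move=> j _; rewrite /mix_flux opprD addrACA -mulrBr mulrDl mulrA; congr (_ + _).
    rewrite /residual_flux -sumrB mulr_suml; apply: eq_bigr => k _.
    by rewrite -mulrBr mulrA.
  rewrite big_split /= -mulr_sumr mulrDr mulrCA; congr (_ + _).
  rewrite exchange_big /= mulr_sumr.
  rewrite (eq_bigr (fun k => r k * (i == k)%:R - r k * (i == ord0)%:R)); last first.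
    by move=> k _; rewrite -mulr_sumr mulrCA L_unit mulrBr.
  rewrite sumrB -mulr_suml r_sum mul0r subr0 (bigD1 i) //= eqxx mulr1 big1 ?addr0 //.
  by move=> k /negbTE ki; rewrite eq_sym ki mulr0.
have i1 : L1 leb_unit (fun t => D t * p i t).
  by apply: continuous_leb_unit_integrable => t; apply: cvgM; [exact: cphi'|exact: (tc_continuous pMC)].
have i2 : L1 leb_unit (fun t => D t * residual (e i) (e' i) h (clip t)).
  by apply: continuous_leb_unit_integrable => t; apply: cvgM; [exact: cphi'|exact: cr].
have i3 : L1 leb_unit (fun t => phi t * residual_rate (e i) (e' i) h (clip t)).
  by apply: continuous_leb_unit_integrable => t; apply: cvgM; [exact: cphi|exact: cr'].
have iF : L1 leb_unit F.
  have ij j : L1 leb_unit (fun t => (M i j t - M j i t) * q i j).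
    have k1 := L1B (tc_flux_integrable pMC i j) (tc_flux_integrable pMC j i).
    by under eq_fun do rewrite mulrC; exact: L1Z.
  by have [k1 _] := Rintegral_sum (index_enum 'I_n.+1) ij; exact: L1Z.
have i4 : L1 leb_unit (fun t => phi t * F t).
  by apply: integrable_bounded_mul => //; exact: test_function_bounded tphi.
transitivity ((1 - eta) * \int[leb_unit]_t (D t * p i t) +
    \int[leb_unit]_t (D t * residual (e i) (e' i) h (clip t))).
  rewrite -RintegralZl // -RintegralD //.
    by apply: eq_Rintegral => t _; rewrite /mix_weight -/h -/(D t); ring.
  exact: L1Z.
rewrite (tc_weak pMC i tphi) residual_weak // mulrN -opprD; congr (- _).
rewrite -RintegralZl // -RintegralD //.
  by apply: eq_Rintegral => t _; rewrite fluxE -/(F t); ring.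
exact: L1Z.
Qed.

End mixture.

(** * Cells of endpoints *)

Lemma measurable_select d d' (T : measurableType d) (U : measurableType d') (I : countType)
    (c : T -> I) (F : I -> T -> U) : (forall i, measurable (c @^-1` [set i])) ->
  (forall i, mfun (F i)) -> mfun (fun x => F (c x) x).
Proof.
move=> mc mF _ A mA; rewrite setTI.
rewrite (_ : _ @^-1` A = \bigcup_i (c @^-1` [set i] `&` F i @^-1` A)); last first.
  apply/seteqP; split=> x /=; first by move=> Ax; exists (c x).
  by move=> [i _ /= [-> ]].
apply: countable_bigcupT_measurable => // i; apply: measurableI; first exact: mc.
by rewrite -[X in measurable X]setTI; exact: mF.
Qed.

Section ratio_class.
Context {R : realType}.
Variable s : R.
Hypothesis s0 : 0 < s.

(** Positive numbers are sorted by their logarithm in steps of [s], so ratios within a class stay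
    above exp(- s). Zero is kept apart from all of them. *)
Definition ratio_class (x : R) : option int :=
  if 0 < x then Some (Num.floor (ln x / s)) else None.

Lemma ratio_class_le x y : 0 <= x -> ratio_class x = ratio_class y -> expR (- s) * y <= x.
Proof.
move=> x0; rewrite /ratio_class; have [y0|y0 _] := ltP 0 y; last first.
  by apply: le_trans x0; rewrite mulr_ge0_le0 // expR_ge0.
case: ifP => // xpos [fxy].
have h1 := floor_le (ln x / s); have h2 := floorD1_gt (ln y / s).
move: h1; rewrite fxy => h1.
have : ln y / s < ln x / s + 1.
  by apply: (lt_le_trans h2); rewrite intrD lerD2r.
rewrite -[X in _ < _ + X](divff (lt0r_neq0 s0)) -mulrDl ltr_pM2r ?invr_gt0 // => lnyx.
rewrite -[leRHS](lnK (x := x)) ?posrE // -[X in _ * X](lnK (x := y)) ?posrE //.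
by rewrite -expRD ler_expR; lra.
Qed.

Lemma measurable_ratio_class d (T : measurableType d) (f : T -> R) o :
  mfun f -> measurable ((ratio_class \o f) @^-1` [set o]).
Proof.
move=> mf.
have mpos : measurable (f @^-1` [set x | 0 < x]).
  rewrite (_ : [set x | 0 < x] = `]0, +oo[%classic); last first.
    by apply/seteqP; split=> x /=; rewrite in_itv /= andbT.
  by rewrite -[X in measurable X]setTI; exact: mf.
case: o => [m|].
  rewrite (_ : _ @^-1` _ = f @^-1` [set x | 0 < x] `&`
      (fun x => ln (f x) / s) @^-1` `[m%:~R, (m + 1)%:~R[); last first.
    apply/seteqP; split=> x /=; rewrite /ratio_class.
      by case: ifP => // fx [<-]; rewrite in_itv /= floor_itv.
    by move=> [-> ]; rewrite in_itv /= -floor_eq => /eqP ->.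
  apply: measurableI => //; rewrite -[X in measurable X]setTI.
  have mln : mfun (fun x => ln (f x) / s).
    by apply: measurable_funM => //; exact: measurableT_comp (@measurable_ln R) mf.
  by apply: mln.
rewrite (_ : _ @^-1` _ = ~` (f @^-1` [set x | 0 < x])); first exact: measurableC.
by apply/seteqP; split=> x /=; rewrite /ratio_class; case: ifP.
Qed.

End ratio_class.

Section cells.
Context {R : realType} {n : nat} {dY : measure_display} {Y : measurableType dY}.
Variables (q : 'I_n.+1 -> 'I_n.+1 -> R) (theta : R -> R -> R).
Hypotheses (q0 : forall i j, 0 <= q i j) (q_sym : graph_symmetric q).
Hypothesis theta_interp : interpolation_function theta.
Variable L : 'I_n.+1 -> 'I_n.+1 -> 'I_n.+1 -> R.
Variables a a' : 'I_n.+1 -> Y -> R.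
Hypotheses (ma : forall i, mfun (a i))
  (ma' : forall i, mfun (a' i)).
Hypotheses (a0 : forall i y, 0 <= a i y) (a'0 : forall i y, 0 <= a' i y).
Variables eta eps : R.
Hypotheses (eta_gt0 : 0 < eta) (eta_lt1 : eta < 1) (eps_gt0 : 0 < eps).

(* [- ln (1 - eta)] is the logarithm of the ratio allowed within a cell. *)
Definition cell (y : Y) : {ffun 'I_n.+1 -> option int * option int} :=
  [ffun i => (ratio_class (- ln (1 - eta)) (a i y), ratio_class (- ln (1 - eta)) (a' i y))].

Let s0 : 0 < - ln (1 - eta).
Proof. by rewrite oppr_gt0 ln_lt0 // subr_gt0 eta_lt1 /= gtrBl. Qed.

Lemma cell_le y y' i : cell y = cell y' ->
  (1 - eta) * a i y' <= a i y /\ (1 - eta) * a' i y' <= a' i y.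
Proof.
move=> /(congr1 (fun f : {ffun _ -> _} => f i)); rewrite !ffunE => -[h h'].
have pos : 1 - eta \is Num.pos by rewrite posrE subr_gt0.
have := ratio_class_le s0 (a0 i y) h; have := ratio_class_le s0 (a'0 i y) h'.
by rewrite opprK lnK.
Qed.

Lemma measurable_cell c : measurable (cell @^-1` [set c]).
Proof.
rewrite (_ : _ @^-1` _ = \bigcap_(i in [set: 'I_n.+1])
   ((ratio_class (- ln (1 - eta)) \o a i) @^-1` [set (c i).1] `&`
    (ratio_class (- ln (1 - eta)) \o a' i) @^-1` [set (c i).2])).
  apply: fin_bigcap_measurable => // i _; apply: measurableI; exact: measurable_ratio_class.
apply/seteqP; split=> y /=.
  by move=> <- i _ /=; rewrite ffunE.
move=> H; apply/ffunP => i; have [/= h1 h2] := H i I.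
by rewrite ffunE h1 h2 -surjective_pairing.
Qed.

(** The infimum runs over the curves and also over the endpoint pairs of the cell. Being constant on
    cells, it is measurable in [y], and it is at most the squared graph distance of each pair in the
    cell. *)
Definition cell_action c : \bar R := ereal_inf [set x | exists p v y,
  [/\ graph_CE q theta p v, p 0 = \row_i a i y, p 1 = \row_i a' i y, cell y = c &
      x = graph_action q theta p v]].

Lemma graph_action_ge0 p v : graph_CE q theta p v -> (0 <= graph_action q theta p v)%E.
Proof.
move=> [[pP _] _ _ _]; apply: integral_ge0 => t /= t01; rewrite lee_fin mulr_ge0 //.
apply: sumr_ge0 => i _; apply: sumr_ge0 => j _; rewrite mulr_ge0 // mulr_ge0 ?sqr_ge0 //.
by have [p0 _] := pP _ t01; exact: (theta_ge0 theta_interp).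
Qed.

Lemma cell_action_ge0 c : (0 <= cell_action c)%E.
Proof.
by apply: le_ereal_inf_tmp => _ [p [v [y [pv _ _ _ ->]]]]; exact: graph_action_ge0.
Qed.

Definition total_weight : R := 2^-1 * \sum_i \sum_j q i j.

Lemma total_weight_ge0 : 0 <= total_weight.
Proof. by rewrite mulr_ge0 //; apply: sumr_ge0 => i _; exact: sumr_ge0. Qed.

(** A placeholder for cells of infinite action, where some curve still has to be provided. *)
Lemma constant_curve : transport_curve q theta (fun _ _ => n.+1%:R^-1)
  (fun _ _ _ => 0) (fun _ _ _ => 0).
Proof.
have i0 : L1 leb_unit (fun _ : R => 0 : R).
  by exact: integrable0.
split=> //.
- by move=> i; exact: cst_continuous.
- by move=> t; rewrite sumr_const card_ord -[LHS]mulr_natr mulVf // pnatr_eq0.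
- move=> i j x y al t xy; rewrite mulr0 sub0r oppr_le0 mulr_ge0 ?sqr_ge0 //.
  by have [x0 y0] := linear_majorant_ge0 theta_interp xy; rewrite addr_ge0 // mulr_ge0.
- move=> i phi tphi.
  rewrite (test_function_by_parts (F := fun=> n.+1%:R^-1) (f := fun=> 0) tphi) //.
  + congr (- _); apply: eq_Rintegral => t _; rewrite big1 ?mulr0 // => j _.
    by rewrite subrr mul0r.
  + by move=> t; exact: cst_continuous.
Qed.

Local Notation mixc := (mix_cost L).

Lemma mix_action_le (h : R) p M C : 0 <= h <= 1 -> transport_curve q theta p M C ->
  (2^-1%:E * \sum_i \sum_j (q i j)%:E * \int[leb_unit]_t (mixc h C i j t)%:E <=
   2^-1%:E * \sum_i \sum_j (q i j)%:E * \int[leb_unit]_t ((1 - h) * C i j t)%:E +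
   (h * total_weight * residual_cost L)%:E)%E.
Proof.
move=> /andP[h0 h1] tc.
have half0 : (0 <= (2^-1 : R)%:E)%E by rewrite lee_fin.
have hK0 : 0 <= h * residual_cost L by rewrite mulr_ge0 // residual_cost_ge0.
have mC i j : mfun (C i j).
  by apply/measurable_EFinP; exact: measurable_int (tc_integrable tc i j).
have hC0 i j t : 0 <= (1 - h) * C i j t by rewrite mulr_ge0 ?subr_ge0 // (tc_cost_ge0 tc).
pose J i j := (\int[leb_unit]_t ((1 - h) * C i j t)%:E)%E.
have J0 i j : (0 <= J i j)%E by apply: integral_ge0 => t _; rewrite lee_fin.
have E i j : (\int[leb_unit]_t (mixc h C i j t)%:E = J i j + (h * residual_cost L)%:E)%E.
  under eq_integral do rewrite /mix_cost EFinD.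
  rewrite ge0_integralD //; first by rewrite integral_cst // [X in (_ * X)%E]leb_unit_setT mule1.
  - by move=> t _; rewrite lee_fin.
  - by apply/measurable_EFinP; exact: measurable_funM.
have qJ0 i j : (0 <= (q i j)%:E * J i j)%E by rewrite mule_ge0 // lee_fin.
have E2 i j : ((q i j)%:E * \int[leb_unit]_t (mixc h C i j t)%:E =
    (q i j)%:E * J i j + (q i j * (h * residual_cost L))%:E)%E.
  by rewrite E muleDr // ge0_adde_def // inE ?lee_fin //; exact: J0.
under eq_bigr => i _ do (under eq_bigr => j _ do rewrite E2; rewrite big_split /= sumEFin).
rewrite big_split /= sumEFin muleDr //; last first.
  apply: ge0_adde_def; rewrite inE.
    by apply: sume_ge0 => i _; exact: sume_ge0.
  by rewrite lee_fin; apply: sumr_ge0 => i _; apply: sumr_ge0 => j _; rewrite mulr_ge0.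
rewrite leeD2l // -EFinM lee_fin /total_weight le_eqVlt; apply/orP; left; apply/eqP.
under eq_bigr do rewrite -mulr_suml.
by rewrite -mulr_suml; ring.
Qed.

(** The curve is fixed by the cell alone; the inequalities at both ends leave nonnegative remainders
    for every pair of the cell, to be carried by the correction. *)
Lemma cell_curve c : exists (h : R) p M C, [/\ 0 <= h <= 1, transport_curve q theta p M C,
  (forall y i, cell y = c -> (1 - h) * p i 0 <= a i y /\ (1 - h) * p i 1 <= a' i y) &
  (2^-1%:E * \sum_i \sum_j (q i j)%:E * \int[leb_unit]_t (mixc h C i j t)%:E <=
   cell_action c + (eps + eta * total_weight * residual_cost L)%:E)%E].
Proof.
have w0 := total_weight_ge0.
have rc0 := residual_cost_ge0 L.
have [Ac|Ac] := eqVneq (cell_action c) +oo%E.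
  (* With h = 1 the placeholder gets weight zero and the correction moves all the mass; the cost
     bound is trivial. *)
  exists 1, (fun _ _ => n.+1%:R^-1), (fun _ _ _ => 0), (fun _ _ _ => 0); split.
  - by rewrite ler01 lexx.
  - exact: constant_curve.
  - by move=> y i _; rewrite subrr !mul0r.
  - by rewrite Ac addye // leey.
have Af : cell_action c \is a fin_num by rewrite ge0_fin_numE ?cell_action_ge0 // ltey.
have [_ [p [v [y [pv p0 p1 cy ->]]]] lt] := lb_ereal_inf_adherent eps_gt0 Af.
have finA : (graph_action q theta p v < +oo)%E.
  by apply: lt_le_trans lt _; exact: leey.
have [P [M [C [tc P0 P1 act]]]] := graph_curve q0 q_sym theta_interp pv finA.
have e01 : 0 <= eta <= 1 by rewrite !ltW.
exists eta, P, M, C; split=> //.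
  (* A curve nearly optimal for one pair [y] fits under all others, thanks to the ratio bound within
     the cell. *)
  by move=> y' i cy'; rewrite P0 P1 p0 p1 !mxE; apply: cell_le; rewrite cy' cy.
apply: (le_trans (mix_action_le e01 tc)).
rewrite EFinD addeA; apply: leeD => //.
apply: (le_trans _ (ltW lt)); rewrite -act; apply: lee_wpmul2l; first by rewrite lee_fin.
apply: lee_sum => i _; apply: lee_sum => j _; apply: lee_wpmul2l; first by rewrite lee_fin.
apply: ge0_le_integral_nonmeas => t _; have C0 := tc_cost_ge0 tc i j t.
  by rewrite lee_fin mulr_ge0 // subr_ge0 ltW.
by rewrite lee_fin ler_piMl // lerBlDr lerDl ltW.
Qed.

End cells.

Section measurable_residual.
Context {R : realType} {dT : measure_display} {T : measurableType dT}.
Variables (h : R) (f f' t : T -> R).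
Hypotheses (mf : mfun f) (mf' : mfun f')
  (mt : mfun t).

Lemma measurable_residual : mfun (fun x => residual (f x) (f' x) h (t x)).
Proof.
rewrite /residual; repeat (apply: measurable_funB => // || apply: measurable_funD => // ||
  apply: measurable_funX => // || apply: measurable_funM => //).
Qed.

Lemma measurable_residual_rate :
  mfun (fun x => residual_rate (f x) (f' x) h (t x)).
Proof.
rewrite /residual_rate; repeat (apply: measurable_funB => // || apply: measurable_funD => // ||
  apply: measurable_funX => // || apply: measurable_funM => //).
Qed.

End measurable_residual.

(** * Superposition of the cell curves *)

Section cell_superposition.
Context {R : realType} {d n : nat} {dY : measure_display} {Y : measurableType dY}.
Variables (Omega : set 'rV[R]_d) (q : 'I_n.+1 -> 'I_n.+1 -> R) (theta : R -> R -> R).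
Hypothesis mOmega : measurable Omega.
Hypotheses (q0 : forall i j, 0 <= q i j) (q_sym : graph_symmetric q).
Hypothesis theta_interp : interpolation_function theta.
Variable L : 'I_n.+1 -> 'I_n.+1 -> 'I_n.+1 -> R.
Hypothesis L_unit : forall k i,
  2^-1 * \sum_j (L k i j - L k j i) * q i j = (i == k)%:R - (i == ord0)%:R.
Variable G : probability Y R.
Variables X0 W : Y -> 'rV[R]_d.
Hypotheses (mX0 : mfun X0) (mW : mfun W).
Hypothesis posO : forall t, 0 <= t <= 1 -> {ae G, forall y, Omega (position X0 W t y)}.
Hypothesis iW2 : forall k, G.-integrable setT (fun y => (W y 0 k ^+ 2)%:E).
Variables a a' : 'I_n.+1 -> Y -> R.
Hypotheses (ma : forall i, mfun (a i))
  (ma' : forall i, mfun (a' i)).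
Hypotheses (a0 : forall i y, 0 <= a i y) (a'0 : forall i y, 0 <= a' i y).
Hypotheses (a_sum : forall y, \sum_i a i y = 1) (a'_sum : forall y, \sum_i a' i y = 1).
Variables eta eps : R.
Hypotheses (eta_gt0 : 0 < eta) (eta_lt1 : eta < 1) (eps_gt0 : 0 < eps).

Local Notation cell := (cell a a' eta).
Local Notation A := (cell_action q theta a a' eta).
Local Notation H := (prodfin G (@leb_unit R)).
Local Notation leb := (@lebesgue_measure R).

Hypothesis A_fin : (\int[G]_y A (cell y) < +oo)%E.

Let mcell c : measurable (cell @^-1` [set c]).
Proof. exact: measurable_cell. Qed.

Let mcell1 (c : {ffun 'I_n.+1 -> option int * option int}) :
  measurable ((fun z : Y * R => cell z.1) @^-1` [set c]).
Proof.
have m1 := @measurable_fst _ _ Y R.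
by rewrite -[X in measurable X]setTI; exact: m1 measurableT _ (mcell c).
Qed.

Let mA : mfun (fun y => A (cell y)).
Proof. by apply: (measurable_select (F := fun c _ => A c)) => // c; exact: measurable_cst. Qed.

(** The curve depends on the cell only, but the missing masses [e] and [e'] depend on the pair, so
    each pair keeps its exact endpoints. Measurability in the pair is checked cell by cell. *)
Lemma cell_superposition : exists rho u v,
  [/\ vector_CE Omega q theta 0 1 rho u v,
      (forall i B, measurable B -> rho 0 i B = (\int[G]_(y in X0 @^-1` B) (a i y)%:E)%E),
      (forall i B, measurable B -> rho 1 i B =
         (\int[G]_(y in (fun y => X0 y + W y)%R @^-1` B) (a' i y)%:E)%E) &
      (\int[leb]_(t in `[0%R, 1%R])
          norm2_rho Omega q theta (rho t) (fun x => u (x, t)) (fun x => v (x, t)) <=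
       \sum_k \int[G]_y (W y 0 k ^+ 2)%:E + \int[G]_y A (cell y) +
         (eps + eta * total_weight q * residual_cost L)%:E)%E].
Proof.
have /choice[h] := cell_curve q0 q_sym theta_interp L a0 a'0 eta_gt0 eta_lt1 eps_gt0.
move=> /choice[p] /choice[M] /choice[C] Hc.
have h01 c : 0 <= h c <= 1 by have [] := Hc c.
have tc c : transport_curve q theta (p c) (M c) (C c) by have [] := Hc c.
have le_a y i : (1 - h (cell y)) * p (cell y) i 0 <= a i y.
  by have [_ _ + _] := Hc (cell y) => /(_ y i erefl) [].
have le_a' y i : (1 - h (cell y)) * p (cell y) i 1 <= a' i y.
  by have [_ _ + _] := Hc (cell y) => /(_ y i erefl) [].
pose e c y i := a i y - (1 - h c) * p c i 0.
pose e' c y i := a' i y - (1 - h c) * p c i 1.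
have e0 y i : 0 <= e (cell y) y i by rewrite subr_ge0.
have e'0 y i : 0 <= e' (cell y) y i by rewrite subr_ge0.
have e_sum c y : \sum_i e c y i = h c.
  by rewrite sumrB a_sum -mulr_sumr (tc_sum (tc c)); ring.
have e'_sum c y : \sum_i e' c y i = h c.
  by rewrite sumrB a'_sum -mulr_sumr (tc_sum (tc c)); ring.
pose P i (z : Y * R) :=
  mix_weight (h (cell z.1)) (p (cell z.1)) (e (cell z.1) z.1) (e' (cell z.1) z.1) i z.2.
pose MM i j (z : Y * R) :=
  mix_flux L (h (cell z.1)) (M (cell z.1)) (e (cell z.1) z.1) (e' (cell z.1) z.1) i j z.2.
pose CC i j (z : Y * R) := mix_cost L (h (cell z.1)) (C (cell z.1)) i j z.2.
have mclip : mfun (@clip R).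
  by apply: continuous_measurable_fun; exact: continuous_clip.
have msnd : mfun (fun z : Y * R => z.2) by exact: measurable_snd.
have mt : mfun (fun z : Y * R => clip z.2).
  exact: (measurableT_comp mclip msnd).
have mfst (f : Y -> R) : mfun f -> mfun (fun z : Y * R => f z.1).
  by move=> mf; exact: (measurableT_comp mf measurable_fst).
have me c i : mfun (fun z : Y * R => e c z.1 i).
  by apply: measurable_funB; [exact: mfst|exact: measurable_cst].
have me' c i : mfun (fun z : Y * R => e' c z.1 i).
  by apply: measurable_funB; [exact: mfst|exact: measurable_cst].
have mP i : mfun (P i).
  apply: (measurable_select (c := fun z : Y * R => cell z.1)
    (F := fun c z => mix_weight (h c) (p c) (e c z.1) (e' c z.1) i z.2)) => // c.
  apply: measurable_funD.
    apply: measurable_funM => //.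
    have mpc : mfun (p c i).
      by apply: continuous_measurable_fun; exact: (tc_continuous (tc c)).
    exact: (measurableT_comp mpc msnd).
  exact: (measurable_residual _ (me c i) (me' c i) mt).
have mM i j : mfun (MM i j).
  apply: (measurable_select (c := fun z : Y * R => cell z.1)
    (F := fun c z => mix_flux L (h c) (M c) (e c z.1) (e' c z.1) i j z.2)) => // c.
  apply: measurable_funD.
    apply: measurable_funM => //.
    exact: (measurableT_comp (tc_measurable (tc c) i j) msnd).
  apply: measurable_sum => k; apply: measurable_funM => //.
  exact: (measurable_residual_rate _ (me c k) (me' c k) mt).
have mCc c i j : mfun (C c i j).
  by apply/measurable_EFinP; exact: measurable_int (tc_integrable (tc c) i j).
have mC i j : mfun (CC i j).
  apply: (measurable_select (c := fun z : Y * R => cell z.1)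
    (F := fun c z => mix_cost L (h c) (C c) i j z.2)) => // c.
  apply: measurable_funD => //; apply: measurable_funM => //.
  exact: (measurableT_comp (mCc c i j) msnd).
have P0 i z : 0 <= P i z by apply: (mix_weight_ge0 (h01 _) (tc _)).
have P1 z : \sum_i P i z = 1 by apply: (mix_weight_sum (tc _)).
have C0 i j z : 0 <= CC i j z.
  have /andP[h0 h1] := h01 (cell z.1).
  apply: addr_ge0; apply: mulr_ge0 => //; last exact: residual_cost_ge0.
    by rewrite subr_ge0.
  exact: (tc_cost_ge0 (tc _)).
pose J i j : Y -> \bar R := fun y => (\int[leb_unit]_t (CC i j (y, t))%:E)%E.
have J0 i j y : (0 <= J i j y)%E by apply: integral_ge0 => t _; rewrite lee_fin.
have CJ i j : (\int[H]_z (CC i j z)%:E = \int[G]_y J i j y)%E.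
  rewrite ge0_prodfin12 //; first exact/measurable_EFinP.
  by move=> z; rewrite lee_fin.
have mJ i j : mfun (J i j).
  apply: (@measurable_fun_fubini_tonelli_F _ _ _ _ _ leb_unit (EFin \o CC i j)).
    exact/measurable_EFinP.
  by move=> z; rewrite lee_fin.
set K := eps + eta * total_weight q * residual_cost L.
have K0 : 0 <= K.
  apply: addr_ge0; first exact: ltW.
  apply: mulr_ge0; last exact: residual_cost_ge0.
  by apply: mulr_ge0; [exact: ltW|exact: total_weight_ge0].
have costJ y : (2^-1%:E * \sum_i \sum_j (q i j)%:E * J i j y <= A (cell y) + K%:E)%E.
  by have [_ _ _] := Hc (cell y).
have A0 c : (0 <= A c)%E by exact: cell_action_ge0.
have qJ0 i j y : (0 <= (q i j)%:E * J i j y)%E by rewrite mule_ge0 // lee_fin.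
have mqJ i j : mfun (fun y => (q i j)%:E * J i j y)%E.
  exact: emeasurable_funM.
have half0 : (0 <= (2^-1 : R)%:E)%E by rewrite lee_fin.
have total : (2^-1%:E * \sum_i \sum_j (q i j)%:E * \int[H]_z (CC i j z)%:E <=
    \int[G]_y A (cell y) + K%:E)%E.
  apply: (@le_trans _ _ (\int[G]_y (A (cell y) + K%:E))%E); last first.
    rewrite ge0_integralD //.
      by rewrite integral_cst // [X in (_ * X)%E]probability_setT mule1.
  apply: (@le_trans _ _ (\int[G]_y (2^-1%:E * \sum_i \sum_j (q i j)%:E * J i j y))%E); last first.
    apply: ge0_le_integral_nonmeas => y _; last exact: costJ.
    by rewrite mule_ge0 //; apply: sume_ge0 => i _; exact: sume_ge0.
  rewrite ge0_integralZl //; last 2 first.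
  - by apply: emeasurable_sum => i; exact: emeasurable_sum.
  - by move=> y _; apply: sume_ge0 => i _; exact: sume_ge0.
  apply: le_of_eq; congr (_ * _)%E.
  rewrite ge0_integral_sum //; last 2 first.
  - by move=> i; exact: emeasurable_sum.
  - by move=> i y _; exact: sume_ge0.
  apply: eq_bigr => i _; rewrite ge0_integral_sum //; apply: eq_bigr => j _.
  by rewrite ge0_integralZl // ?lee_fin // CJ.
have AK_lty : (\int[G]_y A (cell y) + K%:E < +oo)%E by rewrite lte_add_pinfty // ltry.
have iC i j : L1 H (CC i j).
  apply/integrableP; split; first exact/measurable_EFinP.
  under eq_integral do rewrite /= ger0_norm //.
  (* Off the edges the total action says nothing about the cost, but there the curves have cost zero
     and only the bounded correction remains. *)
  have [qij|qij] := eqVneq (q i j) 0.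
    apply: (@le_lt_trans _ _ (\int[H]_z (residual_cost L)%:E)%E); last first.
      by rewrite integral_cst // lte_mul_pinfty ?lee_fin ?residual_cost_ge0 // ltey_eq fin_num_measure.
    apply: ge0_le_integral_nonmeas => z _; first by rewrite lee_fin.
    rewrite lee_fin /CC /mix_cost (tc_no_edge (tc _)) // mulr0 add0r.
    have /andP[h0 h1] := h01 (cell z.1).
    by rewrite ler_piMl // residual_cost_ge0.
  have qij0 : 0 < q i j by rewrite lt_neqAle eq_sym qij q0.
  have int0 k l : (0 <= (q k l)%:E * \int[H]_z (CC k l z)%:E)%E.
    by rewrite mule_ge0 ?lee_fin //; apply: integral_ge0 => z _; rewrite lee_fin.
  have le1 : ((2^-1 * q i j)%:E * \int[H]_z (CC i j z)%:E < +oo)%E.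
    apply: le_lt_trans AK_lty; apply: le_trans total.
    rewrite EFinM -muleA lee_wpmul2l // (bigD1 i) //= (bigD1 j) //= -addeA leeDl //.
    apply: adde_ge0; first by apply: sume_ge0.
    by apply: sume_ge0 => k _; exact: sume_ge0.
  rewrite ltNge leye_eq; apply/negP => /eqP E.
  by move: le1; rewrite E mulry gtr0_sg ?mul1e // mulr_gt0.
have contP i y : continuous (fun t => P i (y, t)).
  exact: (@mix_weight_continuous R n q theta (h (cell y)) (p (cell y)) _ _
    (e (cell y) y) (e' (cell y) y) (tc (cell y)) i).
have MC i j b c al z : linear_majorant theta b c ->
    2 * al * MM i j z - al ^+ 2 * (b * P i z + c * P j z) <= CC i j z.
  by move=> bc; exact: (mix_cost_ge theta_interp L (h01 _) (tc _) (e0 z.1) (e'0 z.1)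
    (e_sum _ z.1) (e'_sum _ z.1) i j al z.2 bc).
have weakP i y (phi : R^o -> R) : test_function (`]0, 1[ : set R) phi ->
  \int[leb_unit]_t ('D_1 (phi : R^o -> R^o) t * P i (y, t)) =
  - \int[leb_unit]_t (phi t * (2^-1 * \sum_j (MM i j (y, t) - MM j i (y, t)) * q i j)).
  by move=> tphi; exact: (mix_weak L_unit (tc (cell y)) (e_sum (cell y) y) (e'_sum (cell y) y) i tphi).
have [rho [u [v [CE rhoE act]]]] :=
  superposition mOmega q0 theta_interp mX0 mW mP P0 P1 mM iC MC posO contP weakP iW2.
have P_0 i y : P i (y, 0) = a i y.
  rewrite /P /mix_weight clip_id ?residual0 /=; last by rewrite in_itv /= lexx ler01.
  by rewrite addrC subrK.
have P_1 i y : P i (y, 1) = a' i y.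
  rewrite /P /mix_weight clip_id ?residual1 /=; last by rewrite in_itv /= lexx ler01.
  by rewrite addrC subrK.
exists rho, u, v; split=> //.
- move=> i B mB; rewrite rhoE //; under eq_integral do rewrite P_0.
  by congr integral; apply/seteqP; split=> y /=; rewrite /position scale0r addr0.
- move=> i B mB; rewrite rhoE //; under eq_integral do rewrite P_1.
  by congr integral; apply/seteqP; split=> y /=; rewrite /position scale1r.
- by apply: (le_trans act); rewrite -addeA leeD2l.
Qed.

End cell_superposition.

(** * Projections and couplings *)

Section narrow_unique.
Context {R : realType} {d : nat}.

(** Continuous functions with values in [0, 1] that converge to the indicator of an open orthant:
    each factor becomes 1 where x_k < a_k and stays 0 elsewhere. *)
Let ramp (a : 'rV[rat]_d) (m : nat) (x : 'rV[R]_d) : R :=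
  \prod_(k < d) clip (m%:R * (ratr (a 0 k) - x 0 k)).

Let ramp01 a m x : 0 <= ramp a m x <= 1.
Proof.
apply/andP; split; first by apply: prodr_ge0 => k _; have /andP[] := clip01 (m%:R * (ratr (a 0 k) - x 0 k)).
by apply: prodr_ile1 => k _; exact: clip01.
Qed.

Let ramp_norm a m x : `|ramp a m x| <= 1.
Proof. by have /andP[r0 r1] := ramp01 a m x; rewrite ger0_norm. Qed.

Let ramp_continuous a m : continuous (ramp a m).
Proof.
rewrite /ramp; elim: (index_enum _) => [|k s IH].
  rewrite (_ : (fun x : 'rV[R]_d => _) = cst 1); first exact: cst_continuous.
  by apply/funext => x; rewrite big_nil.
rewrite (_ : (fun x : 'rV[R]_d => _) = fun x => clip (m%:R * (ratr (a 0 k) - x 0 k)) *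
    \prod_(j <- s) clip (m%:R * (ratr (a 0 j) - x 0 j))); last first.
  by apply/funext => x; rewrite big_cons.
have cg (b c : R) : continuous (fun y : R => clip (c * (b - y))).
  move=> y; have cf : {for y, continuous (fun y : R => c * (b - y))}.
    apply: cvgM; first exact: cvg_cst.
    by apply: cvgB; [exact: cvg_cst|exact: cvg_id].
  by have h := @continuous_comp R R R _ _ y cf (@continuous_clip R _); exact: h.
have ck : continuous (fun x : 'rV[R]_d => x 0 k) := @coord_continuous R 1 d 0 k.
move=> x; have c2 := continuous_comp (ck x) (cg (ratr (a 0 k)) m%:R _).
by have h := cvgM c2 (IH x); exact: h.
Qed.

Let ramp_cvg a x : ramp a m x @[m --> \oo] --> (\1_(lower_ray a) x : R).
Proof.
rewrite indicE; apply: cvg_near_cst; have [xa|] := boolP (x \in lower_ray a).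
  have : \forall m \near \oo, forall k : 'I_d, 1 <= m%:R * (ratr (a 0 k) - x 0 k).
    apply: filter_forall => k.
    have xk : 0 < ratr (a 0 k) - x 0 k by rewrite subr_gt0; move: xa; rewrite inE; apply.
    near=> m; rewrite -ler_pdivrMr // mul1r ltW //; near: m; exact: nbhs_infty_gtr.
  apply: filterS => m H; rewrite /ramp big1 // => k _.
  by rewrite /clip (min_idPl (H k)) (max_idPr ler01).
rewrite notin_setE => xa.
have [k xk] : exists k, ratr (a 0 k) <= x 0 k.
  by apply: contrapT => H; apply: xa => k; rewrite ltNge; apply/negP => xk; apply: H; exists k.
near=> m; rewrite /ramp (bigD1 k) //= /clip.
have le0 : m%:R * (ratr (a 0 k) - x 0 k) <= 0 by rewrite mulr_ge0_le0 // subr_le0.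
by rewrite (min_idPr (le_trans le0 ler01)) (max_idPl le0) mul0r.
Unshelve. all: by end_near. Qed.

(** Dominated convergence along the ramps gives equality on the lower rays, which determine the
    measures. *)
Lemma narrow_unique (m1 m2 : {finite_measure set 'rV[R]_d -> \bar R}) :
  (forall f : 'rV[R]_d -> R, continuous f -> bounded_fun f ->
     \int[m1]_x f x = \int[m2]_x f x) ->
  forall A, measurable A -> m1 A = m2 A.
Proof.
move=> m12; apply: rV_measure_unique; first by rewrite ltey_eq fin_num_measure.
move=> a.
have mr k : mfun (ramp a k).
  by apply: continuous_mx_measurable; exact: ramp_continuous.
have lim (m : {finite_measure set 'rV[R]_d -> \bar R}) :
    (\int[m]_x (ramp a k x)%:E)%E @[k --> \oo] --> m (lower_ray a).
  have -> : m (lower_ray a) = (\int[m]_x (\1_(lower_ray a) x)%:E)%E.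
    by rewrite integral_indic // ?setIT //; exact: measurable_lower_ray.
  have [|||||_ _ //] := @dominated_convergence _ _ _ m setT measurableT
    (fun k x => (ramp a k x)%:E) (fun x => (\1_(lower_ray a) x)%:E) (cst 1%E).
  - by move=> k; apply/measurable_EFinP; exact: mr.
  - by apply/measurable_EFinP; apply: measurable_indic; exact: measurable_lower_ray.
  - by apply: aeW => x _; apply/fine_cvgP; split; [exact: nearW|exact: ramp_cvg].
  - by exact: finite_measure_integrable_cst.
  - by apply: aeW => x k _; rewrite /= lee_fin.
have E k : (\int[m1]_x (ramp a k x)%:E = \int[m2]_x (ramp a k x)%:E)%E.
  have i (m : {finite_measure set 'rV[R]_d -> \bar R}) : L1 m (ramp a k).
    by apply: (@integrable_bounded _ _ _ _ _ 1).
  rewrite -(fineK (integrable_fin_num measurableT (i m1))).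
  rewrite -(fineK (integrable_fin_num measurableT (i m2))) -!/(Rintegral _ _ _).
  rewrite m12 //; first exact: ramp_continuous.
  by exists 1; split=> // M M1 x _; apply: (le_trans (ramp_norm a k x)); exact: ltW.
have l1 := lim m1; have e : (fun k => \int[m1]_x (ramp a k x)%:E)%E = fun k => (\int[m2]_x (ramp a k x)%:E)%E.
  by apply/funext => k; exact: E.
rewrite e in l1; exact: (cvg_unique (@ereal_hausdorff R) l1 (lim m2)).
Qed.

End narrow_unique.

Section node_weight.
Context {R : realType} {n : nat}.
Implicit Types (r : 'rV[R]_n) (j : 'I_n.+1).

Lemma bary_max r : bary r 0 ord_max = 1 - \sum_i r 0 i.
Proof. by rewrite mxE unlift_none. Qed.

Lemma bary_lift r (k : 'I_n) : bary r 0 (lift ord_max k) = r 0 k.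
Proof. by rewrite mxE liftK. Qed.

Lemma bary_sum r : \sum_j bary r 0 j = 1.
Proof.
rewrite (bigD1_ord ord_max) //= bary_max.
by under eq_bigr do rewrite bary_lift; rewrite subrK.
Qed.

Lemma simplexE r : simplex r <-> forall j, 0 <= bary r 0 j.
Proof.
split=> [[r0 r1] j|H].
  by case: (unliftP ord_max j) => [k|] ->; rewrite ?bary_lift // bary_max subr_ge0.
split=> [k|]; first by rewrite -bary_lift.
by rewrite -subr_ge0 -bary_max.
Qed.

Lemma measurable_bary j : mfun (fun r => bary r 0 j).
Proof.
case: (unliftP ord_max j) => [k|] ->.
  by under eq_fun do rewrite bary_lift; exact: measurable_mx_entry.
under eq_fun do rewrite bary_max.
by apply: measurable_funB => //; apply: measurable_sum => k; exact: measurable_mx_entry.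
Qed.

Lemma measurable_simplex : measurable (@simplex R n).
Proof.
rewrite (_ : simplex = \bigcap_(j in [set: 'I_n.+1]) ((fun r => bary r 0 j) @^-1` `[0, +oo[)).
  apply: fin_bigcap_measurable => // j _; rewrite -[X in measurable X]setTI.
  exact: measurable_bary.
apply/seteqP; split=> r /=.
  by move=> /simplexE H j _ /=; rewrite in_itv /= andbT.
by move=> H; apply/simplexE => j; have := H j I; rewrite /= in_itv /= andbT.
Qed.

(* [bary] made a probability also off the simplex. *)
Definition node_weight j r : R := if r \in simplex then bary r 0 j else (j == ord0)%:R.

Lemma node_weight_ge0 j r : 0 <= node_weight j r.
Proof. by rewrite /node_weight; case: ifPn => // /[!inE] /simplexE. Qed.

Lemma node_weight_sum r : \sum_j node_weight j r = 1.
Proof.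
rewrite /node_weight; case: (r \in simplex); first exact: bary_sum.
by rewrite (bigD1 ord0) //= big1 ?addr0 // => j /negbTE ->.
Qed.

Lemma node_weight_simplex j r : simplex r -> node_weight j r = bary r 0 j.
Proof. by move=> sr; rewrite /node_weight mem_set. Qed.

Lemma measurable_node_weight j : mfun (node_weight j).
Proof.
rewrite (_ : node_weight j = fun r => \1_simplex r * bary r 0 j + (1 - \1_simplex r) * (j == ord0)%:R).
  have mI : mfun (\1_simplex : 'rV[R]_n -> R).
    exact: measurable_indic measurable_simplex.
  apply: measurable_funD; apply: measurable_funM => //; first exact: measurable_bary.
  exact: measurable_funB.
apply/funext => r; rewrite /node_weight indicE; case: ifP => _.
  by rewrite mul1r subrr mul0r addr0.
by rewrite mul0r add0r subr0 mul1r.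
Qed.

End node_weight.

Section projection.
Context {R : realType} {d n : nat}.
Local Notation lifted := ('rV[R]_d * 'rV[R]_n)%type.
Variables (l : probability lifted R) (mu : 'I_n.+1 -> {finite_measure set 'rV[R]_d -> \bar R}).
Hypotheses (lP : prob_lifted l) (lmu : projects_to l mu).

Lemma ae_simplex : {ae l, forall z, simplex z.2}.
Proof.
exists (~` (setT `*` simplex)); split=> //.
  by apply: measurableC; apply: measurableX => //; exact: measurable_simplex.
by move=> z /= ns [_ sz]; exact: ns.
Qed.

Let w j (z : lifted) : R := node_weight j z.2.

Let mw j : mfun (w j).
Proof. exact: (measurableT_comp (measurable_node_weight j) measurable_snd). Qed.

Let w_ge0 j z : 0 <= w j z. Proof. exact: node_weight_ge0. Qed.

Let w_norm j z : `|w j z| <= 1.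
Proof.
rewrite ger0_norm // -(node_weight_sum z.2) (bigD1 j) //= lerDl.
by apply: sumr_ge0 => i _; exact: node_weight_ge0.
Qed.

Let iw j : L1 l (w j).
Proof. exact: integrable_bounded (w_norm j). Qed.

(** The projection is defined through continuous functions; [narrow_unique] turns it into an
    identity on sets. [node_weight] may replace [bary] because the lifting is carried by the
    simplex. *)
Lemma projection_measure j A : measurable A ->
  mu j A = (\int[l]_(z in fst @^-1` A) (node_weight j z.2)%:E)%E.
Proof.
move=> mA; have m1 := @measurable_fst _ _ 'rV[R]_d 'rV[R]_n.
pose nu : {finite_measure set 'rV[R]_d -> \bar R} := wimage (iw j) (w_ge0 j) m1.
apply: (narrow_unique (m1 := mu j) (m2 := nu)) => // f cf bf.
have mf : mfun f by exact: continuous_mx_measurable.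
rewrite lmu // [RHS]Rintegral_wimage //.
apply: Rintegral_ae_eq.
- apply: measurable_funM; last exact: (measurableT_comp mf m1).
  exact: (measurableT_comp (measurable_bary j) measurable_snd).
- by apply: measurable_funM => //; exact: (measurableT_comp mf m1).
- by apply: filterS ae_simplex => z sz; rewrite /w node_weight_simplex // mulrC.
Qed.

(** The node weights sum to one, so the mass of the lifting over a set is the sum of the masses of
    its projections. *)
Lemma projection_support (Omega : set 'rV[R]_d) : measurable Omega ->
  (forall j, mu j (~` Omega) = 0%E) -> l (fst @^-1` (~` Omega)) = 0%E.
Proof.
move=> mO mu0; have mC : measurable (~` Omega) by exact: measurableC.
have m1 := @measurable_fst _ _ 'rV[R]_d 'rV[R]_n.
have mB : measurable ((fst : lifted -> _) @^-1` (~` Omega)).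
  by rewrite -[X in measurable X]setTI; exact: m1.
transitivity (\int[l]_(z in fst @^-1` (~` Omega)) (\sum_j node_weight j z.2)%:E)%E.
  by under eq_integral do rewrite node_weight_sum; rewrite integral_cst // mul1e.
under eq_integral do rewrite -sumEFin.
rewrite ge0_integral_sum //.
- by apply: big1 => j _; rewrite -(projection_measure j mC) mu0.
- by move=> j; apply/measurable_EFinP; apply: measurable_funTS; exact: mw.
- by move=> j z _; rewrite lee_fin node_weight_ge0.
Qed.

End projection.

Lemma integral_coupling_fst d (T : measurableType d) (R : realType)
    (l : probability T R) (g : probability (T * T)%type R) (B : set T) (f : T -> \bar R) :
  (forall A, measurable A -> g (A `*` setT) = l A) -> measurable B ->
  mfun f -> (forall x, 0 <= f x)%E ->
  (\int[g]_(y in fst @^-1` B) f y.1 = \int[l]_(x in B) f x)%E.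
Proof.
move=> gl mB mf f0; have m1 := @measurable_fst _ _ T T.
rewrite -(@ge0_integral_pushforward _ _ _ _ _ fst m1 g B f) //; last exact: measurable_funTS.
by apply: eq_measure_integral => A mA _; have := gl A mA; rewrite setXT; exact.
Qed.

Lemma integral_coupling_snd d (T : measurableType d) (R : realType)
    (l : probability T R) (g : probability (T * T)%type R) (B : set T) (f : T -> \bar R) :
  (forall A, measurable A -> g (setT `*` A) = l A) -> measurable B ->
  mfun f -> (forall x, 0 <= f x)%E ->
  (\int[g]_(y in snd @^-1` B) f y.2 = \int[l]_(x in B) f x)%E.
Proof.
move=> gl mB mf f0; have m1 := @measurable_snd _ _ T T.
rewrite -(@ge0_integral_pushforward _ _ _ _ _ snd m1 g B f) //; last exact: measurable_funTS.
by apply: eq_measure_integral => A mA _; have := gl A mA; rewrite setTX; exact.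
Qed.

(** * The dynamic distance bounded by the cost of a coupling *)

Section dynamic_le_coupling.
Context {R : realType} {d n : nat}.
Variables (Omega : set 'rV[R]_d) (q : 'I_n.+1 -> 'I_n.+1 -> R) (theta : R -> R -> R).
Hypotheses (closed_Omega : closed Omega) (convex_Omega : @convex_set R 'rV[R]_d Omega).
Hypotheses (q0 : weighted_graph q) (q_sym : graph_symmetric q) (q_conn : graph_connected q).
Hypothesis theta_interp : interpolation_function theta.
Local Notation lifted := ('rV[R]_d * 'rV[R]_n)%type.
Local Notation leb := (@lebesgue_measure R).
Variables mu nu : 'I_n.+1 -> {finite_measure set 'rV[R]_d -> \bar R}.
Hypotheses (mu0 : forall i, mu i (~` Omega) = 0%E) (nu0 : forall i, nu i (~` Omega) = 0%E).
Variables l1 l2 : probability lifted R.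
Hypotheses (l1P : prob_lifted l1) (l2P : prob_lifted l2).
Hypotheses (l1mu : projects_to l1 mu) (l2nu : projects_to l2 nu).
Variable g : probability (lifted * lifted)%type R.
Hypothesis g12 : coupling l1 l2 g.

Local Notation Y := (lifted * lifted)%type.
Let X0 (y : Y) : 'rV[R]_d := y.1.1.
Let X1 (y : Y) : 'rV[R]_d := y.2.1.
Let W (y : Y) : 'rV[R]_d := y.2.1 - y.1.1.
Let a i (y : Y) : R := node_weight i y.1.2.
Let a' i (y : Y) : R := node_weight i y.2.2.

Let mOmega : measurable Omega. Proof. exact: closed_mx_measurable. Qed.

Let mX0 : mfun X0.
Proof. exact: (measurableT_comp (@measurable_fst _ _ 'rV[R]_d 'rV[R]_n) (@measurable_fst _ _ lifted lifted)). Qed.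

Let mX1 : mfun X1.
Proof. exact: (measurableT_comp (@measurable_fst _ _ 'rV[R]_d 'rV[R]_n) (@measurable_snd _ _ lifted lifted)). Qed.

Let mr1 : mfun (fun y : Y => y.1.2).
Proof. exact: (measurableT_comp (@measurable_snd _ _ 'rV[R]_d 'rV[R]_n) (@measurable_fst _ _ lifted lifted)). Qed.

Let mr2 : mfun (fun y : Y => y.2.2).
Proof. exact: (measurableT_comp (@measurable_snd _ _ 'rV[R]_d 'rV[R]_n) (@measurable_snd _ _ lifted lifted)). Qed.

Let mW : mfun W.
Proof.
apply: measurable_fun_mx => i j; rewrite /W; under eq_fun do rewrite !mxE.
apply: measurable_funB; first exact: (measurableT_comp (measurable_mx_entry i j) mX1).
exact: (measurableT_comp (measurable_mx_entry i j) mX0).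
Qed.

Let ma i : mfun (a i).
Proof. exact: (measurableT_comp (measurable_node_weight i) mr1). Qed.

Let ma' i : mfun (a' i).
Proof. exact: (measurableT_comp (measurable_node_weight i) mr2). Qed.

Let ae_Omega0 : {ae g, forall y, Omega (X0 y)}.
Proof.
have mC : measurable (~` Omega) by exact: measurableC.
have m1 := @measurable_fst _ _ 'rV[R]_d 'rV[R]_n.
have mB : measurable ((fst : lifted -> _) @^-1` (~` Omega)).
  by rewrite -[X in measurable X]setTI; exact: m1.
exists (fst @^-1` (~` Omega) `*` setT); split=> //; first exact: measurableX.
by rewrite (g12 mB).1; exact: (projection_support l1P l1mu mOmega mu0).
Qed.

Let ae_Omega1 : {ae g, forall y, Omega (X1 y)}.
Proof.
have mC : measurable (~` Omega) by exact: measurableC.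
have m1 := @measurable_fst _ _ 'rV[R]_d 'rV[R]_n.
have mB : measurable ((fst : lifted -> _) @^-1` (~` Omega)).
  by rewrite -[X in measurable X]setTI; exact: m1.
exists (setT `*` fst @^-1` (~` Omega)); split=> //; first exact: measurableX.
by rewrite (g12 mB).2; exact: (projection_support l2P l2nu mOmega nu0).
Qed.

Let posO t : 0 <= t <= 1 -> {ae g, forall y, Omega (position X0 W t y)}.
Proof.
move=> /andP[t0 t1]; apply: filterS2 ae_Omega0 ae_Omega1 => y O0 O1.
have := @convex_Omega (X1 y) (X0 y) (Itv01 t0 t1) (mem_set O1) (mem_set O0); rewrite inE.
have -> : position X0 W t y = t *: X1 y + (1 - t) *: X0 y; last by [].
by rewrite /position /W scalerBl scale1r scalerBr addrCA.
Qed.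

(** Every graph curve joining the weights of [y] competes in the infimum over the cell of [y], so
    the cell action is at most the squared simplex distance. *)
Lemma cell_le_distance (eta : R) y :
  (\sum_k (W y 0 k ^+ 2)%:E + cell_action q theta a a' eta (cell a a' eta y) <=
   d_lifted q theta y.1 y.2 ^+ 2)%E.
Proof.
have inf0 : (0 <= ereal_inf [set x | exists p v, [/\ graph_CE q theta p v, p 0%R = bary y.1.2,
    p 1%R = bary y.2.2 & x = graph_action q theta p v]])%E.
  by apply: le_ereal_inf_tmp => _ [p [v [pv _ _ ->]]]; exact: graph_action_ge0.
rewrite /d_lifted /d_simplex /W_graph sqr_sqrte //; last first.
  by rewrite sqr_sqrte // adde_ge0 // lee_fin sqr_ge0.
rewrite sqr_sqrte //; apply: leeD.
  rewrite enorm_sqr sumEFin lee_fin le_eqVlt; apply/orP; left; apply/eqP.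
  by apply: eq_bigr => k _; rewrite /W !mxE -sqrrN opprB.
apply: le_ereal_inf_tmp => _ [p [v [pv p0 p1 ->]]]; apply: ereal_inf_lbound.
have [[pP _] _ _ _] := pv.
have i0 : (0 : R) \in `[0, 1] by rewrite in_itv /= lexx ler01.
have i1 : (1 : R) \in `[0, 1] by rewrite in_itv /= lexx ler01.
(* The existence of a curve puts its endpoints in the simplex, where [node_weight] is [bary]. For
   other points the infimum is over the empty set and equals +oo. *)
have s1 : simplex y.1.2 by have [b0 _] := pP 0 i0; rewrite p0 in b0; exact/simplexE.
have s2 : simplex y.2.2 by have [b0 _] := pP 1 i1; rewrite p1 in b0; exact/simplexE.
exists p, v, y; split=> //.
- by rewrite p0; apply/rowP => i; rewrite [in RHS]mxE /a node_weight_simplex.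
- by rewrite p1; apply/rowP => i; rewrite [in RHS]mxE /a' node_weight_simplex.
Qed.

Lemma dynamic_le_coupling : (ereal_inf [set x | exists rho u v,
    [/\ vector_CE Omega q theta 0%R 1%R rho u v,
        (forall i A, measurable A -> rho 0%R i A = mu i A),
        (forall i A, measurable A -> rho 1%R i A = nu i A) &
        x = \int[leb]_(t in `[0%R, 1%R])
          norm2_rho Omega q theta (rho t) (fun x => u (x, t)) (fun x => v (x, t))]] <=
  \int[g]_y (d_lifted q theta y.1 y.2 ^+ 2))%E.
Proof.
set I := (\int[g]_y _)%E.
have [->|Ifin] := eqVneq I +oo%E; first exact: leey.
have Ilty : (I < +oo)%E by rewrite ltey.
have [L L_unit] := unit_flux q_sym q_conn.
have W2_ge0 y : (0 <= \sum_k (W y 0 k ^+ 2)%:E)%E.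
  by apply: sume_ge0 => k _; rewrite lee_fin sqr_ge0.
have A0 eta c : (0 <= cell_action q theta a a' eta c)%E by exact: cell_action_ge0.
have sum_le (eta : R) : (\int[g]_y (\sum_k (W y 0 k ^+ 2)%:E +
    cell_action q theta a a' eta (cell a a' eta y)) <= I)%E.
  apply: ge0_le_integral_nonmeas => y _; last exact: cell_le_distance.
  exact: adde_ge0.
have mW2 k : mfun (fun y => (W y 0 k ^+ 2)%:E).
  apply/measurable_EFinP; apply: measurable_funX.
  exact: (measurableT_comp (measurable_mx_entry 0 k) mW).
have iW2 k : g.-integrable setT (fun y => (W y 0 k ^+ 2)%:E).
  apply/integrableP; split=> //.
  under eq_integral do rewrite gee0_abs ?lee_fin ?sqr_ge0 //.
  (* Any ratio parameter would do: the cell action is merely dropped, being nonnegative. *)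
  apply: le_lt_trans Ilty; apply: le_trans (sum_le 0).
  apply: ge0_le_integral_nonmeas => y _; first by rewrite lee_fin sqr_ge0.
  rewrite (bigD1 k) //= -addeA leeDl // adde_ge0 //.
  by apply: sume_ge0 => j _; rewrite lee_fin sqr_ge0.
apply/lee_addgt0Pr => e e0.
pose K := total_weight q * residual_cost L.
have K0 : 0 <= K by apply: mulr_ge0; [exact: total_weight_ge0|exact: residual_cost_ge0].
(* Half of [e] pays for near-optimality and half for the corrections. The bound 1/2 ensures eta < 1,
   and K + 1 avoids a division by zero. *)
pose eta := Num.min (2^-1) (e / 2 / (K + 1)).
have K1 : 0 < K + 1 by rewrite ltr_wpDl.
have eta0 : 0 < eta by rewrite lt_min invr_gt0 ltr0n /= !divr_gt0.
have eta1 : eta < 1 by rewrite gt_min invf_lt1 ?ltr1n.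
have etaK : e / 2 + eta * K <= e.
  have : eta * (K + 1) <= e / 2.
    by rewrite -ler_pdivlMr // ge_min lexx orbT.
  by have := ltW eta0; nra.
have A_fin : (\int[g]_y cell_action q theta a a' eta (cell a a' eta y) < +oo)%E.
  apply: le_lt_trans Ilty; apply: le_trans (sum_le eta).
  by apply: ge0_le_integral_nonmeas => y _ //; rewrite leeDr.
have a_ge0 i y : 0 <= a i y by exact: node_weight_ge0.
have a'_ge0 i y : 0 <= a' i y by exact: node_weight_ge0.
have a_sum y : \sum_i a i y = 1 by exact: node_weight_sum.
have a'_sum y : \sum_i a' i y = 1 by exact: node_weight_sum.
have e20 : 0 < e / 2 by rewrite divr_gt0.
have [rho [u [v [CE r0 r1 act]]]] := cell_superposition mOmega q0 q_sym theta_interp L_unit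
  mX0 mW posO iW2 ma ma' a_ge0 a'_ge0 a_sum a'_sum eta0 eta1 e20 A_fin.
have m1 := @measurable_fst _ _ 'rV[R]_d 'rV[R]_n.
have mpre B : measurable B -> measurable ((fst : lifted -> _) @^-1` B).
  by move=> mB; rewrite -[X in measurable X]setTI; exact: m1.
have mnw i : mfun (fun z : lifted => (node_weight i z.2)%:E).
  apply/measurable_EFinP.
  exact: (measurableT_comp (measurable_node_weight i) (@measurable_snd _ _ 'rV[R]_d 'rV[R]_n)).
have nw0 i (z : lifted) : (0 <= (node_weight i z.2)%:E)%E by rewrite lee_fin node_weight_ge0.
apply: ge_ereal_inf; exists (\int[leb]_(t in `[0%R, 1%R])
          norm2_rho Omega q theta (rho t) (fun x => u (x, t)) (fun x => v (x, t)))%E.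
  exists rho, u, v; split=> //.
  - move=> i B mB; rewrite r0 // (projection_measure l1P l1mu) //.
    exact: (@integral_coupling_fst _ _ _ l1 g _ (fun z => (node_weight i z.2)%:E)
      (fun A mA => (g12 mA).1) (mpre B mB) (mnw i) (nw0 i)).
  - move=> i B mB; rewrite r1 // (projection_measure l2P l2nu) //.
    rewrite (_ : (fun y => X0 y + W y) = X1); last by apply/funext => y; rewrite addrC subrK.
    exact: (@integral_coupling_snd _ _ _ l2 g _ (fun z => (node_weight i z.2)%:E)
      (fun A mA => (g12 mA).2) (mpre B mB) (mnw i) (nw0 i)).
apply: (le_trans act); apply: leeD; last by rewrite lee_fin -mulrA.
apply: le_trans (sum_le eta).
rewrite -ge0_integral_sum //; last by move=> k y _; rewrite lee_fin sqr_ge0.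
rewrite -ge0_integralD //.
- exact: emeasurable_sum.
- apply: (measurable_select (F := fun c _ => cell_action q theta a a' eta c)) => c.
    exact: measurable_cell.
  exact: measurable_cst.
Qed.

End dynamic_le_coupling.

(** * The canonical lifting is a lifting *)

Section canonical_lifting.
Context {R : realType} {d n : nat}.
Variable mu : 'I_n.+1 -> {finite_measure set 'rV[R]_d -> \bar R}.
Hypothesis mass1 : (\sum_i mu i setT = 1)%E.
Local Notation lifted := ('rV[R]_d * 'rV[R]_n)%type.

Lemma canonical_lifting_rectangle (A : set 'rV[R]_d) (B : set 'rV[R]_n) :
  measurable A -> measurable B ->
  canonical_lifting mu (A `*` B) = (\sum_i mu i A * \d_(vertex i) B)%E.
Proof.
by move=> mA mB; apply: eq_bigr => i _; exact: product_measure1E.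
Qed.

Let canonical_mass : canonical_lifting mu setT = 1%E.
Proof.
rewrite -setXTT canonical_lifting_rectangle // -[RHS]mass1.
by apply: eq_bigr => i _; rewrite diracT mule1.
Qed.

(** The proof of total mass one is an argument so that the probability structure can be attached to
    the term. *)
Definition canonical_probability (mass1 : (\sum_i mu i setT = 1)%E) : set lifted -> \bar R :=
  canonical_lifting mu.

HB.instance Definition _ := Measure.on (canonical_probability mass1).
HB.instance Definition _ := Measure_isProbability.Build _ _ _
  (canonical_probability mass1) canonical_mass.

Let measurable_vertex j : measurable [set vertex j : 'rV[R]_n].
Proof.
apply: closed_mx_measurable; apply: compact_closed; first exact: norm_hausdorff.
exact: compact_set1.
Qed.

Lemma vertex_inj : injective (@vertex R n).
Proof.
move=> i j /(congr1 bary); rewrite !bary_vertex => /rowP /(_ i).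
rewrite !mxE !eqxx /=; have [//|_] := eqVneq i j.
by move/eqP; rewrite oner_eq0.
Qed.

Lemma ae_vertex : {ae canonical_probability mass1, forall z, exists k, z.2 = vertex k}.
Proof.
pose S := \bigcup_(k in [set: 'I_n.+1]) [set vertex k : 'rV[R]_n].
have mS : measurable S.
  by apply: fin_bigcup_measurable.
exists (setT `*` ~` S); split.
- by apply: measurableX => //; exact: measurableC.
- rewrite [LHS]canonical_lifting_rectangle //; last exact: measurableC.
  rewrite big1 // => i _; rewrite diracE memNset ?mule0 //.
  by apply; exists i.
- by move=> z /= nz; split=> // -[k _ zk]; apply: nz; exists k.
Qed.

Lemma canonical_prob_lifted : prob_lifted (canonical_probability mass1).
Proof.
have mC : measurable (~` (setT `*` simplex) : set lifted).
  by apply: measurableC; apply: measurableX => //; exact: measurable_simplex.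
apply/(negligibleP _ mC).
apply: negligibleS ae_vertex => z /= nz [k zk]; apply: nz; split=> //=.
by rewrite zk; apply/simplexE => j; rewrite bary_vertex mxE.
Qed.

(** The lifting is carried by the vertices, where the [j]-th barycentric coordinate is the indicator
    of vertex [j]; the vertices being distinct, the image of this indicator is [mu j]. *)
Lemma canonical_projects_to : projects_to (canonical_probability mass1) mu.
Proof.
move=> j eta ceta beta.
have m1 := @measurable_fst _ _ 'rV[R]_d 'rV[R]_n.
have m2 := @measurable_snd _ _ 'rV[R]_d 'rV[R]_n.
have meta : mfun eta by exact: continuous_mx_measurable.
pose h (z : lifted) : R := \1_[set vertex j] z.2.
have mh : mfun h.
  have mI : mfun (\1_[set vertex j] : 'rV[R]_n -> R).
    by apply: measurable_indic; exact: measurable_vertex.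
  exact: (measurableT_comp mI m2).
have h0 z : 0 <= h z by [].
have h1 z : `|h z| <= 1 by rewrite /h indicE; case: (_ \in _); rewrite ?normr1 ?normr0.
have ih : L1 (canonical_probability mass1) h.
  exact: integrable_bounded h1.
transitivity (\int[wimage ih h0 m1]_x eta x).
  congr fine; apply: eq_measure_integral => A mA _.
  transitivity (canonical_lifting mu (A `*` [set vertex j])).
    rewrite canonical_lifting_rectangle // (bigD1 j) //= big1 ?adde0.
      by rewrite diracE mem_set // mule1.
    move=> i ij; rewrite diracE memNset ?mule0 // => /vertex_inj ij'.
    by rewrite ij' eqxx in ij.
  rewrite [RHS](_ : _ = \int[canonical_probability mass1]_(z in fst @^-1` A) (h z)%:E)%E //.
  rewrite integral_set_indic.
  rewrite (eq_integral (EFin \o \1_(A `*` [set vertex j]))).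
    by rewrite integral_indic // ?setIT //; exact: measurableX.
  move=> z _ /=; rewrite /h !indicE -natrM mulnb; congr (_%:R)%:E; congr nat_of_bool.
  apply/andP/idP => [[/set_mem zA /set_mem zj]|/set_mem [zA zj]]; first exact: mem_set.
  by split; exact: mem_set.
rewrite Rintegral_wimage //; apply: Rintegral_ae_eq.
- by apply: measurable_funM => //; exact: (measurableT_comp meta m1).
- apply: measurable_funM; last exact: (measurableT_comp meta m1).
  exact: (measurableT_comp (measurable_bary j) m2).
- apply: filterS ae_vertex => z [k zk]; rewrite mulrC zk bary_vertex mxE /h zk indicE /=.
  congr (_%:R * _); congr nat_of_bool; apply/idP/eqP.
    by rewrite inE => /vertex_inj.
  by move=> ->; rewrite inE.
Qed.

End canonical_lifting.

Lemma prob_vec_mass (R : realType) (d n : nat) (Omega : set 'rV[R]_d)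
    (mu : 'I_n.+1 -> {finite_measure set 'rV[R]_d -> \bar R}) : measurable Omega ->
  prob_vec Omega mu -> (\sum_i mu i setT = 1)%E.
Proof.
move=> mO [mu0 <-]; apply: eq_bigr => i _.
rewrite -(setUv Omega) measureU //; last by rewrite setICr.
  by rewrite [X in (_ + X)%E]mu0 adde0.
exact: measurableC.
Qed.

Lemma kantorovich_inf_ge0 d (T : measurableType d) (R : realType) (dist : T -> T -> \bar R)
    (l1 l2 : {measure set T -> \bar R}) :
  (0 <= ereal_inf [set \int[g]_z (dist z.1 z.2 ^+ 2) | g in coupling l1 l2])%E.
Proof.
apply: le_ereal_inf_tmp => _ [g _ <-]; apply: integral_ge0 => z _; exact: sqre_ge0.
Qed.

Theorem theorem1p4 (R : realType) (d n : nat) (Omega : set 'rV[R]_d)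
    (q : 'I_n.+1 -> 'I_n.+1 -> R) (theta : R -> R -> R)
    (closed_Omega : closed Omega)
    (convex_Omega : @convex_set R 'rV[R]_d Omega)
    (q_graph : weighted_graph q)
    (q_sym : graph_symmetric q)
    (q_conn : graph_connected q)
    (theta_interp : interpolation_function theta)
    (mu nu : 'I_n.+1 -> {finite_measure set 'rV[R]_d -> \bar R})
    (mu_P2 : prob2_vec Omega mu)
    (nu_P2 : prob2_vec Omega nu) :
  (W_dynamic Omega q theta mu nu <= D_static q theta mu nu)%E /\
  (D_static q theta mu nu <= W_2W q theta mu nu)%E.
Proof.
have [[mu0 _] _] := mu_P2; have [[nu0 _] _] := nu_P2.
split.
  apply: le_ereal_inf_tmp => _ [l1 [l2 [[l1P l2P] l1mu l2nu ->]]].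
  (* Both sides are square roots, so the infima are compared, one coupling at a time. *)
  rewrite /W_dynamic /W_lifted /W_kantorovich lee_sqrt; last exact: kantorovich_inf_ge0.
  apply: le_ereal_inf_tmp => _ [g g12 <-].
  exact: (dynamic_le_coupling closed_Omega convex_Omega q_graph q_sym q_conn theta_interp
    mu0 nu0 l1P l2P l1mu l2nu g12).
have mOmega : measurable Omega by exact: closed_mx_measurable.
have mass_mu := prob_vec_mass mOmega mu_P2.1.
have mass_nu := prob_vec_mass mOmega nu_P2.1.
apply: ereal_inf_lbound.
exists (canonical_probability mass_mu), (canonical_probability mass_nu); split=> //.
- by split; exact: canonical_prob_lifted.
- exact: canonical_projects_to.
- exact: canonical_projects_to.
Qed.
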